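(* Let $L$ and $M$ be algebraically closed fields, both contained in some common larger field, such that neither is contained in the other, and such that $L$ and $M$ are linearly disjoint over their intersection $C:=L\cap M$. Let $N:=LM$ be their compositum. Then the Galois group $G^{\mathrm{ab}}_N$ of the maximal abelian extension of $N$ is the free pro-abelian group of rank $|N|$, that is, $G^{\mathrm{ab}}_N\simeq \widehat{\mathbb Z}^{I}$ for an index set $I$ with $|I|=|N|$.
   Context: Two extensions $L_1/F$ and $L_2/F$ inside a common field are linearly disjoint over $F$ if any elements of $L_2$ that are linearly independent over $F$ remain linearly independent over $L_1$. $\widehat{\mathbb Z}$ denotes the profinite completion of $\mathbb Z$, and $\widehat{\mathbb Z}^{I}$ the product of copies of $\widehat{\mathbb Z}$ indexed by $I$. *)

(* Defs.v *)
From HB Require Import structures.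
From mathcomp Require Import all_boot all_order all_algebra.
Set Implicit Arguments. Unset Strict Implicit. Unset Printing Implicit Defensive.
Import GRing.Theory.
Local Open Scope ring_scope.

Section Subfields.
Variable F : fieldType.

Definition is_subfield (S : F -> Prop) : Prop :=
  [/\ S 0, S 1, (forall x y, S x -> S y -> S (x - y)),
      (forall x y, S x -> S y -> S (x * y)) & (forall x, S x -> S x^-1)].

Definition alg_closed_subfield (S : F -> Prop) : Prop :=
  is_subfield S /\
  forall p : {poly F}, (1 < size p)%N -> (forall i, S p`_i) ->
    exists x, S x /\ root p x.

Definition lin_indep_over (K : F -> Prop) (n : nat) (v : 'I_n -> F) : Prop :=
  forall c : 'I_n -> F, (forall i, K (c i)) ->
    \sum_(i < n) c i * v i = 0 -> forall i, c i = 0.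

Definition linearly_disjoint (C L1 L2 : F -> Prop) : Prop :=
  forall n (v : 'I_n -> F), (forall i, L2 (v i)) ->
    lin_indep_over C v -> lin_indep_over L1 v.

Definition compositum (L M : F -> Prop) (x : F) : Prop :=
  forall S, is_subfield S -> (forall y, L y -> S y) -> (forall y, M y -> S y) -> S x.

Definition same_card (I : Type) (S : F -> Prop) : Prop :=
  exists f : I -> F, (forall i, S (f i)) /\ injective f /\
    forall x, S x -> exists i, f i = x.

End Subfields.

Section MaxAbelian.
Variable K : closedFieldType.

Definition N_emb (N : K -> Prop) (s : K -> K) : Prop :=
  [/\ (forall x y, s (x + y) = s x + s y), (forall x y, s (x * y) = s x * s y),
      s 1 = 1 & (forall x, N x -> s x = x)].

(* x lies in the maximal abelian extension N^ab of N inside the algebraically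
   closed field K: x belongs to a finite set r of distinct elements with
   \prod_(y in r) (X - y) in N[X] (so N(r) is a finite Galois extension of N)
   on which all N-embeddings of K commute (i.e. Gal(N(r)/N) is abelian). *)
Definition max_ab_ext (N : K -> Prop) (x : K) : Prop :=
  exists r : seq K,
    [/\ x \in r, uniq r,
        (forall i, N (\prod_(y <- r) ('X - y%:P))`_i) &
        (forall s t, N_emb N s -> N_emb N t ->
           forall y, y \in r -> s (t y) = t (s y))].

(* a : nat -> nat is an element of Zhat = lim Z/(n+1)Z, a n being the
   residue modulo n+1 *)
Definition zhat_elt (a : nat -> nat) : Prop :=
  (forall n, (a n < n.+1)%N) /\
  (forall m n, (m.+1 %| n.+1)%N -> a n %% m.+1 = a m)%N.

(* Phi induces an isomorphism of topological groups
   Gal(N^ab/N) ~ Zhat^I.  Gal(N^ab/N) is modelled as the N-embeddings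
   of K modulo agreement on N^ab (restriction to N^ab is surjective onto
   Aut(N^ab/N)); the Krull topology has basic neighbourhoods of the identity
   the pointwise stabilizers of finite subsets of N^ab; Zhat^I carries the
   product of the profinite topologies, with basic neighbourhoods of 0 given
   by a finite set of coordinates j and a modulus k+1. *)
Definition galois_ab_iso_zhat_pow (N : K -> Prop) (I : Type)
    (Phi : (K -> K) -> I -> nat -> nat) : Prop :=
  (forall s, N_emb N s -> forall i, zhat_elt (Phi s i)) /\
  (forall s t, N_emb N s -> N_emb N t ->
     (forall y, max_ab_ext N y -> s y = t y) -> forall i n, Phi s i n = Phi t i n) /\
  (forall s t, N_emb N s -> N_emb N t ->
     forall i n, Phi (s \o t) i n = (Phi s i n + Phi t i n) %% n.+1)%N /\
  (forall s t, N_emb N s -> N_emb N t ->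
     (forall i n, Phi s i n = Phi t i n) -> forall y, max_ab_ext N y -> s y = t y) /\
  (forall z : I -> nat -> nat, (forall i, zhat_elt (z i)) ->
     exists s, N_emb N s /\ forall i n, Phi s i n = z i n) /\
  (forall m (j : 'I_m -> I) (k : nat), exists l (y : 'I_l -> K),
     (forall u, max_ab_ext N (y u)) /\
     forall s, N_emb N s -> (forall u, s (y u) = y u) -> forall u, Phi s (j u) k = 0%N) /\
  (forall l (y : 'I_l -> K), (forall u, max_ab_ext N (y u)) ->
     exists m (j : 'I_m -> I) (k : nat),
     forall s, N_emb N s -> (forall u, Phi s (j u) k = 0%N) -> forall u, s (y u) = y u).

End MaxAbelian.

(* Main.v *)
Require Import Defs.
From HB Require Import structures.
From mathcomp Require Import all_boot all_order all_algebra all_fingroup.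
From mathcomp Require Import all_solvable all_field all_character.
From mathcomp Require Import boolp classical_sets functions cardinality filter.
From mathcomp Require Import ring.

(* With [N = LM] and [G] the monoid of [N]-embeddings of [K], the group in
   question is the Pontryagin dual of the torsion group [X] of continuous
   characters [G -> Z/n], so it suffices that [X] is divisible and that each
   [X[l]], [l] prime, has dimension [|N|] over [F_l]: compatible lifts to [Zhat]
   of bases of the [X[l]] are then the coordinates.  By Kummer and Artin-Schreier
   theory [X[l]] embeds into [N]; a character mod [l^k] lifts mod [l^(k+1)] by
   extracting a root, or by Albert's construction if [l] is the characteristic.
   For the lower bound, take [y] in [M] but not in [L]: the classes of the
   [y - a] modulo [l]-th powers (of the [1/(y - a)] modulo the image of
   [z -> z^p - z]), for [a] in [L] but not in [M], are independent.  Indeed let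
   [C'] be maximal among the subfields of [M] containing [C] over which [y] is
   transcendental, [Q = C'(y)] and [P = LQ], so that [M] is algebraic over [Q]
   and [P] meets [M] in [Q].  An [l]-th root in [N] of an element of [P] is, up to
   Frobenius, a product of an element of [M] and one of [P], so a relation
   becomes [f = q v^l] with [q] in [Q] and [v] in [P]; now compare the
   multiplicities at [y = a], which is neither a zero nor a pole of [q]. *)

Set Implicit Arguments. Unset Strict Implicit. Unset Printing Implicit Defensive.
Import GRing.Theory.
Local Open Scope ring_scope.

(** * Subfields and algebraic elements *)

(** Embeddings replace automorphisms because [K] may be transcendental over [N], and then they need
    not be invertible. To produce enough of them, [N] is enlarged to some [N'] over which [K] is
    algebraic and in which [N] is algebraically closed; an element algebraic over [N] and fixed by
    the [N']-embeddings still lies in [N], because [N], a compositum of perfect fields, is perfect.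
    Why a root [z] splits: an embedding [s] over [P] multiplies [z] by a root of unity (or
    translates it by an element of the prime field), which lies in [M]. If [z] is written as a
    fraction along independent elements of [L], then [s] acts only on the coefficients, which are in
    [M], and disjointness determines how. The Frobenius exponent comes from the possible
    inseparability of [M] over [Q]. The point [a] is harmless for [q] because numerator and
    denominator of [q] have coefficients in [C'], so their roots lie in [M]. The points [a] fill [L]
    minus [M], which has the size of [N] when [L] is the larger of the two fields; otherwise [L] and
    [M] exchange roles. *)

Definition is_subring (F : fieldType) (S : F -> Prop) : Prop :=
  [/\ S 0, S 1, (forall x y, S x -> S y -> S (x - y)) &
      (forall x y, S x -> S y -> S (x * y))].

Definition poly_in (F : fieldType) (S : F -> Prop) (f : {poly F}) : Prop :=
  forall i, S f`_i.

Section Subring.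
Variables (F : fieldType) (S : F -> Prop).
Implicit Types (x y : F) (f g : {poly F}).

Lemma subfield_subring : is_subfield S -> is_subring S.
Proof. by case=> s0 s1 sB sM _; split. Qed.

Lemma subfieldV x : is_subfield S -> S x -> S x^-1.
Proof. by case=> s0 s1 sB sM sV; apply: sV. Qed.

Hypothesis hS : is_subring S.

Lemma subring0 : S 0. Proof. by case: hS. Qed.
Lemma subring1 : S 1. Proof. by case: hS. Qed.
Lemma subringB x y : S x -> S y -> S (x - y). Proof. by case: hS => _ _ sB _; apply: sB. Qed.
Lemma subringM x y : S x -> S y -> S (x * y). Proof. by case: hS => _ _ _ sM; apply: sM. Qed.
Lemma subringN x : S x -> S (- x). Proof. by rewrite -sub0r; apply/subringB/subring0. Qed.
Lemma subringD x y : S x -> S y -> S (x + y).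
Proof. by move=> sx sy; rewrite -[y]opprK; apply/subringB/subringN. Qed.
Lemma subring_sum I (r : seq I) (P : pred I) (G : I -> F) :
  (forall i, P i -> S (G i)) -> S (\sum_(i <- r | P i) G i).
Proof. by move=> h; apply: big_ind => //; [apply: subring0 | apply: subringD]. Qed.
Lemma subring_prod I (r : seq I) (P : pred I) (G : I -> F) :
  (forall i, P i -> S (G i)) -> S (\prod_(i <- r | P i) G i).
Proof. by move=> h; apply: big_ind => //; [apply: subring1 | apply: subringM]. Qed.
Lemma subringX x n : S x -> S (x ^+ n).
Proof.
by move=> sx; elim: n => [|n IH]; rewrite ?expr0 ?exprS; [apply: subring1 | apply: subringM].
Qed.
Lemma subringMn x n : S x -> S (x *+ n).
Proof.
by move=> sx; elim: n => [|n IH]; rewrite ?mulr0n ?mulrS; [apply: subring0 | apply: subringD].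
Qed.
Lemma subringMz x m : S x -> S (x *~ m).
Proof. by move=> sx; case: m => n; [|apply: subringN]; apply: subringMn. Qed.

Lemma poly_inC x : S x -> poly_in S x%:P.
Proof. by move=> sx i; rewrite coefC; case: ifP => // _; apply: subring0. Qed.
Lemma poly_in0 : poly_in S 0. Proof. by move=> i; rewrite coef0; apply: subring0. Qed.
Lemma poly_in1 : poly_in S 1. Proof. by apply/poly_inC/subring1. Qed.
Lemma poly_inX : poly_in S 'X.
Proof. by move=> i; rewrite coefX; case: eqP => _; [apply: subring1 | apply: subring0]. Qed.
Lemma poly_inB f g : poly_in S f -> poly_in S g -> poly_in S (f - g).
Proof. by move=> sf sg i; rewrite coefB; apply: subringB. Qed.
Lemma poly_inD f g : poly_in S f -> poly_in S g -> poly_in S (f + g).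
Proof. by move=> sf sg i; rewrite coefD; apply: subringD. Qed.
Lemma poly_inM f g : poly_in S f -> poly_in S g -> poly_in S (f * g).
Proof. by move=> sf sg i; rewrite coefM; apply: subring_sum => j _; apply: subringM. Qed.
Lemma poly_inXn f n : poly_in S f -> poly_in S (f ^+ n).
Proof.
by move=> sf; elim: n => [|n IH]; rewrite ?expr0 ?exprS; [apply: poly_in1 | apply: poly_inM].
Qed.
Lemma poly_in_sum I (r : seq I) (P : pred I) (G : I -> {poly F}) :
  (forall i, P i -> poly_in S (G i)) -> poly_in S (\sum_(i <- r | P i) G i).
Proof. by move=> h; apply: big_ind => //; [apply: poly_in0 | apply: poly_inD]. Qed.
Lemma poly_in_prod I (r : seq I) (P : pred I) (G : I -> {poly F}) :
  (forall i, P i -> poly_in S (G i)) -> poly_in S (\prod_(i <- r | P i) G i).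
Proof. by move=> h; apply: big_ind => //; [apply: poly_in1 | apply: poly_inM]. Qed.
Lemma horner_in f x : poly_in S f -> S x -> S f.[x].
Proof.
by move=> sf sx; rewrite horner_coef; apply: subring_sum => i _; apply/subringM/subringX.
Qed.

End Subring.

Section SubfieldType.
Variables (F : fieldType) (S : F -> Prop) (hS : is_subfield S).

(** The proof [hS] is a parameter of the predicate so that closure under the field operations can be
    registered as an instance for it. *)
Definition sf_pred of is_subfield S : {pred F} := fun x => `[< S x >].
Record sf_type := SfType {sf_val : F; sf_valP : sf_val \in sf_pred hS}.

HB.instance Definition _ := [isSub for sf_val].
HB.instance Definition _ := [Choice of sf_type by <:].

Fact sf_pred_closed : divring_closed (sf_pred hS).
Proof.
have [s0 s1 sB sM sV] := hS.
split=> [|x y|x y]; first by apply/asboolP.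
- by move=> /asboolP sx /asboolP sy; apply/asboolP/sB.
- by move=> /asboolP sx /asboolP sy; apply/asboolP/sM/sV.
Qed.
HB.instance Definition _ := GRing.isDivringClosed.Build F (sf_pred hS) sf_pred_closed.
HB.instance Definition _ := [SubChoice_isSubIntegralDomain of sf_type by <:].
HB.instance Definition _ := [SubIntegralDomain_isSubField of sf_type by <:].

End SubfieldType.

(** Bridge from subfields given as predicates to the theory of polynomials and algebraic elements
    over a field type: [S] becomes the image of an abstract field [E]. *)
Lemma subfield_model (F : fieldType) (S : F -> Prop) : is_subfield S ->
  exists (E : fieldType) (e : {rmorphism E -> F}),
    (forall u, S (e u)) /\ (forall x, S x -> exists u, e u = x).
Proof.
move=> hS; exists (sf_type hS), (val : sf_type hS -> F); split=> [u|x Sx].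
  by have /asboolP := valP u.
by exists (SfType (asboolT Sx : x \in sf_pred hS)).
Qed.

Definition algP (F : fieldType) (P : F -> Prop) (x : F) : Prop :=
  exists f : {poly F}, [/\ f != 0, poly_in P f & root f x].

Section Model.
Variables (F E : fieldType) (S : F -> Prop) (e : {rmorphism E -> F}).
Hypotheses (eS : forall u, S (e u)) (Se : forall x, S x -> exists u, e u = x).

Lemma poly_in_lift f : poly_in S f -> exists g : {poly E}, map_poly e g = f.
Proof.
move=> sf; have [c cE] := choice (fun i => Se (sf i)).
exists (\poly_(i < size f) c i); apply/polyP => i; rewrite coef_map coef_poly.
by case: ltnP => hi; rewrite ?raddf0 ?(nth_default _ hi) //= cE.
Qed.

Lemma poly_in_map (g : {poly E}) : poly_in S (map_poly e g).
Proof. by move=> i; rewrite coef_map; apply: eS. Qed.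

Lemma algPE x : algP S x <-> algebraicOver e x.
Proof.
split=> [[f [f0 sf fx]]|[g g0 gx]].
  have [g gf] := poly_in_lift sf.
  by exists g; [apply: contra_neq f0 => g0; rewrite -gf g0 map_poly0 | rewrite gf].
exists (map_poly e g); split=> //; first by rewrite map_poly_eq0.
exact: poly_in_map.
Qed.

End Model.

Section Algebraic.
Variables (F : fieldType) (P : F -> Prop).
Hypothesis hP : is_subfield P.
Let hR := subfield_subring hP.
Lemma alg_id x : P x -> algP P x.
Proof.
have [E [e [eP Pe]]] := subfield_model hP.
by move=> /Pe[u <-]; apply/(algPE eP Pe)/algebraic_id.
Qed.

Lemma alg_root (f : {poly F}) x : f != 0 -> (forall i, algP P f`_i) -> root f x -> algP P x.
Proof.
have [E [e [eP Pe]]] := subfield_model hP; have PE := algPE eP Pe.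
move=> f0 af fx; apply/PE/integral_algebraic/(integral_root (p := f)) => //.
by apply/integral_poly => i; apply/integral_algebraic/PE.
Qed.

Lemma alg_subfield : is_subfield (algP P).
Proof.
have [E [e [eP Pe]]] := subfield_model hP; have PE := algPE eP Pe.
have h0 := subring0 hR; have h1 := subring1 hR.
split; [exact: alg_id | exact: alg_id | | |].
- by move=> x y /PE ? /PE ?; apply/PE/algebraic_sub.
- by move=> x y /PE ? /PE ?; apply/PE/algebraic_mul.
- by move=> x /PE ?; apply/PE/algebraic_inv.
Qed.

Lemma algX_inv x n : (0 < n)%N -> algP P (x ^+ n) -> algP P x.
Proof.
move=> n0 ax; have hA := subfield_subring alg_subfield.
apply: (@alg_root ('X^n - (x ^+ n)%:P)); last by rewrite /root !hornerE subrr.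
  by rewrite -size_poly_eq0 size_XnsubC.
by apply: (poly_inB hA); [apply/(poly_inXn hA)/(poly_inX hA) | apply: poly_inC].
Qed.

End Algebraic.

Lemma alg_sub (F : fieldType) (P Q : F -> Prop) x :
  (forall y, P y -> Q y) -> algP P x -> algP Q x.
Proof. by move=> PQ [f [f0 sf fx]]; exists f; split=> // i; apply: PQ. Qed.

(** Algebraic closedness only provides some root in [M], not the given root [w]. So linear factors
    with root in [M] are split off, the quotient keeping its coefficients in [M], until [w] is one
    of these roots. *)
Lemma alg_closed_in (F : fieldType) (M : F -> Prop) w :
  alg_closed_subfield M -> algP M w -> M w.
Proof.
move=> [hM cM] [f [f0 Mf fw]]; have hR := subfield_subring hM; have [E [e [eM Me]]] := subfield_model hM.
have [n] := ubnP (size f); elim: n => // n IH in f f0 Mf fw *.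
rewrite ltnS => szf.
have sz1 : (1 < size f)%N.
  rewrite ltnNge; apply/negP => /size1_polyC fc; move: f0 fw.
  by rewrite fc /root hornerC polyC_eq0 => /negPf ->.
have [x [Mx fx]] := cM _ sz1 Mf.
have [u ux] := Me _ Mx; have [g gf] := poly_in_lift Me Mf.
have gu : root g u.
  by rewrite -gf -ux in fx; rewrite -(fmorph_root (e)).
have [h gE] := factor_theorem _ _ gu.
have fE : f = map_poly e h * ('X - x%:P).
  by rewrite -gf gE rmorphM /= map_polyXsubC ux.
have h0 : map_poly e h != 0 by apply: contra_neq f0 => h0; rewrite fE h0 mul0r.
move: fw; rewrite fE rootM root_XsubC => /orP[hw|/eqP-> //].
apply: (IH _ h0 (poly_in_map eM _) hw).
by move: szf; rewrite fE size_Mmonic ?monicXsubC // size_XsubC addn2.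
Qed.

(** These fractions form a field even if [S] is only a subring, a case needed for the ring generated
    by [L] and [C']. *)
Definition adjoin (F : fieldType) (S : F -> Prop) (x w : F) : Prop :=
  exists f g, [/\ poly_in S f, poly_in S g, g.[x] != 0 & w = f.[x] / g.[x]].

Section Adjoin.
Variables (F : fieldType) (S : F -> Prop) (x : F).
Hypothesis hS : is_subring S.

Lemma adjoin_horner f : poly_in S f -> adjoin S x f.[x].
Proof.
move=> sf; exists f, 1; split=> //; first exact: poly_in1.
  by rewrite hornerE oner_eq0.
by rewrite hornerE divr1.
Qed.

Lemma adjoin_sub w : S w -> adjoin S x w.
Proof. by move=> sw; rewrite -(hornerC w x); apply/adjoin_horner/(poly_inC hS). Qed.

Lemma adjoin_id : adjoin S x x.
Proof. by rewrite -{2}(hornerX x); apply/adjoin_horner/(poly_inX hS). Qed.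

Lemma adjoin_subfield : is_subfield (adjoin S x).
Proof.
split.
- by apply/adjoin_sub/(subring0 hS).
- by apply/adjoin_sub/(subring1 hS).
- move=> _ _ [f [g [sf sg g0 ->]]] [f' [g' [sf' sg' g0' ->]]].
  exists (f * g' - f' * g), (g * g'); split.
  + by apply: poly_inB => //; apply: poly_inM.
  + exact: poly_inM.
  + by rewrite hornerM mulf_neq0.
  + by rewrite !hornerE -mulNr addf_div // mulNr.
- move=> _ _ [f [g [sf sg g0 ->]]] [f' [g' [sf' sg' g0' ->]]].
  exists (f * f'), (g * g'); split; try exact: poly_inM.
  + by rewrite hornerM mulf_neq0.
  + by rewrite !hornerM mulf_div.
- move=> _ [f [g [sf sg g0 ->]]]; rewrite invf_div.
  have [f0|f0] := eqVneq f.[x] 0; last by exists g, f.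
  by rewrite f0 invr0 mulr0; apply/adjoin_sub/(subring0 hS).
Qed.

End Adjoin.

(** * Extension of embeddings *)

Section ZornAbove.
Local Open Scope classical_set_scope.

(** The usual form of Zorn's lemma is applied to the sets [X] whose union with [A0] satisfies [P];
    the result contains [A0], and only nonempty chains have to be examined. *)
Lemma Zorn_above T (P : set (set T)) A0 : P A0 ->
    (forall F : set (set T), F !=set0 -> F `<=` P -> total_on F subset ->
       P (\bigcup_(X in F) X)) ->
  exists A, [/\ A0 `<=` A, P A & forall B, A `<=` B -> P B -> B `<=` A].
Proof.
move=> P0 hP; have [|A [PA Amax]] := @Zorn_bigcup T [set X | P (A0 `|` X)].
  move=> F FP Ft /=.
  (* Having [A0] itself as a member makes the chain nonempty even when [F] is empty. *)
  have -> : A0 `|` \bigcup_(X in F) X =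
      \bigcup_(Y in [set Y | Y = A0 \/ exists2 X, F X & Y = A0 `|` X]) Y.
    apply/seteqP; split=> x /= [].
    - by move=> ax; exists A0 => //; left.
    - by move=> [X FX Xx]; exists (A0 `|` X); [right; exists X|right].
    - by move=> _ [->|[X FX ->]]; [left|case; [left|right; exists X]].
  apply: hP; first by exists A0; left.
  - by move=> _ [->|[X FX ->]] //; apply: FP.
  - move=> _ _ [->|[X FX ->]] [->|[Y FY ->]]; [by left|by left|by right|].
    by have [h|h] := Ft _ _ FX FY; [left|right]; apply: setUS.
exists (A0 `|` A); split=> // B AB PB x Bx; apply: contrapT => nx.
apply: (Amax B); last by rewrite /= (_ : A0 `|` B = B) //; apply/setUidPr => y ?; apply: AB; left.
split=> [y Ay|]; first by apply: AB; right.
by move=> BA; apply: nx; right; apply: BA.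
Qed.

(** This is why finitary conditions survive unions of chains: finitely many elements of the union
    already occur together in one member. *)
Lemma chain_seq T (I : eqType) (F : set (set T)) (r : seq I) (h : I -> T) : F !=set0 ->
    total_on F subset -> (forall i, i \in r -> (\bigcup_(X in F) X) (h i)) ->
  exists2 X, F X & forall i, i \in r -> X (h i).
Proof.
move=> [X0 FX0] Ft; elim: r => [|i r IH] hr; first by exists X0.
have [|X FX Xr] := IH; first by move=> j jr; apply: hr; rewrite inE jr orbT.
have [Y FY Yi] := hr i (mem_head _ _).
have [YX|XY] := Ft _ _ FY FX; [exists X => // | exists Y => //] => j.
  by rewrite inE => /orP[/eqP->|/Xr//]; apply: YX.
by rewrite inE => /orP[/eqP->//|/Xr/XY].
Qed.

Lemma chain_subfield (F : fieldType) (C : set (set F)) : C !=set0 -> total_on C subset ->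
  (forall X, C X -> is_subfield X) -> is_subfield (\bigcup_(X in C) X).
Proof.
move=> C0 Ct Cs; have [X0 CX0] := C0.
have two x y : (\bigcup_(X in C) X) x -> (\bigcup_(X in C) X) y ->
    exists2 X, C X & X x /\ X y.
  move=> hx hy; have [|X CX Xr] := @chain_seq _ _ C [:: x; y] id C0 Ct.
    by move=> z; rewrite !inE => /orP[]/eqP->.
  by exists X => //; split; apply: Xr; rewrite !inE eqxx ?orbT.
split.
- by exists X0 => //; case: (Cs _ CX0).
- by exists X0 => //; case: (Cs _ CX0).
- by move=> x y hx hy; have [X CX [Xx Xy]] := two _ _ hx hy; exists X => //;
    case: (Cs _ CX) => _ _ sB _ _; apply: sB.
- by move=> x y hx hy; have [X CX [Xx Xy]] := two _ _ hx hy; exists X => //;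
    case: (Cs _ CX) => _ _ _ sM _; apply: sM.
- by move=> x [X CX Xx]; exists X => //; case: (Cs _ CX) => _ _ _ _; apply.
Qed.

Lemma chain_alg (F : fieldType) (C : set (set F)) x : C !=set0 -> total_on C subset ->
  algP (\bigcup_(X in C) X) x -> exists2 X, C X & algP X x.
Proof.
move=> C0 Ct [f [f0 fC fx]].
(* The extra index [size f] puts 0 into [X], which covers every coefficient past the leading one. *)
have [|X CX Xf] := @chain_seq _ _ C (iota 0 (size f).+1) (fun i => f`_i) C0 Ct.
  by move=> i _; apply: fC.
exists X => //; exists f; split=> // i; have [le_fi|lt_if] := leqP (size f) i.
  have := Xf (size f); rewrite mem_iota leq0n add0n ltnSn => /(_ isT).
  by rewrite !nth_default.
by have := Xf i; rewrite mem_iota leq0n add0n ltnS ltnW // => /(_ isT).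
Qed.

End ZornAbove.

Definition hom_on (F : fieldType) (E : F -> Prop) (s : F -> F) : Prop :=
  [/\ (forall x y, E x -> E y -> s (x + y) = s x + s y),
      (forall x y, E x -> E y -> s (x * y) = s x * s y) & s 1 = 1].

Section HomOn.
Variables (F : fieldType) (E : F -> Prop) (s : F -> F).
Hypotheses (hE : is_subfield E) (hs : hom_on E s).
Let hR := subfield_subring hE.

Lemma hom_on0 : s 0 = 0.
Proof.
case: hs => sD _ _; have := sD 0 0 (subring0 hR) (subring0 hR).
by rewrite addr0 => /(congr1 (fun z => z - s 0)); rewrite subrr addrK.
Qed.

Lemma hom_onB x y : E x -> E y -> s (x - y) = s x - s y.
Proof.
move=> Ex Ey; case: hs => sD _ _; have := sD (x - y) y (subringB hR Ex Ey) Ey.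
by rewrite subrK => ->; rewrite addrK.
Qed.

Lemma hom_on_model (E0 : fieldType) (e : {rmorphism E0 -> F}) : (forall u, E (e u)) ->
  exists j : {rmorphism E0 -> F}, forall u, j u = s (e u).
Proof.
move=> eE; case: (hs) => sD sM s1.
have jB : zmod_morphism (fun u => s (e u)).
  by move=> u v /=; rewrite rmorphB hom_onB.
have jM : monoid_morphism (fun u => s (e u)).
  by split=> [|u v] /=; rewrite ?rmorph1 // rmorphM sM.
pose aj := GRing.isZmodMorphism.Build _ _ (fun u => s (e u)) jB.
pose mj := GRing.isMonoidMorphism.Build _ _ (fun u => s (e u)) jM.
pose j : {rmorphism E0 -> F} := HB.pack (fun u => s (e u)) aj mj.
by exists j.
Qed.

End HomOn.

(** * Extending a homomorphism to one more element *)

Section SimpleExtension.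
Variables (E0 F : fieldType) (i j : {rmorphism E0 -> F}).

Lemma minpoly_exists x : algebraicOver i x ->
  exists p, [/\ p != 0, root (map_poly i p) x &
             forall f, root (map_poly i f) x -> p %| f].
Proof.
move=> [q q0 qx]; have ex : exists n, `[< exists p, [/\ p != 0, root (map_poly i p) x & size p = n] >].
  by exists (size q); apply/asboolP; exists q.
case: (ex_minnP ex) => n /asboolP[p [p0 px szp]] nmin.
exists p; split=> // f fx; apply/modp_eq0P/eqP; apply: contraT => r0.
have := ltn_modpN0 f p0; rewrite ltnNge szp nmin //; apply/asboolP.
exists (f %% p); split=> //; move: fx; rewrite {1}(divp_eq f p) rmorphD rmorphM /= /root.
by rewrite hornerD hornerM (rootP px) mulr0 add0r.
Qed.

Lemma minpoly_roots x x' p : p != 0 -> root (map_poly i p) x ->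
    (forall f, root (map_poly i f) x -> p %| f) -> root (map_poly j p) x' ->
  forall f, root (map_poly i f) x = root (map_poly j f) x'.
Proof.
move=> p0 px pmin px' f; apply/idP/idP => [/pmin|fx'].
  by rewrite -(dvdp_map j) => /dvdpP[q ->]; rewrite rootM px' orbT.
(* If [f] vanishes at [x'] but not at [x], a common factor of [p] and [f] would leave a cofactor of
   [p] of smaller degree vanishing at [x], against minimality. So [p] and [f] are coprime, and a
   Bezout relation is contradicted at [x']. *)
apply: contraT => fx; suff: coprimep p f.
  move=> /Bezout_coprimepP[[u v] /= uv1].
  have: root (map_poly j (u * p + v * f)) x'.
    by rewrite rmorphD !rmorphM /= /root hornerD !hornerM (rootP px') (rootP fx') !mulr0 addr0.
  by move: uv1; rewrite -(eqp_map j) rmorph1 => /eqp_root->; rewrite (negPf (root1 _)).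
set g := gcdp p f; have [h pE] := dvdpP _ _ (dvdp_gcdl p f).
have: root (map_poly i h) x.
  move: px; rewrite pE rmorphM rootM => /orP[//|gx].
  by case/negP: fx; have := dvdp_gcdr p f; rewrite -(dvdp_map i) => /dvdpP[q ->]; rewrite rootM gx orbT.
move=> /pmin ph; have h0 : h != 0 by apply: contra_neq p0 => h0; rewrite pE h0 mul0r.
have g0 : g != 0 by rewrite gcdp_eq0 negb_and p0.
have := dvdp_leq h0 ph; rewrite {1}pE size_mul // -/g.
rewrite /coprimep -/g -[(_ == 1)%N]negbK; case: (size g) (size_poly_gt0 g) => [|[|k]] //.
  by rewrite g0.
by rewrite addnS /= => _; rewrite addnS ltnNge leq_addr.
Qed.

(** The map sends [f(x) / g(x)] to [f(x') / g(x')]; by hypothesis denominators vanish together and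
    the value does not depend on the fraction. [V] is the graph of this map, turned into a function
    by choice. *)
Lemma simple_ext x x' :
    (forall f, root (map_poly i f) x = root (map_poly j f) x') ->
  exists E s, [/\ is_subfield E, hom_on E s, E x, s x = x' &
               forall u, E (i u) /\ s (i u) = j u].
Proof.
move=> hroot.
pose V w w' := exists f g, [/\ ~~ root (map_poly i g) x,
   w = (map_poly i f).[x] / (map_poly i g).[x] & w' = (map_poly j f).[x'] / (map_poly j g).[x']].
have Vfun w w1 w2 : V w w1 -> V w w2 -> w1 = w2.
  move=> [f [g [g0 -> ->]]] [f' [g' [g0' wE ->]]].
  have g0j := g0; have g0j' := g0'; rewrite hroot in g0j; rewrite hroot in g0j'.
  apply/eqP; rewrite eqr_div // -subr_eq0 -!hornerM -hornerN -hornerD -!rmorphM -rmorphB.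
  change (root (map_poly j (f * g' - f' * g)) x'); rewrite -hroot /root rmorphB !rmorphM.
  rewrite hornerD hornerN !hornerM subr_eq0 -eqr_div //; exact/eqP.
have Vh f : V (map_poly i f).[x] (map_poly j f).[x'].
  by exists f, 1; rewrite !rmorph1 !hornerC !divr1 root1.
have VB w1 w1' w2 w2' : V w1 w1' -> V w2 w2' -> V (w1 - w2) (w1' - w2').
  move=> [f [g [g0 -> ->]]] [f' [g' [g0' -> ->]]].
  have g0j := g0; have g0j' := g0'; rewrite hroot in g0j; rewrite hroot in g0j'.
  exists (f * g' - f' * g), (g * g'); rewrite !rmorphB !rmorphM rootM negb_or g0 g0' /=.
  by rewrite !(hornerM, hornerD, hornerN) -!mulNr !addf_div.
have VM w1 w1' w2 w2' : V w1 w1' -> V w2 w2' -> V (w1 * w2) (w1' * w2').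
  move=> [f [g [g0 -> ->]]] [f' [g' [g0' -> ->]]].
  exists (f * f'), (g * g'); rewrite !rmorphM rootM negb_or g0 g0' /=.
  by rewrite !hornerM !mulf_div.
have V0 : V 0 0 by have := Vh 0; rewrite !rmorph0 !horner0.
have V1 : V 1 1 by have := Vh 1; rewrite !rmorph1 !hornerC.
have VV w w' : V w w' -> V w^-1 w'^-1.
  move=> [f [g [g0 wE wE']]]; have [f0|f0] := boolP (root (map_poly i f) x); last first.
    by exists g, f; rewrite f0 wE wE' !invf_div.
  by move: (f0); rewrite wE wE' (rootP f0) hroot => /rootP->; rewrite !mul0r invr0.
pose s w := xget 0 (V w).
have sE w w' : V w w' -> s w = w'.
  by move=> h; apply: Vfun (h); rewrite /s; case: xgetP => // /(_ w').
exists (fun w => exists w', V w w'), s; split.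
- split; [by exists 0|by exists 1| | |].
  + by move=> w1 w2 [w1' h1] [w2' h2]; exists (w1' - w2'); apply: VB.
  + by move=> w1 w2 [w1' h1] [w2' h2]; exists (w1' * w2'); apply: VM.
  + by move=> w1 [w1' h1]; exists w1'^-1; apply: VV.
- split; last exact: sE.
  + move=> w1 w2 [w1' h1] [w2' h2]; rewrite (sE _ _ h1) (sE _ _ h2).
    have h2' := VB _ _ _ _ V0 h2; rewrite !sub0r in h2'.
    by rewrite -[w2]opprK -[w2']opprK; apply/sE/VB.
  + by move=> w1 w2 [w1' h1] [w2' h2]; rewrite (sE _ _ h1) (sE _ _ h2); apply/sE/VM.
- by exists x'; have := Vh 'X; rewrite !map_polyX !hornerX.
- by apply: sE; have := Vh 'X; rewrite !map_polyX !hornerX.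
- move=> u; have := Vh u%:P; rewrite !map_polyC !hornerC => h.
  by split; [exists (j u)|apply: sE].
Qed.

End SimpleExtension.

Section Extension.
Local Open Scope classical_set_scope.

(** Partial homomorphisms are encoded by their graphs, so that extension becomes inclusion and
    Zorn's lemma for sets applies. *)
Definition hom_graph (F : fieldType) (G : set (F * F)) : Prop :=
  exists E s, [/\ is_subfield E, hom_on E s & forall x y, G (x, y) <-> E x /\ y = s x].

Lemma chain_hom_graph (F : fieldType) (C : set (set (F * F))) : C !=set0 ->
    C `<=` @hom_graph F -> total_on C subset -> hom_graph (\bigcup_(X in C) X).
Proof.
move=> C0 Cg Ct; set U := \bigcup_(X in C) X; have [X0 CX0] := C0.
have two x x' y y' : U (x, x') -> U (y, y') ->
    exists E s, [/\ is_subfield E, hom_on E s,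
      (forall x y, E x /\ y = s x -> U (x, y)), E x /\ x' = s x & E y /\ y' = s y].
  move=> hx hy; have [|X CX Xr] := @chain_seq _ _ C [:: (x, x'); (y, y')] id C0 Ct.
    by move=> z; rewrite !inE => /orP[]/eqP->.
  have [E [s [Es hs EX]]] := Cg _ CX; exists E, s; split=> //.
  - by move=> u v /EX ?; exists X.
  - by apply/EX/Xr; rewrite !inE eqxx.
  - by apply/EX/Xr; rewrite !inE eqxx orbT.
have Ufun x y z : U (x, y) -> U (x, z) -> y = z.
  by move=> h1 h2; have [E [s [_ _ _ [_ ->] [_ ->]]]] := two _ _ _ _ h1 h2.
pose s x := xget 0 [set y | U (x, y)].
have sE x y : U (x, y) -> s x = y.
  by move=> h; apply: Ufun (h); rewrite /s; case: xgetP => // /(_ y).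
have [E0 [s0 [hE0 hs0 EX0]]] := Cg _ CX0; have hR0 := subfield_subring hE0.
have U0 : U (0, 0).
  by exists X0 => //; apply/EX0; rewrite (hom_on0 hE0 hs0); split=> //; apply: (subring0 hR0).
have U1 : U (1, 1).
  by exists X0 => //; apply/EX0; case: hs0 => _ _ ->; split=> //; apply: (subring1 hR0).
exists (fun x => exists y, U (x, y)), s; split; [split|split|].
- by exists 0.
- by exists 1.
- move=> x y [x' hx] [y' hy]; have [E [t [hE ht EU [Ex x'E] [Ey y'E]]]] := two _ _ _ _ hx hy.
  exists (t (x - y)); apply: EU; split=> //.
  exact: subringB (subfield_subring hE) _ _ _ _.
- move=> x y [x' hx] [y' hy]; have [E [t [hE ht EU [Ex x'E] [Ey y'E]]]] := two _ _ _ _ hx hy.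
  exists (t (x * y)); apply: EU; split=> //.
  exact: subringM (subfield_subring hE) _ _ _ _.
- move=> x [x' hx]; have [E [t [hE ht EU [Ex x'E] _]]] := two _ _ _ _ hx hx.
  by exists (t x^-1); apply: EU; split=> //; apply: subfieldV.
- move=> x y [x' hx] [y' hy]; have [E [t [hE ht EU [Ex x'E] [Ey y'E]]]] := two _ _ _ _ hx hy.
  case: (ht) => tD _ _; rewrite (sE _ _ hx) (sE _ _ hy) x'E y'E -tD //.
  apply/sE/EU; split=> //; exact: subringD (subfield_subring hE) _ _ _ _.
- move=> x y [x' hx] [y' hy]; have [E [t [hE ht EU [Ex x'E] [Ey y'E]]]] := two _ _ _ _ hx hy.
  case: (ht) => _ tM _; rewrite (sE _ _ hx) (sE _ _ hy) x'E y'E -tM //.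
  apply/sE/EU; split=> //; exact: subringM (subfield_subring hE) _ _ _ _.
- exact: sE.
- move=> x y; split=> [h|[[y' h] ->]]; first by split; [exists y|rewrite (sE _ _ h)].
  by rewrite (sE _ _ h).
Qed.

Variable K : closedFieldType.

Lemma closed_root (p : {poly K}) : (1 < size p)%N -> exists x, root p x.
Proof. by move=> sp; apply: closed_rootP; rewrite neq_ltn sp orbT. Qed.

(** A maximal graph has full domain: any [x] is algebraic over the domain, and the closed field [K]
    has a root of the transported minimal polynomial, to which [x] can be sent. *)
Lemma ext_emb (P E : K -> Prop) (s : K -> K) : is_subfield P -> (forall x, algP P x) ->
    is_subfield E -> hom_on E s -> (forall x, P x -> E x /\ s x = x) ->
  exists t, N_emb P t /\ forall x, E x -> t x = s x.
Proof.
move=> hP aP hE hs hPE.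
have [|G [sG hG maxG]] := @Zorn_above _ (@hom_graph K) [set w | E w.1 /\ w.2 = s w.1] _ (@chain_hom_graph K).
  by exists E, s; split.
have [E1 [s1 [hE1 hs1 GE]]] := hG.
have EE1 x : E x -> E1 x /\ s1 x = s x.
  by move=> Ex; have /GE[E1x ->] : G (x, s x) by apply: sG.
have PE1 x : P x -> E1 x by move=> /hPE[/EE1[]].
have [E0 [e [eE Ee]]] := subfield_model hE1.
have [j jE] := hom_on_model hE1 hs1 eE.
have E1T x : E1 x.
  have /(algPE eE Ee)/minpoly_exists[p [p0 px pmin]] := alg_sub PE1 (aP x).
  have [|x' px'] := @closed_root (map_poly j p).
    have : (size (map_poly e p) != 1)%N.
      apply/eqP => /eqP /size_poly1P[c c0 pc].
      by move: px; rewrite pc /root hornerC (negPf c0).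
    by rewrite !size_map_poly; case: (size p) (size_poly_gt0 p) => [|[|]] //; rewrite p0.
  have [E2 [s2 [hE2 hs2 E2x _ E2s]]] := simple_ext (minpoly_roots p0 px pmin px').
  have /(_ (x, s2 x)) : [set w | E2 w.1 /\ w.2 = s2 w.1] `<=` G.
    apply: maxG; last by exists E2, s2; split.
    move=> [u v] /GE[/Ee[w <-] ->] /=; have [] := E2s w.
    by rewrite jE => ? ->.
  by move=> /(_ (conj E2x erefl)) /GE[].
exists s1; split; last by move=> x /EE1[].
case: hs1 => sD sM s1e; split=> //; try by move=> *; [apply: sD|apply: sM].
- by move=> x y; apply: sD.
- by move=> x y; apply: sM.
- by move=> x Px; have [/EE1[_ ->] ->] := hPE _ Px.
Qed.

Lemma emb_root (P : K -> Prop) (s : K -> K) f x : N_emb P s -> poly_in P f -> root f x -> root f (s x).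
Proof.
move=> [sD sM s1 sP] Pf /rootP fx; apply/rootP.
have s0 : s 0 = 0 by have := sD 0 0; rewrite addr0 => /(congr1 (fun z => z - s 0)); rewrite subrr addrK.
have sX y n : s (y ^+ n) = s y ^+ n.
  by elim: n => [|n IH]; rewrite ?expr0 // !exprS sM IH.
have sS n (G : 'I_n -> K) : s (\sum_(k < n) G k) = \sum_(k < n) s (G k).
  exact: (big_morph s sD s0).
transitivity (s f.[x]); last by rewrite fx.
rewrite !horner_coef sS; apply: eq_bigr => k _.
by rewrite sM sX (sP f`_k).
Qed.

Lemma emb_move (P : K -> Prop) x : is_subfield P -> (forall x, algP P x) ->
  exists p, [/\ p != 0, poly_in P p, root p x &
    forall x', root p x' -> exists t, N_emb P t /\ t x = x'].
Proof.
move=> hP aP; have [E0 [e [eP Pe]]] := subfield_model hP.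
have /(algPE eP Pe)/minpoly_exists[p [p0 px pmin]] := aP x.
exists (map_poly e p); split=> //; [by rewrite map_poly_eq0|exact: poly_in_map|].
move=> x' px'.
have [E [s [hE hs Ex sx Es]]] := simple_ext (minpoly_roots p0 px pmin px').
have [|t [tP tE]] := @ext_emb P E s hP aP hE hs; last by exists t; rewrite tE.
by move=> y /Pe[u <-]; have [] := Es u.
Qed.

(** All conjugates of [x] equal [x], so some [(X - x)^d] has coefficients in [P]. Splitting off the
    part [e] of [d] prime to no factor but the characteristic turns it into [(X^e - x^e)^k]. *)
Lemma fixed_power (P : K -> Prop) x : is_subfield P -> (forall x, algP P x) ->
    (forall t, N_emb P t -> t x = x) ->
  exists2 e, [pchar K].-nat e & P (x ^+ e).
Proof.
move=> hP aP fx; have hR := subfield_subring hP.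
have [p [p0 Pp px pconj]] := emb_move x hP aP.
have [r pr] := closed_field_poly_normal p.
set q := \prod_(z <- r) _ in pr.
have rE : r = nseq (size r) x.
  apply/all_pred1P/allP => z zr /=; have [|t [Pt <-]] := pconj z; last exact/eqP/fx.
  by rewrite pr rootZ ?lead_coef_eq0 // root_prod_XsubC.
have r0 : (0 < size r)%N.
  rewrite lt0n; apply: contraTN px => /nilP r0.
  by rewrite pr /q r0 big_nil rootZ ?lead_coef_eq0 // (negPf (root1 _)).
have Pq : poly_in P q.
  move=> i; have -> : q`_i = (lead_coef p)^-1 * p`_i by rewrite {2}pr coefZ mulKf // lead_coef_eq0.
  by apply: (subringM hR); [apply: (subfieldV hP); apply: Pp|apply: Pp].
move: Pq; rewrite /q rE; set d := size r in r0 *.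
pose e := (d`_[pchar K])%N; pose k := (d`_([pchar K]^'))%N.
have ek : d = (k * e)%N by rewrite mulnC partnC.
have e_pchar : [pchar K].-nat e by apply: part_pnat.
have k0 : (0 < k)%N by apply: part_gt0.
have e0 : (0 < e)%N by apply: part_gt0.
have kK : k%:R != 0 :> K.
  apply/negP => k0K; have [p' pcp] := natf0_pchar k0 k0K.
  have pk : (p' %| k)%N by rewrite (dvdn_pcharf pcp).
  have /pnatP : ([pchar K]^').-nat k by apply: part_pnat.
  by move=> /(_ k0 p' (pcharf_prime pcp) pk) /negP[].
have e_pchar' : [pchar {poly K}].-nat e by rewrite (eq_pnat _ (@pchar_poly K)).
rewrite big_nseq -Monoid.iteropE -/(_ ^+ d) ek mulnC exprM exprDn_pchar //.
rewrite exprNn_pchar // -rmorphXn.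
have -> : ('X^e - (x ^+ e)%:P) ^+ k = (\prod_(z <- nseq k (x ^+ e)) ('X - z%:P)) \Po 'X^e.
  rewrite rmorph_prod /= big_nseq -Monoid.iteropE -/(_ ^+ k); congr (_ ^+ _).
  by rewrite comp_polyB comp_polyX comp_polyC.
(* The coefficient of degree [(k - 1) e] in [(X^e - x^e)^k] is [- k x^e], and [k] is invertible in
   [K]. *)
move=> /(_ (k.-1 * e)%N); rewrite coef_comp_poly_Xn // dvdn_mull // mulnK //.
have := @coefPn_prod_XsubC _ (nseq k (x ^+ e)); rewrite size_nseq -lt0n k0 => /(_ isT) ->.
rewrite big_nseq -Monoid.iteropE => Pk; exists e => //.
have -> : x ^+ e = (k%:R)^-1 * (k%:R * x ^+ e) by rewrite mulKf.
apply: (subringM hR); first by apply: subfieldV => //; apply: (subringMn hR); apply: (subring1 hR).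
rewrite mulr_natl -[_ *+ k]opprK; exact: (subringN hR).
Qed.

End Extension.

(** * Regular extensions and fixed elements *)

Section Regular.
Local Open Scope classical_set_scope.

(* [N'] plays the role of [N] adjoined a transcendence basis of [K]. *)
Lemma regular_extension (K : fieldType) (N : K -> Prop) : is_subfield N ->
  exists N' : K -> Prop, [/\ is_subfield N', (forall x, N x -> N' x), (forall x, algP N' x) &
    forall x, N' x -> algP N x -> N x].
Proof.
move=> hN; pose good (X : set K) := is_subfield X /\ forall x, X x -> algP N x -> N x.
have [||N' [NN' [hN' regN'] maxN']] := @Zorn_above _ good N.
- by split.
- move=> F F0 FP Ft; split; first by apply: chain_subfield => // X /FP[].
  by move=> x [X /FP[_ h] Xx]; apply: h.
exists N'; split=> // x; apply: contrapT => nax; have hR := subfield_subring hN'.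
have hA := alg_subfield hN'; have hAR := subfield_subring hA.
suff hx : good (adjoin N' x).
  by apply/nax/(alg_id hN'); apply: (maxN' _ _ hx); [move=> y; apply: adjoin_sub|apply: adjoin_id].
split; first exact: adjoin_subfield.
move=> _ [f [g [Nf Ng g0 ->]]]; set w := _ / _ => aw; apply: (regN') => //.
have aw' : algP N' w by apply: alg_sub aw.
(* [x] is a root of [f - w g], whose coefficients are algebraic over [N']. As [x] is not algebraic
   over [N'], this polynomial must vanish, and then [w] is a quotient of coefficients of [f] and
   [g]. *)
have [h0|h0] := eqVneq (f - w%:P * g) 0.
  have fE i : f`_i = w * g`_i by move/subr0_eq: h0 => ->; rewrite coefCM.
  have gn0 : lead_coef g != 0 by rewrite lead_coef_eq0; apply: contraNneq g0 => ->; rewrite horner0.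
  have -> : w = f`_(size g).-1 / lead_coef g by rewrite fE mulfK.
  by apply: (subringM hR); [apply: Nf|apply: (subfieldV hN'); apply: Ng].
case: nax; apply: (alg_root hN' h0); last first.
  by rewrite /root !hornerE /w divfK // subrr.
apply: (poly_inB hAR); first by move=> i; apply/(alg_id hN').
by apply: (poly_inM hAR); [apply: (poly_inC hAR)|move=> i; apply/(alg_id hN')].
Qed.

Lemma emb_sub (K : closedFieldType) (N N' : K -> Prop) s :
  (forall x, N x -> N' x) -> N_emb N' s -> N_emb N s.
Proof. by move=> NN' [sD sM s1 sN]; split=> // x /NN'/sN. Qed.

(** Since [K] may be transcendental over [P], only embeddings over a regular extension [P'] are
    used; the power found in [P'] is algebraic over [P], hence in [P]. *)
Lemma fixed_alg_power (K : closedFieldType) (P : K -> Prop) x : is_subfield P -> algP P x ->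
    (forall t, N_emb P t -> t x = x) ->
  exists2 e, [pchar K].-nat e & P (x ^+ e).
Proof.
move=> hP ax fx; have [P' [hP' PP' aP' rP']] := regular_extension hP.
have [|e pe Pe] := @fixed_power K P' x hP' aP'.
  by move=> t /(emb_sub PP')/fx.
exists e => //; apply: rP' => //.
exact: (subringX (subfield_subring (alg_subfield hP))).
Qed.

End Regular.

(** * Linear disjointness *)

Section LinearAlgebra.
Variables (F : fieldType) (C : F -> Prop).
Hypothesis hC : is_subfield C.
Let hCR := subfield_subring hC.

Lemma basis_extract (V : F -> Prop) (ms : seq F) : (forall m, m \in ms -> V m) ->
  exists d (u : 'I_d -> F), [/\ (forall j, V (u j)), lin_indep_over C u &
    forall m, m \in ms -> exists c : 'I_d -> F, (forall j, C (c j)) /\ m = \sum_j c j * u j].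
Proof.
elim: ms => [|m ms IH] hms.
  by exists 0%N, (fun _ => 0); split=> // [[] | c _ _ []].
have [d [u [Vu iu su]]] := IH (fun z zs => hms z (mem_behead (s := m :: ms) zs)).
have [[c [Cc mE]]|nm] := pselect (exists c : 'I_d -> F, (forall j, C (c j)) /\ m = \sum_j c j * u j).
  exists d, u; split=> // z; rewrite inE => /orP[/eqP->|/su //].
  by exists c.
pose u' j := if unlift ord0 j is Some i then u i else m.
have u'0 : u' ord0 = m by rewrite /u' unlift_none.
have u'S i : u' (lift ord0 i) = u i by rewrite /u' liftK.
have bigS (c : 'I_d.+1 -> F) :
    \sum_j c j * u' j = c ord0 * m + \sum_j c (lift ord0 j) * u j.
  by rewrite big_ord_recl u'0; congr (_ + _); apply: eq_bigr => j _; rewrite u'S.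
exists d.+1, u'; split.
- move=> j; case: (unliftP ord0 j) => [i ->|->]; rewrite ?u'S // u'0.
  exact/hms/mem_head.
- move=> c Cc; rewrite bigS => c0.
  have c00 : c ord0 = 0.
    apply/eqP; apply: contrapT => /negP c0n; apply: nm.
    exists (fun j => - (c ord0)^-1 * c (lift ord0 j)); split.
      move=> j; apply: (subringM hCR) (Cc _); apply: (subringN hCR).
      exact: (subfieldV hC).
    have -> : \sum_j - (c ord0)^-1 * c (lift ord0 j) * u j =
        - (c ord0)^-1 * \sum_j c (lift ord0 j) * u j.
      by rewrite mulr_sumr; apply: eq_bigr => j _; rewrite mulrA.
    have -> : \sum_j c (lift ord0 j) * u j = - (c ord0 * m).
      by apply/eqP; rewrite -addr_eq0 addrC c0.
    by rewrite mulrNN mulKf.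
  move=> j; case: (unliftP ord0 j) => [i ->|-> //].
  apply: (iu (fun j => c (lift ord0 j))); first by move=> *; apply: Cc.
  by move: c0; rewrite c00 mul0r add0r.
- move=> z; rewrite inE => /orP[/eqP->|/su[c [Cc ->]]].
    exists (fun j => (j == ord0)%:R); split=> [j|].
      by case: eqP => _; [apply: (subring1 hCR)|apply: (subring0 hCR)].
    by rewrite bigS eqxx mul1r big1 ?addr0 // => j _; rewrite mul0r.
  exists (fun j => if unlift ord0 j is Some i then c i else 0); split=> [j|].
    by case: unliftP => [i _|_] //; apply: (subring0 hCR).
  by rewrite bigS unlift_none mul0r add0r; apply: eq_bigr => j _; rewrite liftK.
Qed.

(** Expand the [c i] along elements [u j] of [M] independent over [C]. The relation becomes one
    between the [u j] with coefficients in [L]; these vanish, and each is a combination of the [v i]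
    over [C]. *)
Lemma linearly_disjoint_sym (L M : F -> Prop) : is_subfield L ->
    (forall x, C x -> L x) -> linearly_disjoint C L M -> linearly_disjoint C M L.
Proof.
move=> hL CL dLM n v Lv iv c Mc cv; have hLR := subfield_subring hL.
have [|d [u [Mu iu su]]] := @basis_extract M [seq c i | i <- enum 'I_n].
  by move=> _ /mapP[i _ ->].
have /choice[a aE] i : exists a : 'I_d -> F, (forall j, C (a j)) /\ c i = \sum_j a j * u j.
  by apply/su/map_f; rewrite mem_enum.
have aC i j : C (a i j) by have [] := aE i.
have cE i : c i = \sum_j a i j * u j by have [] := aE i.
have Lav j : L (\sum_i a i j * v i).
  by apply: (subring_sum hLR) => i _; apply: (subringM hLR) (Lv i); apply: CL.
have av0 := dLM _ _ Mu iu (fun j => \sum_i a i j * v i) Lav.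
have {}av0 : forall j, \sum_i a i j * v i = 0.
  apply: av0; rewrite -[RHS]cv.
  transitivity (\sum_j \sum_i a i j * v i * u j).
    by apply: eq_bigr => j _; rewrite mulr_suml.
  rewrite exchange_big; apply: eq_bigr => i _ /=.
  by rewrite cE mulr_suml; apply: eq_bigr => j _; rewrite mulrAC.
move=> i; rewrite cE big1 // => j _.
by rewrite (iv (fun i => a i j) _ (av0 j)) ?mul0r // => i'; apply: aC.
Qed.

End LinearAlgebra.

(** * The ring spanned by two subrings, and its fractions *)

Definition span_of (F : fieldType) (L Q : F -> Prop) (w : F) : Prop :=
  exists r : seq (F * F), (forall p, p \in r -> L p.1 /\ Q p.2) /\ w = \sum_(p <- r) p.1 * p.2.

Section Span.
Variables (F : fieldType) (L Q : F -> Prop).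
Hypotheses (hL : is_subring L) (hQ : is_subring Q).

Lemma spanM_in l q : L l -> Q q -> span_of L Q (l * q).
Proof. by move=> Ll Qq; exists [:: (l, q)]; split=> [p|]; rewrite ?big_seq1 // inE => /eqP->. Qed.

Lemma span_l l : L l -> span_of L Q l.
Proof. by move=> Ll; rewrite -[l]mulr1; apply: spanM_in => //; apply: (subring1 hQ). Qed.

Lemma span_r q : Q q -> span_of L Q q.
Proof. by move=> Qq; rewrite -[q]mul1r; apply: spanM_in => //; apply: (subring1 hL). Qed.

Lemma spanD w1 w2 : span_of L Q w1 -> span_of L Q w2 -> span_of L Q (w1 + w2).
Proof.
move=> [r1 [h1 ->]] [r2 [h2 ->]]; exists (r1 ++ r2); rewrite big_cat; split=> // p.
by rewrite mem_cat => /orP[/h1|/h2].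
Qed.

Lemma spanN w : span_of L Q w -> span_of L Q (- w).
Proof.
move=> [r [h ->]]; exists [seq (- p.1, p.2) | p <- r]; split.
  by move=> _ /mapP[p /h[h1 h2] ->]; split=> //; apply: subringN.
by rewrite big_map -sumrN; apply: eq_bigr => p _; rewrite mulNr.
Qed.

Lemma span_sum I (r : seq I) (P : pred I) (G : I -> F) :
  (forall i, P i -> span_of L Q (G i)) -> span_of L Q (\sum_(i <- r | P i) G i).
Proof. by move=> h; apply: big_ind => //; [apply/span_l/(subring0 hL)|apply: spanD]. Qed.

Lemma span_subring : is_subring (span_of L Q).
Proof.
split; first exact/span_l/(subring0 hL).
- exact/span_l/(subring1 hL).
- by move=> w1 w2 h1 /spanN; apply: spanD.
- move=> w1 w2 [r1 [h1 ->]] [r2 [h2 ->]]; rewrite mulr_suml big_seq.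
  apply: span_sum => p /h1[Lp Qp]; rewrite mulr_sumr big_seq.
  apply: span_sum => q /h2[Lq Qq]; rewrite mulrACA.
  by apply: spanM_in; [apply: (subringM hL)|apply: (subringM hQ)].
Qed.

(** The compositum is defined as an intersection, which gives no normal form; fractions of spans
    form a subfield containing [L] and [Q], so they exhaust it. *)
Lemma span_frac w : is_subfield L -> compositum L Q w ->
  exists g h, [/\ span_of L Q g, span_of L Q h, h != 0 & w = g / h].
Proof.
move=> hLf; have hS := span_subring.
pose S w := exists g h, [/\ span_of L Q g, span_of L Q h, h != 0 & w = g / h].
have inS g : span_of L Q g -> S g.
  by move=> sg; exists g, 1; split; rewrite ?divr1 ?oner_eq0 //; apply: (subring1 hS).
move=> cw; apply: (cw S); [|by move=> l /span_l/inS|by move=> q /span_r/inS].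
  split; first exact/inS/(subring0 hS).
  - exact/inS/(subring1 hS).
  - move=> _ _ [g [h [sg sh h0 ->]]] [g' [h' [sg' sh' h0' ->]]].
    exists (g * h' - g' * h), (h * h'); split; last by rewrite -!mulNr addf_div.
    + by apply: (subringB hS); apply: (subringM hS).
    + exact: (subringM hS).
    + exact: mulf_neq0.
  - move=> _ _ [g [h [sg sh h0 ->]]] [g' [h' [sg' sh' h0' ->]]].
    exists (g * g'), (h * h'); split; rewrite ?mulf_div ?mulf_neq0 //; exact: (subringM hS).
  - move=> _ [g [h [sg sh h0 ->]]]; rewrite invf_div.
    have [g0|g0] := eqVneq g 0; last by exists h, g.
    by rewrite g0 invr0 mulr0; apply/inS/(subring0 hS).
Qed.

(** A single family [u], independent over [C], serves all of [ws], so that linear disjointness can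
    compare them coefficient by coefficient. *)
Lemma span_normal (C : F -> Prop) (ws : seq F) : is_subfield C -> (forall x, C x -> Q x) ->
    (forall w, w \in ws -> span_of L Q w) ->
  exists d (u : 'I_d -> F), [/\ (forall j, L (u j)), lin_indep_over C u &
    forall w, w \in ws -> exists q : 'I_d -> F, (forall j, Q (q j)) /\ w = \sum_j q j * u j].
Proof.
move=> hC CQ hws.
have /choice[r rE] w : exists r : seq (F * F), w \in ws ->
    (forall p, p \in r -> L p.1 /\ Q p.2) /\ w = \sum_(p <- r) p.1 * p.2.
  by have [/hws[r ?]|_] := boolP (w \in ws); [exists r | exists [::]].
have [|d [u [Lu iu su]]] := @basis_extract F C hC L (flatten [seq [seq p.1 | p <- r w] | w <- ws]).
  by move=> l /flattenP[_ /mapP[w /rE[rL _] ->] /mapP[p /rL[? _] ->]].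
exists d, u; split=> // w ws_w; have [rL wE] := rE w ws_w.
have /choice[c cE] p : exists c : 'I_d -> F, p \in r w ->
    (forall j, C (c j)) /\ p.1 = \sum_j c j * u j.
  have [pr|_] := boolP (p \in r w); last by exists (fun _ => 0).
  have [|c cP] := su p.1; last by exists c.
  by apply/flattenP; exists [seq p.1 | p <- r w]; apply: map_f.
exists (fun j => \sum_(p <- r w) p.2 * c p j); split.
  move=> j; rewrite big_seq; apply: (subring_sum hQ) => p pr.
  by apply: (subringM hQ); [case: (rL _ pr)|apply: CQ; case: (cE _ pr)].
rewrite {1}wE; under [RHS]eq_bigr do rewrite mulr_suml.
rewrite exchange_big /= big_seq [RHS]big_seq; apply: eq_bigr => p pr.
have [_ ->] := cE _ pr; rewrite mulr_suml; apply: eq_bigr => j _.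
by rewrite mulrC mulrA.
Qed.

End Span.

Section Compositum.
Variables (F : fieldType) (L M : F -> Prop).

Lemma compositum_subfield : is_subfield (compositum L M).
Proof.
split.
- by move=> S [].
- by move=> S [].
- move=> x y hx hy S hS SL SM; case: (hS) => _ _ sB _ _.
  by apply: sB; [apply: hx|apply: hy].
- move=> x y hx hy S hS SL SM; case: (hS) => _ _ _ sM _.
  by apply: sM; [apply: hx|apply: hy].
- move=> x hx S hS SL SM; case: (hS) => _ _ _ _ sV.
  by apply: sV; apply: hx.
Qed.

Lemma compositum_l x : L x -> compositum L M x.
Proof. by move=> Lx S hS SL SM; apply: SL. Qed.

Lemma compositum_r x : M x -> compositum L M x.
Proof. by move=> Mx S hS SL SM; apply: SM. Qed.

End Compositum.

Lemma adjoin_common (F : fieldType) (R : F -> Prop) w n (x : 'I_n -> F) : is_subring R ->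
    (forall i, adjoin R w (x i)) ->
  exists D (G : 'I_n -> {poly F}), [/\ (forall i, poly_in R (G i)), D.[w] != 0 &
    forall i, x i = (G i).[w] / D.[w]].
Proof.
move=> hR /choice[num]/choice[den h].
exists (\prod_j den j), (fun i => num i * \prod_(j | j != i) den j); split.
- move=> i; have [Rn _ _ _] := h i; apply: (poly_inM hR) => //.
  by apply: (poly_in_prod hR) => j _; have [] := h j.
- by rewrite horner_prod; apply/prodf_neq0 => j _; have [] := h j.
- move=> i; rewrite [\prod_j _](bigD1 i) //= !hornerM -mulf_div.
  have [_ _ _ <-] := h i; rewrite divff ?mulr1 // horner_prod.
  by apply/prodf_neq0 => j _; have [] := h j.
Qed.

(** * Embeddings acting on the compositum *)

Section EmbFacts.
Variables (K : closedFieldType) (P : K -> Prop) (s : K -> K).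
Hypothesis hs : N_emb P s.

Lemma embD x y : s (x + y) = s x + s y. Proof. by case: hs. Qed.
Lemma embM x y : s (x * y) = s x * s y. Proof. by case: hs. Qed.
Lemma emb1 : s 1 = 1. Proof. by case: hs. Qed.
Lemma emb_id x : P x -> s x = x. Proof. by case: hs => _ _ _; apply. Qed.
Lemma emb0 : s 0 = 0.
Proof. by have := embD 0 0; rewrite addr0 => /(congr1 (fun z => z - s 0)); rewrite subrr addrK. Qed.
Lemma embN x : s (- x) = - s x.
Proof. by apply/eqP; rewrite -addr_eq0 -embD addNr emb0. Qed.
Lemma embB x y : s (x - y) = s x - s y. Proof. by rewrite embD embN. Qed.
Lemma emb_sum I (r : seq I) (Q : pred I) (G : I -> K) :
  s (\sum_(i <- r | Q i) G i) = \sum_(i <- r | Q i) s (G i).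
Proof. exact: (big_morph s embD emb0). Qed.
Lemma emb_prod I (r : seq I) (Q : pred I) (G : I -> K) :
  s (\prod_(i <- r | Q i) G i) = \prod_(i <- r | Q i) s (G i).
Proof. exact: (big_morph s embM emb1). Qed.
Lemma embX x n : s (x ^+ n) = s x ^+ n.
Proof. by elim: n => [|n IH]; rewrite ?expr0 ?emb1 // !exprS embM IH. Qed.
Lemma embMn x n : s (x *+ n) = s x *+ n.
Proof. by elim: n => [|n IH]; rewrite ?mulr0n ?emb0 // !mulrS embD IH. Qed.
Lemma emb_eq0 x : (s x == 0) = (x == 0).
Proof.
apply/eqP/eqP => [sx0|->]; last exact: emb0.
apply/eqP; apply: contraT => x0; have : s (x / x) = 1 by rewrite divff ?emb1.
by rewrite embM sx0 mul0r => /eqP; rewrite eq_sym oner_eq0.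
Qed.
Lemma emb_inj : injective s.
Proof. by move=> x y /eqP; rewrite -subr_eq0 -embB emb_eq0 subr_eq0 => /eqP. Qed.
Lemma embV x : s x^-1 = (s x)^-1.
Proof.
have [->|x0] := eqVneq x 0; first by rewrite invr0 emb0 invr0.
have sx0 : s x != 0 by rewrite emb_eq0.
by apply: (mulfI sx0); rewrite -embM !divff // emb1.
Qed.
End EmbFacts.

(** * Embeddings over [P] acting through coefficients in [M] *)

Section Twist.
Variables (K : closedFieldType) (L M : K -> Prop).
Hypotheses (hL : alg_closed_subfield L) (hM : alg_closed_subfield M).
Local Notation C := (fun x => L x /\ M x).
Hypothesis hdisj : linearly_disjoint C L M.
Let hLf : is_subfield L. Proof. by case: hL. Qed.
Let hMf : is_subfield M. Proof. by case: hM. Qed.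
Let hLR := subfield_subring hLf.
Let hMR := subfield_subring hMf.

Lemma meet_subfield : is_subfield C.
Proof.
case: hLf => l0 l1 lB lM lV; case: hMf => m0 m1 mB mM mV.
by split; [split|split|move=> x y [? ?] [? ?]; split; [apply: lB|apply: mB]
  |move=> x y [? ?] [? ?]; split; [apply: lM|apply: mM]|move=> x [? ?]; split; [apply: lV|apply: mV]].
Qed.

Let hC := meet_subfield.

Lemma indep_L_over_M n (u : 'I_n -> K) :
  (forall j, L (u j)) -> lin_indep_over C u -> lin_indep_over M u.
Proof.
move=> Lu iu; apply: (linearly_disjoint_sym hC hLf _ hdisj Lu iu).
by move=> x [].
Qed.

Section Intermediate.
Variable Q : K -> Prop.
Hypotheses (hQ : is_subfield Q) (CQ : forall x, C x -> Q x) (QM : forall x, Q x -> M x).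
Let hQR := subfield_subring hQ.

(** Numerator and denominator of [w] are expanded, with coefficients [a j] and [b j], along the same
    [u j]. The relation [w * h = g] then has coefficients in [M]; disjointness forces
    [w * b j = a j] for each [j], and some [b j] is nonzero. *)
Lemma compositum_meet w : compositum L Q w -> M w -> Q w.
Proof.
move=> /(span_frac hLR hQR)-/(_ hLf)[g [h [sg sh h0 wE]]] Mw.
have [|d [u [Lu iu su]]] := @span_normal K L Q hQR C [:: g; h] hC CQ.
  by move=> x; rewrite !inE => /orP[]/eqP->.
have [a [Qa gE]] : exists q : 'I_d -> K, (forall j, Q (q j)) /\ g = \sum_j q j * u j.
  by apply: su; rewrite mem_head.
have [b [Qb hE]] : exists q : 'I_d -> K, (forall j, Q (q j)) /\ h = \sum_j q j * u j.
  by apply: su; rewrite !inE eqxx orbT.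
have wab j : w * b j = a j.
  apply/eqP; rewrite -subr_eq0; apply/eqP; move: j.
  apply: (indep_L_over_M Lu iu) => [j|].
    by apply: (subringB hMR); [apply: (subringM hMR)|]; rewrite ?Mw //; apply: QM.
  under eq_bigr do rewrite mulrBl -mulrA.
  by rewrite sumrB -mulr_sumr -gE -hE wE divfK // subrr.
have [j bj] : exists j, b j != 0.
  apply/not_existsP => b0; case/eqP: h0; rewrite hE big1 // => j _.
  by have /negP/negPn/eqP-> := b0 j; rewrite mul0r.
have -> : w = a j / b j by rewrite -wab mulfK.
by apply: (subringM hQR) => //; apply: (subfieldV hQ).
Qed.

Hypothesis aM : forall w, M w -> algP Q w.
Local Notation P := (compositum L Q).

Lemma emb_M s w : N_emb P s -> M w -> M (s w).
Proof.
move=> hs Mw; apply: (alg_closed_in hM); have [f [f0 Qf fw]] := aM Mw.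
exists f; split=> //; first by move=> i; apply/QM/Qf.
by apply: (emb_root hs) fw => i; apply: compositum_r.
Qed.

Lemma fixed_in_M n (x : 'I_n -> K) : (forall i, M (x i)) ->
    (forall i s, N_emb P s -> s (x i) = x i) ->
  exists2 e, [pchar K].-nat e & forall i, Q (x i ^+ e).
Proof.
move=> Mx fx.
have /choice[e eP] i : exists e, [pchar K].-nat e /\ Q (x i ^+ e).
  have [||e pe Pe] := @fixed_alg_power K P (x i) (compositum_subfield _ _).
  - by apply: alg_sub (aM (Mx i)); apply: compositum_r.
  - exact: fx.
  - by exists e; split=> //; apply: compositum_meet => //; apply: (subringX hMR).
exists (\prod_i e i)%N.
  by apply: (big_ind (fun n => [pchar K].-nat n)) => [//|a b pa pb|i _]; [rewrite pnatM pa|case: (eP i)].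
by move=> i; rewrite (bigD1 i) //= exprM; apply: (subringX hQR); case: (eP i).
Qed.

(* Take a fraction with as few terms as possible in the denominator, one of
   whose coefficients is [1].  Comparing [s z] with [a z + b] gives a fraction
   with fewer terms unless [s] fixes the coefficients of the denominator. *)
Lemma twist_normal z : compositum L M z ->
  exists d (u g h : 'I_d -> K) (j0 : 'I_d),
    [/\ (forall j, L (u j)), (forall j, M (g j)), (forall j, M (h j)),
       h j0 = 1 & [/\ \sum_j h j * u j != 0,
       z = (\sum_j g j * u j) / (\sum_j h j * u j) &
       forall s a b, N_emb P s -> M a -> M b -> a != 0 -> s z = a * z + b ->
         forall j, s (h j) = h j /\ s (g j) = a * g j + b * h j]].
Proof.
move=> /(span_frac hLR hMR)-/(_ hLf)[g [h [sg sh h0 zE]]].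
have CM x : C x -> M x by case.
have [|d [u [Lu iu su]]] := @span_normal K L M hMR C [:: g; h] hC CM.
  by move=> x; rewrite !inE => /orP[]/eqP->.
have iuM := indep_L_over_M Lu iu.
pose rep (n : nat) (g h : 'I_d -> K) := [/\ (forall j, M (g j)), (forall j, M (h j)),
  (exists j, h j != 0), z * (\sum_j h j * u j) = \sum_j g j * u j & #|[pred j | h j != 0]| = n].
have ex : exists n, `[< exists g h, rep n g h >].
  have [|g' [Mg gE]] := su g; first by rewrite mem_head.
  have [|h' [Mh hE]] := su h; first by rewrite !inE eqxx orbT.
  exists #|[pred j | h' j != 0]|; apply/asboolP; exists g', h'; split=> //.
    apply/not_existsP => b0; case/eqP: h0; rewrite hE big1 // => j _.
    by have /negP/negPn/eqP-> := b0 j; rewrite mul0r.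
  by rewrite -gE -hE zE divfK.
case: (ex_minnP ex) => n /asboolP[g1 [h1 [Mg1 Mh1 [j0 hj0] zE1 cn]]] nmin.
pose g2 j := g1 j / h1 j0; pose h2 j := h1 j / h1 j0.
have Mg2 j : M (g2 j) by apply: (subringM hMR) => //; apply: (subfieldV hMf).
have Mh2 j : M (h2 j) by apply: (subringM hMR) => //; apply: (subfieldV hMf).
have h2j0 : h2 j0 = 1 by rewrite /h2 divff.
have zE2 : z * (\sum_j h2 j * u j) = \sum_j g2 j * u j.
  rewrite /g2 /h2; under eq_bigr do rewrite mulrAC.
  under [RHS]eq_bigr do rewrite mulrAC.
  by rewrite -!mulr_suml mulrA zE1.
have h2s : \sum_j h2 j * u j != 0.
  apply/eqP => /(iuM _ Mh2)/(_ j0) /eqP; by rewrite h2j0 oner_eq0.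
exists d, u, g2, h2, j0; split=> //; split=> //; first by rewrite -zE2 mulfK.
move=> s a b hs Ma Mb a0 sz.
have sL j : s (u j) = u j by apply: (emb_id hs); apply: compositum_l.
(* Applying [s] to [z * h = g] and subtracting [a] times the original relation leaves a relation
   with coefficients [h3] on the side of [z] and [g3] on the other. *)
pose h3 j := a * (s (h2 j) - h2 j); pose g3 j := s (g2 j) - b * s (h2 j) - a * g2 j.
have Mh3 j : M (h3 j) by apply: (subringM hMR) => //; apply: (subringB hMR) => //; apply: emb_M.
have Mg3 j : M (g3 j).
  apply: (subringB hMR); last exact: (subringM hMR).
  by apply: (subringB hMR); [|apply: (subringM hMR) => //]; apply: emb_M.
have zE3 : z * (\sum_j h3 j * u j) = \sum_j g3 j * u j.
  have sS (f : 'I_d -> K) : s (\sum_j f j * u j) = \sum_j s (f j) * u j.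
    by rewrite (emb_sum hs); apply: eq_bigr => j _; rewrite (embM hs) sL.
  have := congr1 s zE2; rewrite (embM hs) sz !sS => e2.
  have -> : \sum_j h3 j * u j = a * (\sum_j s (h2 j) * u j - \sum_j h2 j * u j).
    by rewrite -sumrB mulr_sumr; apply: eq_bigr => j _; rewrite -mulrBl mulrA.
  have -> : \sum_j g3 j * u j = \sum_j s (g2 j) * u j - b * (\sum_j s (h2 j) * u j) - a * \sum_j g2 j * u j.
    by rewrite !mulr_sumr -!sumrB; apply: eq_bigr => j _; rewrite !mulrBl !mulrA.
  by rewrite -e2 -zE2 mulrDl addrK !mulrBr !mulrA [z * a]mulrC.
have h30 j : h3 j = 0.
  apply/eqP; apply: contraT => h3j.
  have := nmin #|[pred j | h3 j != 0]|; rewrite leqNgt -cn; case/(_ _)/negP.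
    by apply/asboolP; exists g3, h3; split=> //; exists j.
  apply: proper_card; apply/fintype.properP; split.
    apply/fintype.subsetP => i; rewrite !inE; apply: contraNN => /eqP h1i.
    by rewrite /h3 /h2 h1i mul0r (emb0 hs) subrr mulr0.
  by exists j0; rewrite !inE //= /h3 h2j0 (emb1 hs) subrr mulr0 eqxx.
have sh2 j : s (h2 j) = h2 j.
  by have /eqP := h30 j; rewrite mulf_eq0 (negPf a0) subr_eq0 => /eqP.
have g30 j : g3 j = 0.
  move: j; apply: iuM => //; rewrite -zE3 big1 ?mulr0 // => j _.
  by rewrite h30 mul0r.
move=> j; split=> //; have /eqP := g30 j.
by rewrite /g3 sh2 -addrA -opprD subr_eq0 addrC => /eqP.
Qed.

Lemma frac_in_P d (u g h : 'I_d -> K) e : [pchar K].-nat e -> (forall j, L (u j)) ->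
    (forall j, Q (g j ^+ e)) -> (forall j, Q (h j ^+ e)) ->
  P (((\sum_j g j * u j) / (\sum_j h j * u j)) ^+ e).
Proof.
move=> pe Lu Qg Qh; have hP := compositum_subfield L Q; have hPR := subfield_subring hP.
have hX (f : 'I_d -> K) : (forall j, Q (f j ^+ e)) -> P ((\sum_j f j * u j) ^+ e).
  move=> Qf; have -> : (\sum_j f j * u j) ^+ e = \sum_j f j ^+ e * u j ^+ e.
    have e0 : 0 ^+ e = 0 :> K by rewrite expr0n; case: (e) pe => // k; rewrite ?eqxx //; case/andP.
    rewrite (big_morph (fun x => x ^+ e) (id1 := 0) (op1 := +%R)) //; last first.
      by move=> x y; rewrite exprDn_pchar.
    by apply: eq_bigr => j _; rewrite exprMn.
  apply: (subring_sum hPR) => j _; apply: (subringM hPR); first exact: compositum_r.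
  by apply: compositum_l; apply: (subringX hLR).
rewrite exprMn exprVn; apply: (subringM hPR); first exact: hX.
by apply: (subfieldV hP); apply: hX.
Qed.

(** Every [s] fixes the [h i] and multiplies all the [g i] by one factor, so the ratios [g i / g j]
    are fixed and have a power in [Q]. Hence [z] is [g j], an element of [M], times a fraction with
    fixed coefficients. *)
Lemma twist_mul z : compositum L M z -> z != 0 ->
    (forall s, N_emb P s -> exists a, M a /\ s z = a * z) ->
  exists e m v, [/\ [pchar K].-nat e, M m, P v & z ^+ e = m * v].
Proof.
move=> Nz z0 tz; have [d [u [g [h [j0 [Lu Mg Mh hj0 [h0 zE tw]]]]]]] := twist_normal Nz.
have [j gj] : exists j, g j != 0.
  apply/not_existsP => g0; case/eqP: z0; rewrite zE big1 ?mul0r // => j _.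
  by have /negP/negPn/eqP-> := g0 j; rewrite mul0r.
have {}tw s : N_emb P s -> exists a, forall i, s (h i) = h i /\ s (g i) = a * g i.
  move=> hs; have [a [Ma sz]] := tz s hs.
  have a0 : a != 0.
    by apply: contra_neq z0 => a0; apply/eqP; rewrite -(emb_eq0 hs) sz a0 mul0r.
  have tw' := tw s a 0 hs Ma (subring0 hMR) a0.
  exists a => i; have [|-> ->] := tw' _ i; first by rewrite addr0.
  by rewrite mul0r addr0.
(* Indexing by [d + d] lists the [h i] and the ratios together, to get one exponent for both. *)
have [||e pe Qe] := @fixed_in_M (d + d) (fun i => match fintype.split i with inl i => h i | inr i => g i / g j end).
- move=> i; case: fintype.split => // k; apply: (subringM hMR) => //; exact: (subfieldV hMf).
- move=> i s hs; have [a sa] := tw s hs; have [_ sgj] := sa j.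
  have a0 : a != 0.
    by move: gj; rewrite -(emb_eq0 hs) sgj; apply: contraNneq => ->; rewrite mul0r.
  case: fintype.split => k; have [sh sg] := sa k; first by [].
  by rewrite (embM hs) (embV hs) sg sgj invfM mulrACA divff // mul1r.
exists e, (g j ^+ e), (((\sum_i g i / g j * u i) / (\sum_i h i * u i)) ^+ e); split=> //.
- exact: (subringX hMR).
- apply: frac_in_P => // i; first by have := Qe (rshift d i); rewrite (unsplitK (inr i)).
  by have := Qe (lshift d i); rewrite (unsplitK (inl i)).
- rewrite -exprMn zE mulrA; congr ((_ / _) ^+ _); rewrite mulr_sumr; apply: eq_bigr => i _.
  by rewrite mulrA [g j * _]mulrC divfK.
Qed.

(** Here [s] adds [b * h i] to [g i]; since [h j0 = 1], the differences [g i - g j0 * h i] are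
    fixed. *)
Lemma twist_add z : compositum L M z ->
    (forall s, N_emb P s -> exists b, M b /\ s z = z + b) ->
  exists e m v, [/\ [pchar K].-nat e, M m, P v & z ^+ e = m + v].
Proof.
move=> Nz tz; have [d [u [g [h [j0 [Lu Mg Mh hj0 [h0 zE tw]]]]]]] := twist_normal Nz.
have {}tw s : N_emb P s -> exists b, forall i, s (h i) = h i /\ s (g i) = g i + b * h i.
  move=> hs; have [b [Mb sz]] := tz s hs.
  have tw' := tw s 1 b hs (subring1 hMR) Mb (oner_neq0 _).
  exists b => i; have [|-> ->] := tw' _ i; first by rewrite mul1r.
  by rewrite mul1r.
have [||e pe Qe] := @fixed_in_M (d + d) (fun i => match fintype.split i with inl i => h i | inr i => g i - g j0 * h i end).
- move=> i; case: fintype.split => // k; apply: (subringB hMR) => //; exact: (subringM hMR).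
- move=> i s hs; have [b sb] := tw s hs; have [_ sgj] := sb j0.
  case: fintype.split => k; have [sh sg] := sb k; first by [].
  by rewrite (embB hs) (embM hs) sg sgj sh hj0 mulr1 mulrDl opprD addrACA subrr addr0.
exists e, (g j0 ^+ e), (((\sum_i (g i - g j0 * h i) * u i) / (\sum_i h i * u i)) ^+ e); split=> //.
- exact: (subringX hMR).
- apply: frac_in_P => // i; first by have := Qe (rshift d i); rewrite (unsplitK (inr i)).
  by have := Qe (lshift d i); rewrite (unsplitK (inl i)).
- rewrite -exprDn_pchar // zE; congr (_ ^+ _).
  have -> : \sum_i (g i - g j0 * h i) * u i = \sum_i g i * u i - g j0 * \sum_i h i * u i.
    by rewrite mulr_sumr -sumrB; apply: eq_bigr => i _; rewrite mulrBl mulrA.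
  by rewrite mulrBl mulfK // addrC subrK.
Qed.

End Intermediate.
End Twist.

(** * Independence modulo powers and modulo Artin-Schreier *)

Section Multiplicity.
Variable F : fieldType.
Implicit Types (p q v : {poly F}) (a : F).

Lemma mupX a q n : q != 0 -> mup a (q ^+ n) = (n * mup a q)%N.
Proof.
move=> q0; elim: n => [|n IH]; first by rewrite expr0 mupNroot // root1.
by rewrite exprS mupM ?expf_neq0 // IH mulSn.
Qed.

(** This is [f = q v^l] with denominators cleared: at [a], only [(X - a)^n] and the [l]-th powers
    contribute to the multiplicities of the two sides. *)
Lemma power_multiplicity a l n b q1 q2 v1 v2 : (0 < l)%N -> ~~ root b a -> ~~ root q1 a -> ~~ root q2 a ->
    v2 != 0 -> ('X - a%:P) ^+ n * b * q2 * v2 ^+ l = q1 * v1 ^+ l -> (l %| n)%N.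
Proof.
move=> l0 ba q1a q2a v20 E.
have nz p : ~~ root p a -> p != 0 by apply: contraNneq => ->; rewrite root0.
have X0 k : ('X - a%:P) ^+ k != 0 by rewrite expf_neq0 // polyXsubC_eq0.
have b0 : ('X - a%:P) ^+ n * b * q2 != 0 by rewrite !mulf_neq0 ?X0 ?nz.
have v10 : v1 ^+ l != 0.
  apply: contraTneq (mulf_neq0 b0 (expf_neq0 l v20)).
  by move=> v10; rewrite E v10 mulr0 eqxx.
have /(congr1 (mup a)) := E; rewrite (mupM _ b0 (expf_neq0 l v20)).
rewrite (mupMl _ q2a) (mupMl _ ba) (mupMr _ q1a) mup_XsubCX eqxx !mupX //; last first.
  by move: v10; rewrite expf_eq0 l0.
by move=> /eqP; rewrite -(@dvdn_addl (l * mup a v2)) ?dvdn_mulr // => /eqP->; rewrite dvdn_mulr.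
Qed.

(** With [v = v1 / v2] and [p = k + 2], denominators are cleared in an equality between a function
    with a simple pole at [a] and [q + v^p - v], where [q] is regular at [a]. A pole of [v^p - v]
    has order divisible by [p], so it is never simple. *)
Lemma simple_pole a k A b q1 q2 v1 v2 : ~~ root A a -> ~~ root q2 a -> ~~ root b a ->
    v2 != 0 ->
    A * q2 * v2 ^+ k.+2 =
      ('X - a%:P) * b * (q1 * v2 ^+ k.+2 + q2 * (v1 ^+ k.+2 - v1 * v2 ^+ k.+1)) -> False.
Proof.
move=> Aa q2a ba v20.
set d := gcdp v1 v2; have d0 : d != 0 by rewrite gcdp_eq0 negb_and v20 orbT.
have cop : coprimep (v1 %/ d) (v2 %/ d) by apply: coprimep_div_gcd; rewrite v20 orbT.
have w1E : v1 = v1 %/ d * d by rewrite divpK // dvdp_gcdl.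
have w2E : v2 = v2 %/ d * d by rewrite divpK // dvdp_gcdr.
move: (v1 %/ d) (v2 %/ d) cop w1E w2E => w1 w2 cop -> -> E.
have {}E : A * q2 * w2 ^+ k.+2 =
      ('X - a%:P) * b * (q1 * w2 ^+ k.+2 + q2 * (w1 ^+ k.+2 - w1 * w2 ^+ k.+1)).
  apply: (mulIf (expf_neq0 k.+2 d0)); rewrite -[LHS]mulrA -exprMn E !exprMn [d ^+ k.+2]exprS.
  move: (d ^+ k.+1) (w2 ^+ k.+1) (w1 ^+ k.+2) (w2 ^+ k.+2) => *; ring.
(* If [v] has no pole at [a], evaluate there; otherwise divide once by [X - a] and evaluate, the
   left side still vanishing because [k + 1 > 0]. *)
have [w2a|w2a] := boolP (root w2 a); last first.
  move: E => /(congr1 (horner^~ a)); rewrite /= !(horner_exp, hornerM) hornerXsubC subrr !mul0r => /eqP.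
  by apply/negP; exact: (mulf_neq0 (mulf_neq0 Aa q2a) (expf_neq0 k.+2 w2a)).
have w1a : w1.[a] != 0 by apply: (coprimep_root _ w2a); rewrite coprimep_sym.
have [w3 w3E] := factor_theorem _ _ w2a.
have X0 : 'X - a%:P != 0 by rewrite polyXsubC_eq0.
have : A * q2 * (w2 ^+ k.+1 * w3) = b * (q1 * w2 ^+ k.+2 + q2 * (w1 ^+ k.+2 - w1 * w2 ^+ k.+1)).
  apply: (mulIf X0); rewrite [b * _]mulrC -[RHS]mulrA [b * _]mulrC [RHS]mulrC -E.
  by rewrite -!mulrA -w3E [w2 ^+ k.+2]exprSr.
move=> /(congr1 (horner^~ a)); rewrite /= !(horner_exp, hornerM, hornerD, hornerN) (rootP w2a).
rewrite !expr0n /= !(mul0r, mulr0, add0r, subr0) => /esym/eqP.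
by apply/negP; exact: (mulf_neq0 ba (mulf_neq0 q2a (expf_neq0 k.+2 w1a))).
Qed.

End Multiplicity.

(** * Independence of the classes built from [y - a] in the compositum *)

Section Independence.
Variables (K : closedFieldType) (L M : K -> Prop).
Hypotheses (hL : alg_closed_subfield L) (hM : alg_closed_subfield M).
Local Notation C := (fun x => L x /\ M x).
Hypothesis hdisj : linearly_disjoint C L M.
Let hLf : is_subfield L. Proof. by case: hL. Qed.
Let hMf : is_subfield M. Proof. by case: hM. Qed.
Let hLR := subfield_subring hLf.
Let hMR := subfield_subring hMf.
Let hC := meet_subfield hL hM.

Variable y : K.
Hypotheses (My : M y) (nLy : ~ L y).

(** [C] can start Zorn's lemma since [L] is algebraically closed and does not contain [y]. For [w]
    in [M] outside [C'], maximality makes [y] algebraic over [C'(w)], and an exchange makes [w]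
    algebraic over [C'(y)]. *)
Lemma twist_base : exists C' : K -> Prop, [/\ is_subfield C', (forall x, C x -> C' x),
  (forall x, C' x -> M x), ~ algP C' y & forall w, M w -> algP (adjoin C' y) w].
Proof.
pose good X := [/\ is_subfield X, (forall x, X x -> M x) & ~ algP X y].
have [||C' [CC' [hC' C'M ny] maxC]] := @Zorn_above K good C.
- split=> // [x []//|ay]; apply: nLy; apply: (alg_closed_in hL).
  by apply: alg_sub ay => x [].
- move=> G G0 GP Gt; split.
  + by apply: chain_subfield => // X /GP[].
  + by move=> x [X /GP[_ XM _] /XM].
  + by move=> /(chain_alg G0 Gt)[X /GP[]].
exists C'; split=> // w Mw; apply: contrapT => nw.
have hCR := subfield_subring hC'.
have hQ := adjoin_subfield y hCR; have hQR := subfield_subring hQ.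
have [f [f0 fC fy]] : algP (adjoin C' w) y.
  apply: contrapT => nay; apply/nw/(alg_id hQ)/(adjoin_sub y hCR).
  apply: (maxC (adjoin C' w)); last exact: adjoin_id.
    by move=> x; apply: adjoin_sub.
  split=> //; first exact: adjoin_subfield.
  move=> _ [g [h [Cg Ch _ ->]]]; apply: (subringM hMR); last apply: (subfieldV hMf).
    by apply: (horner_in hMR) => // i; apply/C'M/Cg.
  by apply: (horner_in hMR) => // i; apply/C'M/Ch.
have [D [G [CG D0 fE]]] := adjoin_common (n := size f) hCR (fun i : 'I_(size f) => fC i).
(* The equation of [y] over [C'(w)], denominators cleared, is read as a polynomial in [w] with
   coefficients in [C'(y)]. *)
pose H := \sum_(i < size f) (y ^+ i) *: G i.
apply: nw; exists H; split.
- apply: contra_not_neq ny => H0.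
  (* [S k] collects the coefficients of the [k]-th power of [w]; it is a polynomial over [C'] that
     vanishes at [y] when [H = 0]. *)
  pose S k := \poly_(i < size f) (if insub i is Some j then (G j)`_k else 0).
  have SC k : poly_in C' (S k).
    move=> i; rewrite coef_poly; case: ifP => _; last exact: (subring0 hCR).
    by case: insubP => [j _ _|_]; [apply: CG|apply: (subring0 hCR)].
  have [k Sk] : exists k, S k != 0.
    apply/not_existsP => S0; case/eqP: f0; apply/polyP => i; rewrite coef0.
    have [lt_if|] := ltnP i (size f); last exact: nth_default.
    have -> : f`_i = (G (Ordinal lt_if)).[w] / D.[w] by rewrite -fE.
    suff -> : G (Ordinal lt_if) = 0 by rewrite horner0 mul0r.
    apply/polyP => k; rewrite coef0; have /negP/negPn/eqP/(congr1 (coefp i)) := S0 k.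
    by rewrite /coefp coef0 coef_poly lt_if insubT.
  exists (S k); split=> //; move/(congr1 (coefp k)): H0; rewrite /coefp coef0 coef_sum => H0.
  rewrite /root horner_poly; apply/eqP; rewrite -[RHS]H0; apply: eq_bigr => i _.
  by rewrite valK coefZ mulrC.
- apply: (poly_in_sum hQR) => i _ k; rewrite coefZ; apply: (subringM hQR).
    by apply: (subringX hQR); apply: adjoin_id.
  exact/(adjoin_sub y hCR)/CG.
- apply/eqP; transitivity (D.[w] * f.[y]); last by rewrite (rootP fy) mulr0.
  rewrite /H horner_sum [f.[y]]horner_coef mulr_sumr; apply: eq_bigr => i _.
  by rewrite hornerZ fE mulrA mulrCA divff // mulr1 mulrC.
Qed.

Section Base.
Variable C' : K -> Prop.
Hypotheses (hC' : is_subfield C') (CC' : forall x, C x -> C' x) (C'M : forall x, C' x -> M x)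
  (ny : ~ algP C' y) (aM : forall w, M w -> algP (adjoin C' y) w).
Let hC'R := subfield_subring hC'.
Local Notation Q := (adjoin C' y).
Local Notation P := (compositum L Q).
Local Notation R := (span_of L C').
Let hQ : is_subfield Q := adjoin_subfield y hC'R.
Let hP : is_subfield P := compositum_subfield L Q.
Let hPR := subfield_subring hP.
Let hR : is_subring R := span_subring hLR hC'R.
Let CQ x : C x -> Q x. Proof. by move/CC'/(adjoin_sub y hC'R). Qed.
Let QM x : Q x -> M x.
Proof.
move=> [g [h [Cg Ch _ ->]]]; apply: (subringM hMR); last apply: (subfieldV hMf).
  by apply: (horner_in hMR) => // i; apply/C'M/Cg.
by apply: (horner_in hMR) => // i; apply/C'M/Ch.
Qed.

Lemma base_frac v : P v -> exists v1 v2, [/\ poly_in R v1, poly_in R v2, v2.[y] != 0 &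
  v = v1.[y] / v2.[y]].
Proof.
move=> Pv; apply: (Pv (adjoin R y)); first exact: adjoin_subfield.
- by move=> l Ll; apply: (adjoin_sub y hR); apply: (span_l hC'R).
- move=> _ [g [h [Cg Ch h0 ->]]]; exists g, h; split=> // i; exact: (span_r hLR).
Qed.

(** Expanding the coefficients along elements [u j] of [L] independent over [C] writes [f(y)] as the
    sum of the [G_j(y) u_j] with [G_j(y)] in [M]. Disjointness kills each [G_j(y)], and [y] is
    transcendental over [C']. *)
Lemma base_transcendental f : poly_in R f -> root f y -> f = 0.
Proof.
move=> Rf fy.
have [|d [u [Lu iu su]]] := @span_normal K L C' hC'R C f hC CC'.
  by move=> w /(nthP 0)[i _ <-].
have /choice[q qP] k : exists q : 'I_d -> K, (forall j, C' (q j)) /\ f`_k = \sum_j q j * u j.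
  have [lt_k|le_k] := ltnP k (size f); first by apply/su/mem_nth.
  exists (fun _ => 0); split=> [j|]; first exact: (subring0 hC'R).
  by rewrite nth_default // big1 // => j _; rewrite mul0r.
have qC k j : C' (q k j) by case: (qP k).
pose G j := \poly_(k < size f) q k j.
have GC j : poly_in C' (G j).
  by move=> k; rewrite coef_poly; case: ifP => _ //; apply: (subring0 hC'R).
have Gy : forall j, (G j).[y] = 0.
  apply: (indep_L_over_M hL hM hdisj Lu iu) => [j|].
    by apply: (horner_in hMR) => // k; apply/C'M/GC.
  rewrite -[RHS](rootP fy) horner_coef.
  transitivity (\sum_j \sum_(k < size f) q k j * y ^+ k * u j).
    by apply: eq_bigr => j _; rewrite horner_poly mulr_suml.
  rewrite exchange_big; apply: eq_bigr => k _ /=; have [_ ->] := qP k.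
  by rewrite mulr_suml; apply: eq_bigr => j _; rewrite mulrAC.
have G0 j : G j = 0.
  apply/eqP; apply: contraT => Gj; case: ny; exists (G j); split=> //; exact/rootP.
apply/polyP => k; rewrite coef0; have [lt_k|] := ltnP k (size f); last exact: nth_default.
have [_ ->] := qP k; rewrite big1 // => j _.
have /(congr1 (coefp k)) := G0 j; rewrite /coefp coef0 coef_poly lt_k => ->.
by rewrite mul0r.
Qed.

(** Equalities at [y] lift to polynomial identities, which can then be examined at the points
    [a i]. *)
Lemma base_eq f g : poly_in R f -> poly_in R g -> f.[y] = g.[y] -> f = g.
Proof.
move=> Rf Rg E; apply/subr0_eq/base_transcendental; first exact: poly_inB.
by rewrite /root hornerD hornerN E subrr.
Qed.

Lemma nroot_base q a : poly_in C' q -> q.[y] != 0 -> ~ M a -> ~~ root q a.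
Proof.
move=> Cq qy nMa; apply/negP => qa; apply: nMa; apply: (alg_closed_in hM).
exists q; split=> //; last by move=> i; apply/C'M/Cq.
by apply: contraNneq qy => ->; rewrite horner0.
Qed.

Variables (n : nat) (a : 'I_n -> K) (c : 'I_n -> nat).
Hypotheses (a_inj : injective a) (La : forall i, L (a i)) (nMa : forall i, ~ M (a i)).

Let Ra i : poly_in R ('X - (a i)%:P).
Proof.
by apply: (poly_inB hR); [apply: (poly_inX hR)|apply/(poly_inC hR)/(span_l hC'R)].
Qed.

Let ya i : y - a i != 0.
Proof. by apply/eqP => /subr0_eq ya; apply: nLy; rewrite ya. Qed.

Let Py : P y.
Proof. by apply: compositum_r; apply: adjoin_id. Qed.

Let Pya i : P (y - a i).
Proof. by apply: (subringB hPR) => //; apply: compositum_l. Qed.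

Let rest_nroot i (e : 'I_n -> nat) :
  ~~ root (\prod_(j | j != i) ('X - (a j)%:P) ^+ e j) (a i).
Proof.
rewrite /root horner_prod; apply/prodf_neq0 => j ji.
rewrite horner_exp hornerXsubC expf_eq0 subr_eq0 negb_and orbC.
by apply/orP; left; apply: contra ji => /eqP/a_inj->.
Qed.

Lemma base_power l z : (0 < l)%N -> (forall e, [pchar K].-nat e -> coprime l e) ->
  compositum L M z -> \prod_i (y - a i) ^+ c i = z ^+ l -> forall i, (l %| c i)%N.
Proof.
move=> l0 cop Nz zl i; set f := \prod_i _ in zl.
have f0 : f != 0 by apply/prodf_neq0 => j _; rewrite expf_neq0.
have Pf : P f by apply: (subring_prod hPR) => j _; apply: (subringX hPR).
have z0 : z != 0 by apply: contra_neq f0 => z0; rewrite zl z0 expr0n eqn0Ngt l0.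
(* [s z / z] is an [l]-th root of unity, so it lies in the algebraically closed field [M]. *)
have [s hs|e [m [v [pe Mm Pv zE]]]] := twist_mul hL hM hdisj hQ CQ QM aM Nz z0.
  have sz : s z ^+ l = z ^+ l by rewrite -(embX hs) -zl (emb_id hs).
  exists (s z / z); split; last by rewrite divfK.
  apply: (alg_closed_in hM); apply: (algX_inv hMf l0).
  by rewrite exprMn exprVn sz divff ?expf_neq0 //; apply: (alg_id hMf); apply: (subring1 hMR).
have e0 : (0 < e)%N by case/andP: pe.
have v0 : v != 0.
  by have := expf_neq0 e z0; rewrite zE; apply: contraNneq => ->; rewrite mulr0.
have fE : f ^+ e = m ^+ l * v ^+ l by rewrite zl -exprM mulnC exprM zE exprMn.
(* [m^l] is in [M], and also in [P] as the quotient of [f^e] by [v^l]. *)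
have Qm : Q (m ^+ l).
  apply: (compositum_meet hL hM hdisj hQ CQ QM); last exact: (subringX hMR).
  have -> : m ^+ l = f ^+ e / v ^+ l by rewrite fE mulfK // expf_neq0.
  apply: (subringM hPR); first exact: (subringX hPR).
  by apply: (subfieldV hP); apply: (subringX hPR).
have [q1 [q2 [Cq1 Cq2 q20 mE]]] := Qm.
have [v1 [v2 [Rv1 Rv2 v20 vE]]] := base_frac Pv.
have q10 : q1.[y] != 0.
  have : m ^+ l != 0.
    by have := expf_neq0 e f0; rewrite fE; apply: contraNneq => ->; rewrite mul0r.
  by rewrite mE; apply: contraNneq => ->; rewrite mul0r.
have Rq q : poly_in C' q -> poly_in R q by move=> Cq k; apply: (span_r hLR).
have E : ('X - (a i)%:P) ^+ (c i * e) * \prod_(j | j != i) ('X - (a j)%:P) ^+ (c j * e)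
    * q2 * v2 ^+ l = q1 * v1 ^+ l.
  apply: base_eq.
  - apply: (poly_inM hR); last exact: (poly_inXn hR).
    apply: (poly_inM hR); last exact: (Rq).
    apply: (poly_inM hR); first exact: (poly_inXn hR).
    by apply: (poly_in_prod hR) => j _; apply: (poly_inXn hR).
  - by apply: (poly_inM hR); [apply: (Rq)|apply: (poly_inXn hR)].
  have -> : ('X - (a i)%:P) ^+ (c i * e) * \prod_(j | j != i) ('X - (a j)%:P) ^+ (c j * e)
      = (\prod_j ('X - (a j)%:P) ^+ c j) ^+ e.
    rewrite [in RHS](bigD1 i) //= exprMn -exprM -prodrXl; congr (_ * _).
    by apply: eq_bigr => j _; rewrite exprM.
  rewrite !hornerM !horner_exp horner_prod.
  have -> : \prod_j (('X - (a j)%:P) ^+ c j).[y] = f.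
    by apply: eq_bigr => j _; rewrite horner_exp hornerXsubC.
  rewrite fE mE vE expr_div_n; field.
  by rewrite q20 expf_neq0.
have v20' : v2 != 0 by apply: contraNneq v20 => ->; rewrite horner0.
have := power_multiplicity l0 (rest_nroot i (fun j => c j * e)%N)
  (nroot_base Cq1 q10 (@nMa i)) (nroot_base Cq2 q20 (@nMa i)) v20' E.
by rewrite Gauss_dvdl // cop.
Qed.

(** Frobenius acts trivially modulo the elements [s^p - s], by telescoping. This removes the
    exponent [e] from the additive splitting. *)
Lemma frobenius_shift p e w : p \in [pchar K] -> [pchar K].-nat e -> P w ->
  exists2 s, P s & w ^+ e = w + s ^+ p - s.
Proof.
move=> pcp pe Pw; have p_pr := pcharf_prime pcp.
have /p_natP[k ->] : p.-nat e by rewrite (eq_pnat _ (pcharf_eq pcp)) in pe.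
elim: k => [|k [s Ps E]].
  by exists 0; [apply: (subring0 hPR)|rewrite expn0 expr1 expr0n eqn0Ngt prime_gt0 // addr0 subr0].
exists (w ^+ (p ^ k) + s); first by apply: (subringD hPR) => //; apply: (subringX hPR).
have pcD (x x' : K) : (x + x') ^+ p = x ^+ p + x' ^+ p.
  by rewrite exprDn_pchar // (eq_pnat _ (pcharf_eq pcp)) pnat_id.
rewrite expnSr exprM pcD; move: (w ^+ (p ^ k)) E => X E.
have -> : w = X - s ^+ p + s by rewrite E; ring.
ring.
Qed.

Lemma base_artin_schreier p z : p \in [pchar K] -> compositum L M z ->
  \sum_i (c i)%:R / (y - a i) = z ^+ p - z -> forall i, (p %| c i)%N.
Proof.
move=> pcp Nz zp i; set f := \sum_i _ in zp.
have p_pr := pcharf_prime pcp; have p_nat : [pchar K].-nat p.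
  by rewrite (eq_pnat _ (pcharf_eq pcp)) pnat_id.
have Pf : P f.
  apply: (subring_sum hPR) => j _; apply: (subringM hPR); last exact: (subfieldV hP).
  by apply: (subringMn hPR); apply: (subring1 hPR).
have BD q (x x' : K) : [pchar K].-nat q -> (x - x') ^+ q = x ^+ q - x' ^+ q.
  by move=> qn; rewrite exprDn_pchar // exprNn_pchar.
have [s hs|e [m [v [pe Mm Pv zE]]]] := twist_add hL hM hdisj hQ CQ QM aM Nz.
  exists (s z - z); split; last by rewrite addrC subrK.
  apply: (alg_closed_in hM); exists ('X^p - 'X).
  have MX : poly_in M ('X^p - 'X).
    by apply: (poly_inB hMR); [apply: (poly_inXn hMR)|]; apply: (poly_inX hMR).
  split=> //.
    rewrite -size_poly_gt0 size_polyDl size_polyXn // size_polyN size_polyX.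
    by rewrite ltnS prime_gt1.
  have : s (z ^+ p - z) = z ^+ p - z by rewrite -zp (emb_id hs).
  rewrite (embB hs) (embX hs) /root !hornerE BD // => sE.
  have -> : s z ^+ p - z ^+ p - (s z - z) = (s z ^+ p - s z) - (z ^+ p - z) by ring.
  by rewrite sE subrr.
have [t Pt tE] := frobenius_shift pcp pe Pf.
(* The shift by [t] absorbs the exponent [e] and leaves [f = q + v'^p - v']; then [q] lies in both
   [M] and [P], hence in [Q]. *)
set q := m ^+ p - m; pose v' := v - t.
have fE : f = q + v' ^+ p - v'.
  have : f ^+ e = z ^+ e ^+ p - z ^+ e by rewrite zp BD // exprAC.
  rewrite tE zE exprDn_pchar // => E.
  have -> : f = f + t ^+ p - t - t ^+ p + t by ring.
  by rewrite E /q /v' BD //; ring.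
have Qq : Q q.
  apply: (compositum_meet hL hM hdisj hQ CQ QM); last first.
    by apply: (subringB hMR) => //; apply: (subringX hMR).
  have -> : q = f - v' ^+ p + v' by rewrite fE; ring.
  have Pv' : P v' by apply: (subringB hPR).
  apply: (subringD hPR) => //; apply: (subringB hPR) => //; exact: (subringX hPR).
have Pv' : P v' by apply: (subringB hPR).
have [q1 [q2 [Cq1 Cq2 q20 qE]]] := Qq.
have [v1 [v2 [Rv1 Rv2 v20 vE]]] := base_frac Pv'.
have Rq r : poly_in C' r -> poly_in R r by move=> Cr k; apply: (span_r hLR).
have cK k : R k%:R by apply: (subringMn hR); apply: (subring1 hR).
pose rest k := \prod_(j | j != k) ('X - (a j)%:P).
(* [A] is the numerator of [f], with [X] for [y], over the common denominator of its partial
   fractions. *)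
pose A := \sum_k (c k)%:R%:P * rest k.
have Rrest k : poly_in R (rest k) by apply: (poly_in_prod hR).
have restE k : (rest k).[y] = \prod_(j | j != k) (y - a j).
  by rewrite horner_prod; apply: eq_bigr => j _; rewrite hornerXsubC.
have [k pk] : exists k, p = k.+2 by case: (p) p_pr => [|[|k]] //; exists k.
have E : A * q2 * v2 ^+ k.+2 = ('X - (a i)%:P) * rest i *
    (q1 * v2 ^+ k.+2 + q2 * (v1 ^+ k.+2 - v1 * v2 ^+ k.+1)).
  have RX r j : poly_in R r -> poly_in R (r ^+ j) by apply: (poly_inXn hR).
  have RM r r' : poly_in R r -> poly_in R r' -> poly_in R (r * r') by apply: (poly_inM hR).
  apply: base_eq.
  - apply: (RM); last exact: (RX).
    apply: (RM); last exact: (Rq).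
    by apply: (poly_in_sum hR) => j _; apply: (RM) => //; apply: (poly_inC hR).
  - apply: (RM); first exact: (RM).
    apply: (poly_inD hR); first by apply: (RM); [apply: (Rq)|apply: (RX)].
    apply: (RM); [exact: Rq|apply: (poly_inB hR); [exact: RX|]].
    by apply: (RM) => //; apply: (RX).
  have AE : A.[y] = f * ((y - a i) * (rest i).[y]).
    have PE j : (y - a j) * (rest j).[y] = \prod_j' (y - a j').
      by rewrite restE [RHS](bigD1 j).
    rewrite PE /A horner_sum mulr_suml; apply: eq_bigr => j _.
    by rewrite hornerM hornerC -(PE j) mulrA divfK.
  rewrite !(horner_exp, hornerXsubC, hornerM, hornerD, hornerN) AE fE qE vE pk.
  rewrite expr_div_n [v2.[y] ^+ k.+2]exprS.
  have := expf_neq0 k.+1 v20; move: (v1.[y] ^+ k.+2) (v2.[y] ^+ k.+1) => V1 V2 V20.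
  by field; rewrite v20 V20 q20.
have v20' : v2 != 0 by apply: contraNneq v20 => ->; rewrite horner0.
rewrite (dvdn_pcharf pcp); apply: contraT => ci.
have rest_i : ~~ root (rest i) (a i) by have := rest_nroot i (fun _ => 1%N).
have := simple_pole _ (nroot_base Cq2 q20 (@nMa i)) rest_i v20' E; case.
(* At [a i] only the term of index [i] survives, and it is nonzero if [p] does not divide [c i]. *)
rewrite /root /A (bigD1 i) //= hornerD horner_sum big1 => [|j ji].
  by rewrite addr0 hornerM hornerC mulf_neq0.
rewrite hornerM /rest (bigD1 i) 1?eq_sym //= !hornerM hornerXsubC subrr mul0r.
by rewrite mulr0.
Qed.

End Base.

Variables (n : nat) (a : 'I_n -> K) (c : 'I_n -> nat) (z : K).
Hypotheses (a_inj : injective a) (La : forall i, L (a i)) (nMa : forall i, ~ M (a i)).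
Hypothesis Nz : compositum L M z.

Lemma power_independent l : (0 < l)%N -> (forall e, [pchar K].-nat e -> coprime l e) ->
  \prod_i (y - a i) ^+ c i = z ^+ l -> forall i, (l %| c i)%N.
Proof.
move=> l0 cop zl; have [C' [hC' CC' C'M ny aM]] := twist_base.
exact: (base_power hC' CC' C'M ny aM a_inj La nMa l0 cop Nz zl).
Qed.

Lemma artin_schreier_independent p : p \in [pchar K] ->
  \sum_i (c i)%:R / (y - a i) = z ^+ p - z -> forall i, (p %| c i)%N.
Proof.
move=> pcp zp; have [C' [hC' CC' C'M ny aM]] := twist_base.
exact: (base_artin_schreier hC' CC' C'M ny aM a_inj La nMa pcp Nz zp).
Qed.

End Independence.

(** * Characters of the Galois group *)

(** No relation is shortest: translate it by an [x0] where [rho i] and [rho j] differ and subtract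
    [rho j x0] times the relation; the [j]-th term disappears and the [i]-th stays. *)
Lemma dedekind (K : fieldType) (W : K -> Prop) n (rho : 'I_n -> K -> K) :
    W 1 -> (forall x y, W x -> W y -> W (x * y)) ->
    (forall i, rho i 1 = 1) -> (forall i x y, rho i (x * y) = rho i x * rho i y) ->
    (forall i j, i != j -> exists x, W x /\ rho i x <> rho j x) ->
  forall c : 'I_n -> K, (exists i, c i != 0) -> exists x, W x /\ \sum_i c i * rho i x != 0.
Proof.
move=> W1 WM r1 rM rneq c [i ci]; apply: contrapT => nx.
have {nx} c0 x : W x -> \sum_i c i * rho i x = 0.
  by move=> Wx; apply/eqP; apply: contrapT => /negP h; apply: nx; exists x.
have [k] := ubnP #|[pred j | c j != 0]|; elim: k => // k IH in c c0 i ci *.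
rewrite ltnS => ck; have [[j /andP[ji cj]]|onlyi] := pselect (exists j, (j != i) && (c j != 0)).
  have [x0 [Wx0 x0ij]] := rneq _ _ ji.
  apply: (IH (fun k => c k * (rho k x0 - rho j x0)) _ i).
  - move=> x Wx; have := c0 _ (WM _ _ Wx0 Wx); have := c0 _ Wx => cx cx0.
    have -> : \sum_k c k * (rho k x0 - rho j x0) * rho k x =
        \sum_k c k * rho k (x0 * x) - rho j x0 * \sum_k c k * rho k x.
      by rewrite mulr_sumr -sumrB; apply: eq_bigr => l _; rewrite rM; ring.
    by rewrite cx cx0 mulr0 subrr.
  - by rewrite mulf_neq0 // subr_eq0; apply/eqP/nesym.
  - apply: leq_trans ck; apply: proper_card; apply/fintype.properP; split.
      by apply/fintype.subsetP => l; rewrite !inE mulf_eq0 negb_or => /andP[].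
    by exists j; rewrite !inE ?subrr ?mulr0 ?eqxx.
have := c0 _ W1; rewrite (bigD1 i) //= big1 => [/eqP|j ji].
  by rewrite addr0 r1 mulr1 (negPf ci).
have [-> |cj] := eqVneq (c j) 0; first by rewrite mul0r.
by case: onlyi; exists j; rewrite ji.
Qed.

(** Congruences below are proved by combining known ones and leaving the remaining identity to
    [ring]. *)
Lemma dvdz_transport (d a b : int) : (d %| a)%Z -> a = b -> (d %| b)%Z.
Proof. by move=> ? <-. Qed.

Section Galois.
Variables (K : closedFieldType) (N : K -> Prop).
Hypothesis hN : is_subfield N.
Let hNR := subfield_subring hN.
Let hA := alg_subfield hN.
Let hAR := subfield_subring hA.
Local Notation G := (N_emb N).

Lemma emb_comp s t : G s -> G t -> G (s \o t).
Proof.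
move=> hs ht; split=> [x y|x y||x Nx] /=.
- by rewrite (embD ht) (embD hs).
- by rewrite (embM ht) (embM hs).
- by rewrite (emb1 ht) (emb1 hs).
- by rewrite (emb_id ht Nx) (emb_id hs Nx).
Qed.

Lemma emb_idfun : G id. Proof. by []. Qed.

Lemma emb_alg s x : G s -> algP N x -> algP N (s x).
Proof. by move=> hs [f [f0 Nf fx]]; exists f; split=> //; apply: (emb_root hs). Qed.

Lemma emb_rmorphism s : G s -> exists j : {rmorphism K -> K}, forall u, j u = s u.
Proof.
move=> hs; have hT : is_subfield (fun _ : K => True) by split.
apply: (hom_on_model (E := fun _ => True) hT _ (e := idfun)) => //.
by split=> [x y _ _|x y _ _|]; [apply: (embD hs)|apply: (embM hs)|apply: (emb1 hs)].
Qed.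

Lemma stable_list (r : seq K) : (forall y, y \in r -> algP N y) ->
  exists r' : seq K, [/\ {subset r <= r'}, (forall y, y \in r' -> algP N y) &
    forall s y, G s -> y \in r' -> s y \in r'].
Proof.
elim: r => [|x r IH] hr; first by exists [::]; split.
have [|r1 [rr1 ar1 sr1]] := IH; first by move=> y yr; apply: hr; rewrite inE yr orbT.
have [f [f0 Nf fx]] := hr x (mem_head _ _).
have [r2 fE] := closed_field_poly_normal f.
have r2E y : (y \in r2) = root f y by rewrite fE rootZ ?lead_coef_eq0 // root_prod_XsubC.
exists (r2 ++ r1); split.
- by move=> y; rewrite inE mem_cat => /orP[/eqP->|/rr1->]; rewrite ?orbT ?r2E ?fx.
- by move=> y; rewrite mem_cat r2E => /orP[fy|/ar1//]; exists f.
- move=> s y hs; rewrite !mem_cat !r2E => /orP[fy|/(sr1 _ _ hs)->]; last by rewrite orbT.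
  by rewrite (emb_root hs Nf fy).
Qed.

Definition agree (r : seq K) (s t : K -> K) : Prop := forall y, y \in r -> s y = t y.

(** On a stable list an embedding acts as a self-map of a finite type, so there are finitely many
    classes of embeddings. *)
Lemma finite_reps (r : seq K) : (forall s y, G s -> y \in r -> s y \in r) ->
  exists m (rho : 'I_m -> K -> K), [/\ (forall i, G (rho i)),
    (forall s, G s -> exists i, agree r (rho i) s) &
    forall i j, agree r (rho i) (rho j) -> i = j].
Proof.
move=> sr; pose pi (s : K -> K) : {ffun seq_sub r -> seq_sub r} := [ffun y => insubd y (s (ssval y))].
have piE s : G s -> forall y, ssval (pi s y) = s (ssval y).
  by move=> hs y; rewrite ffunE val_insubd sr // ssvalP.
have piP s t : G s -> G t -> pi s = pi t <-> agree r s t.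
  move=> hs ht; split=> [E y yr|E].
    by have := piE _ hs (SeqSub yr); rewrite E piE //= => ->.
  by apply/ffunP => y; apply: val_inj; rewrite [LHS]piE // [RHS]piE // E // ssvalP.
pose A := [set x | `[< exists s, G s /\ pi s = x >]].
have /choice[f fE] (x : {ffun seq_sub r -> seq_sub r}) : exists s, x \in A -> G s /\ pi s = x.
  have [|_] := boolP (x \in A); last by exists id.
  by rewrite inE => /asboolP[s sE]; exists s.
exists #|A|, (fun i => f (enum_val i)); split.
- by move=> i; have [] := fE _ (enum_valP i).
- move=> s hs; have As : pi s \in A by rewrite inE; apply/asboolP; exists s.
  exists (enum_rank_in As (pi s)); rewrite enum_rankK_in //.
  by have [h1 h2] := fE _ As; apply/piP.
- move=> i j; have [hi iE] := fE _ (enum_valP i); have [hj jE] := fE _ (enum_valP j).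
  by move/(piP _ _ hi hj); rewrite iE jE => /enum_val_inj.
Qed.

Lemma emb_fin_orbit x : algP N x -> exists r : seq K, forall s, G s -> s x \in r.
Proof.
move=> ax; have [|r [xr _ sr]] := @stable_list [:: x].
  by move=> y; rewrite inE => /eqP->.
by exists r => s hs; apply: sr => //; apply: xr; rewrite inE.
Qed.

(** An integer-valued function stands for a continuous character to [Z/n]: only its values modulo
    [n] at embeddings matter, and one type serves all moduli. Continuity is dependence on a finite
    list of algebraic elements. *)
Definition is_char (n : nat) (chi : (K -> K) -> int) : Prop :=
  (forall s t, G s -> G t -> (n%:Z %| chi (s \o t) - (chi s + chi t))%Z) /\
  exists r : seq K, (forall y, y \in r -> algP N y) /\
    forall s t, G s -> G t -> agree r s t -> (n%:Z %| chi s - chi t)%Z.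

(* The finite quotient of the Galois group through which a character factors:
   [rho] lists representatives, [tau s] is left translation by [s], and [W] is
   the set of algebraic elements on which each embedding is determined by its class. *)
Lemma char_quotient n chi : is_char n chi ->
  exists m (rho : 'I_m -> K -> K) (tau : (K -> K) -> 'I_m -> 'I_m) (W : K -> Prop),
  [/\ (forall i, G (rho i)), (forall x, W x -> algP N x /\ forall s, G s -> W (s x)),
      (forall s, G s -> exists i, (forall x, W x -> rho i x = s x) /\ (n%:Z %| chi (rho i) - chi s)%Z),
      (forall s, G s -> injective (tau s) /\ forall i,
        (n%:Z %| chi (rho (tau s i)) - (chi s + chi (rho i)))%Z /\
        forall x, W x -> s (rho i x) = rho (tau s i) x) &
      forall c : 'I_m -> K, (exists i, c i != 0) ->
        exists x, W x /\ \sum_i c i * rho i x != 0].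
Proof.
move=> [chiM [r0 [ar0 chi_r0]]]; have [r [r0r ar sr]] := stable_list ar0.
have chi_r s t : G s -> G t -> agree r s t -> (n%:Z %| chi s - chi t)%Z.
  by move=> hs ht st; apply: chi_r0 => // y /r0r/st.
have [m [rho [Grho repr rho_inj]]] := finite_reps sr.
pose W x := algP N x /\ forall s t, G s -> G t -> agree r s t -> s x = t x.
have WM x y : W x -> W y -> W (x * y).
  move=> [ax Wx] [ay Wy]; split; first exact: (subringM hAR).
  by move=> s t hs ht st; rewrite (embM hs) (embM ht) (Wx s t) // (Wy s t).
have W1 : W 1.
  by split=> [|s t hs ht _]; [apply: (subring1 hAR)|rewrite (emb1 hs) (emb1 ht)].
have Wr y : y \in r -> W y by move=> yr; split=> [|s t hs ht st]; [apply: ar|apply: st].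
have /choice[tau tauE] s : exists t : 'I_m -> 'I_m, G s -> forall i, agree r (rho (t i)) (s \o rho i).
  have [hs|nhs] := pselect (G s); last by exists id.
  have /choice[t tE] i : exists j, agree r (rho j) (s \o rho i).
    by apply: repr; apply: emb_comp.
  by exists t.
exists m, rho, tau, W; split=> //.
- move=> x [ax Wx]; split=> // s hs; split; first exact: emb_alg.
  move=> u t hu ht ut; apply: (Wx (u \o s) (t \o s)); [exact: emb_comp|exact: emb_comp|].
  by move=> y yr; apply/ut/sr.
- move=> s hs; have [i iE] := repr s hs; exists i; split; last exact: chi_r.
  by move=> x [_ Wx]; apply: Wx.
- move=> s hs; split.
    move=> i j tij; apply: rho_inj => y yr; apply: (emb_inj hs).
    by have := tauE s hs i y yr; rewrite tij (tauE s hs j y yr) => /esym.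
  move=> i; have ti := tauE s hs i; have hsi : G (s \o rho i) by apply: emb_comp.
  split; last by move=> x [_ Wx]; rewrite (Wx _ _ (Grho _) hsi ti).
  have d1 := chi_r _ _ (Grho _) hsi ti; have d2 := chiM _ _ hs (Grho i).
  by have := rpredD d1 d2; rewrite addrA subrK.
- apply: (dedekind W1 WM).
  + by move=> i; rewrite (emb1 (Grho i)).
  + by move=> i x y; rewrite (embM (Grho i)).
  + move=> i j ij; apply: contrapT => h; case/eqP: ij; apply: rho_inj => y yr.
    by apply: contrapT => nE; apply: h; exists y; split=> //; apply: Wr.
Qed.

Hypothesis perfN : forall e x, [pchar K].-nat e -> N x -> exists2 w, N w & w ^+ e = x.

Lemma frobenius_inj e : [pchar K].-nat e -> injective (fun x : K => x ^+ e).
Proof.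
move=> pe x y /eqP; rewrite -subr_eq0 -exprNn_pchar // -exprDn_pchar // expf_eq0.
by rewrite subr_eq0 => /andP[_ /eqP].
Qed.

(** Some power [x^e] lies in [N'], hence in [N]; it has an [e]-th root in [N] by perfectness, and
    [e]-th roots are unique. *)
Lemma fixed_in (N' : K -> Prop) x : is_subfield N' -> (forall x, algP N' x) ->
    (forall x, N' x -> algP N x -> N x) -> algP N x ->
  (forall s, N_emb N' s -> s x = x) -> N x.
Proof.
move=> hN' aN' rN' ax fx; have [e pe Ne] := fixed_power hN' aN' fx.
have [|w Nw wx] := perfN pe (rN' _ Ne _); first exact: (subringX hAR).
by rewrite -(frobenius_inj pe wx).
Qed.

Lemma fixedN x : algP N x -> (forall s, G s -> s x = x) -> N x.
Proof.
move=> ax fx; have [N' [hN' NN' aN' rN']] := regular_extension hN.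
by apply: (fixed_in hN' aN' rN' ax) => s /(emb_sub NN')/fx.
Qed.

Lemma stable_prod (r : seq K) : uniq r -> (forall y, y \in r -> algP N y) ->
    (forall s y, G s -> y \in r -> s y \in r) ->
  forall i, N (\prod_(y <- r) ('X - y%:P))`_i.
Proof.
move=> ur ar sr i; apply: fixedN.
  have : poly_in (algP N) (\prod_(y <- r) ('X - y%:P)).
    rewrite big_seq; apply: (poly_in_prod hAR) => y /ar ay.
    by apply: (poly_inB hAR); [apply: (poly_inX hAR)|apply: (poly_inC hAR)].
  exact.
move=> s hs; have [j jE] := emb_rmorphism hs; rewrite -jE -coef_map.
rewrite (_ : map_poly j _ = \prod_(y <- r) ('X - y%:P)) // rmorph_prod /=.
transitivity (\prod_(y <- map s r) ('X - y%:P)).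
  by rewrite big_map; apply: eq_bigr => y _; rewrite /= map_polyXsubC jE.
apply: perm_big.
apply: uniq_perm => //; first by rewrite map_inj_uniq //; apply: (emb_inj hs).
have us : uniq (map s r) by rewrite map_inj_uniq //; apply: (emb_inj hs).
have sub : {subset map s r <= r} by move=> _ /mapP[y yr ->]; apply: sr.
by have [] := uniq_min_size us sub; rewrite ?size_map.
Qed.

(** Sums of conjugates over the classes of [chi] are permuted by embeddings according to the values
    of [chi] alone, so embeddings commute on them and they lie in the maximal abelian extension. By
    Dedekind's theorem enough of them exist to tell the classes apart. *)
Lemma char_max_ab n chi : is_char n chi -> exists ys : seq K,
  (forall y, y \in ys -> max_ab_ext N y) /\
  forall s t, G s -> G t -> agree ys s t -> (n%:Z %| chi s - chi t)%Z.
Proof.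
move=> hchi; have [chiM _] := hchi.
have [m [rho [tau [W [Grho Walg repr tauP ded]]]]] := char_quotient hchi.
pose sim i k := (n%:Z %| chi (rho k) - chi (rho i))%Z.
have simC i k : sim i k = sim k i by rewrite /sim -opprB rpredN.
have simT i j k : sim i j -> sim j k -> sim i k.
  by move=> h1 h2; have := rpredD h2 h1; rewrite addrA subrK.
have simr i : sim i i by rewrite /sim subrr dvdz0.
pose f i x := \sum_(k | sim i k) rho k x.
have fsim i j x : sim i j -> f i x = f j x.
  move=> ij; apply: eq_bigl => k; apply/idP/idP; last exact: simT.
  by apply: simT; rewrite simC.
have tau_sim s i k : G s -> sim (tau s i) (tau s k) = sim i k.
  move=> hs; have [_ tE] := tauP s hs; have [d1 _] := tE i; have [d2 _] := tE k.
  have := rpredB d2 d1; set A := chi (rho (tau s i)); set B := chi (rho (tau s k)).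
  rewrite /sim -/A -/B => d.
  have E : B - A = (B - (chi s + chi (rho k)) - (A - (chi s + chi (rho i)))) + (chi (rho k) - chi (rho i)).
    by ring.
  by rewrite E rpredDl.
have sf s i x : G s -> W x -> s (f i x) = f (tau s i) x.
  move=> hs Wx; have [tinj tE] := tauP s hs; rewrite /f (emb_sum hs).
  rewrite [RHS](reindex_inj tinj) /=; apply: eq_big => [k|k _]; first by rewrite tau_sim.
  by have [_ ->] := tE k.
have falg i x : W x -> algP N (f i x).
  by move=> /Walg[ax _]; apply: (subring_sum hAR) => k _; apply: emb_alg.
(* For classes on which [chi] differs, the difference of the two sums is a nontrivial combination of
   the [rho k], so some [x] separates them. *)
have /choice[th thE] (ij : 'I_m * 'I_m) : exists x, W x /\ (~~ sim ij.1 ij.2 -> f ij.1 x != f ij.2 x).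
  case: ij => i j /=; have [|nij] := boolP (sim i j).
    have [|x [Wx _]] := ded (fun k => (k == i)%:R); first by exists i; rewrite eqxx oner_neq0.
    by exists x.
  have [|x [Wx fx]] := ded (fun k => (sim i k)%:R - (sim j k)%:R).
    by exists i; rewrite simr [sim j i]simC (negPf nij) subr0 oner_neq0.
  exists x; split=> // _; apply: contraNneq fx => E; apply/eqP.
  transitivity (f i x - f j x); last by rewrite E subrr.
  rewrite /f [X in _ = X - _]big_mkcond [X in _ = _ - X]big_mkcond -sumrB /=.
  apply: eq_bigr => k _; rewrite mulrBl.
  by case: (sim i k); case: (sim j k); rewrite /= ?mul1r ?mul0r.
pose y (p : 'I_m * ('I_m * 'I_m)) := f p.1 (th p.2).
exists [seq y p | p <- enum {: 'I_m * ('I_m * 'I_m)}]; split.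
  move=> _ /mapP[[k ij] _ ->]; rewrite /y /=; have [Wx _] := thE ij.
  move: (th ij) Wx => x Wx; exists (undup [seq f i x | i <- enum 'I_m]); split.
  - by rewrite mem_undup; apply: map_f; rewrite mem_enum.
  - exact: undup_uniq.
  - apply: stable_prod; first exact: undup_uniq.
      by move=> z; rewrite mem_undup => /mapP[i _ ->]; apply: falg.
    move=> s z hs; rewrite !mem_undup => /mapP[i _ ->].
    by rewrite sf //; apply: map_f; rewrite mem_enum.
  - move=> s t hs ht z; rewrite mem_undup => /mapP[i _ ->].
    rewrite !sf //; apply: fsim; rewrite /sim.
    have [_ /(_ i) [ti _]] := tauP t ht; have [_ /(_ (tau t i)) [sti _]] := tauP s hs.
    have [_ /(_ i) [si _]] := tauP s hs; have [_ /(_ (tau s i)) [tsi _]] := tauP t ht.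
    by apply: (dvdz_transport (rpredB (rpredD tsi si) (rpredD sti ti))); ring.
move=> s t hs ht st; have [k0 [_ k0id]] := repr id emb_idfun.
have stk x : x \in [seq th ij | ij <- enum {: 'I_m * 'I_m}] -> f (tau s k0) x = f (tau t k0) x.
  move=> /mapP[ij _ ->]; have [Wx _] := thE ij; rewrite -!sf //; apply: st.
  by apply/mapP; exists (k0, ij); rewrite ?mem_enum.
have st0 : sim (tau s k0) (tau t k0).
  apply: contraT => nst; have [_ /(_ nst)/=/eqP[]] := thE (tau s k0, tau t k0).
  by apply: stk; apply: map_f; rewrite mem_enum.
have [_ /(_ k0) [sk _]] := tauP s hs; have [_ /(_ k0) [tk _]] := tauP t ht.
by apply: (dvdz_transport (rpredB (rpredB tk sk) st0)); ring.
Qed.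

End Galois.

(** * Kummer and Artin-Schreier theory *)

Section RootsOfUnity.
Variable K : closedFieldType.

Lemma prim_root_exists n : n%:R != 0 :> K -> exists z : K, n.-primitive_root z.
Proof.
move=> n0K; have n0 : (0 < n)%N by rewrite lt0n; apply: contraNneq n0K => ->.
have [r rE] := closed_field_poly_normal ('X^n - 1 : {poly K}).
have lc : lead_coef ('X^n - 1 : {poly K}) = 1 by apply/monicP/monicXnsubC.
rewrite lc scale1r in rE.
have ur : uniq r by rewrite -separable_prod_XsubC -rE separable_Xn_sub_1.
have sr : size r = n.
  by have /eqP := size_prod_XsubC r id; rewrite -rE size_XnsubC // eqSS => /eqP.
have /(has_prim_root n0) : all n.-unity_root r.
  apply/allP => z; rewrite -root_prod_XsubC -rE /root !hornerE subr_eq0.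
  by rewrite unity_rootE.
by move=> /(_ ur); rewrite sr leqnn => /(_ isT)/hasP[z _ zP]; exists z.
Qed.

Variables (n : nat) (z : K).
Hypothesis zP : n.-primitive_root z.

Lemma prim_neq0 : z != 0.
Proof.
have n0 := prim_order_gt0 zP; apply: contra_eq_neq (prim_expr_order zP) => ->.
by rewrite expr0n eqn0Ngt n0 eq_sym oner_neq0.
Qed.

Lemma prim_exprz_eq1 (a : int) : (z ^ a == 1) = (n%:Z %| a)%Z.
Proof.
case: a => a; first by rewrite -exprnP -(prim_order_dvd zP) dvdzE.
by rewrite NegzE -exprnN invr_eq1 -(prim_order_dvd zP) dvdzE abszN.
Qed.

Lemma prim_exprz_eq (a b : int) : (z ^ a == z ^ b) = (n%:Z %| a - b)%Z.
Proof.
have zb0 : z ^ b != 0 by rewrite expfz_neq0 ?prim_neq0.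
rewrite -prim_exprz_eq1 -(inj_eq (mulIf zb0) (z ^ (a - b))) -expfzDr ?prim_neq0 //.
by rewrite subrK mul1r.
Qed.


Lemma exprz_dvd (a b : int) : (n%:Z %| a - b)%Z -> z ^ a = z ^ b.
Proof. by rewrite -prim_exprz_eq => /eqP. Qed.

End RootsOfUnity.

(** [X^p - X] has at most [p] roots, and the prime field already provides [p] of them. *)
Lemma frobenius_fixed (K : fieldType) p (x : K) : p \in [pchar K] -> x ^+ p = x ->
  exists k : nat, x = k%:R.
Proof.
move=> pcp xp; have p_pr := pcharf_prime pcp; have p1 := prime_gt1 p_pr.
have [/mapP[k _ ->]|nx] := boolP (x \in [seq k%:R | k <- iota 0 p]); first by exists k.
have f0 : 'X^p - 'X != 0 :> {poly K}.
  by rewrite -size_poly_gt0 size_polyDl size_polyXn // size_polyN size_polyX.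
have rts : all (root ('X^p - 'X)) (x :: [seq k%:R | k <- iota 0 p]).
  apply/allP => y; rewrite inE /root !hornerE subr_eq0 => /orP[/eqP->|/mapP[k _ ->]].
    by rewrite xp.
  by rewrite -(pFrobenius_autE pcp) pFrobenius_aut_nat.
have ur : uniq (x :: [seq k%:R | k <- iota 0 p]).
  rewrite /= nx /= map_inj_in_uniq ?iota_uniq // => k l; rewrite !mem_iota /= add0n.
  wlog le_kl : k l / (k <= l)%N.
    move=> h kp lp; case: (leqP k l) => [kl|/ltnW kl] E; first exact: h.
    exact/esym/h.
  move=> kp lp /eqP; rewrite eq_sym -subr_eq0 -natrB // -(dvdn_pcharf pcp) => d.
  apply/eqP; rewrite eqn_leq le_kl /= leqNgt; apply/negP => lt_kl.
  have lk0 : (0 < l - k)%N by rewrite subn_gt0.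
  by have := leq_ltn_trans (dvdn_leq lk0 d) (leq_ltn_trans (leq_subr k l) lp); rewrite ltnn.
have := max_poly_roots f0 rts ur.
by rewrite /= size_map size_iota size_polyDl size_polyXn ?size_polyN ?size_polyX // ltnn.
Qed.

Lemma size_artin_schreier (K : fieldType) p (a : K) : (1 < p)%N ->
  size ('X^p - 'X - a%:P) = p.+1.
Proof.
by move=> p1; rewrite -addrA -opprD size_polyDl size_polyXn // size_polyN size_XaddC.
Qed.

Lemma intr_pchar_eq (F : fieldType) p (a b : int) : p \in [pchar F] ->
  (a%:~R == b%:~R :> F) = (p%:Z %| a - b)%Z.
Proof.
move=> pcp; rewrite -subr_eq0 -rmorphB /=; case: (a - b) => c.
  by rewrite -pmulrn -(dvdn_pcharf pcp) dvdzE.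
by rewrite NegzE mulrNz oppr_eq0 -pmulrn -(dvdn_pcharf pcp) dvdzE abszN.
Qed.

Section CharacterGenerators.
Variables (K : closedFieldType) (N : K -> Prop).
Hypothesis hN : is_subfield N.
Let hNR := subfield_subring hN.
Let hA := alg_subfield hN.
Let hAR := subfield_subring hA.
Local Notation G := (N_emb N).
Local Notation is_char := (is_char N).
Hypothesis rootsN : forall n (z : K), (0 < n)%N -> z ^+ n = 1 -> N z.

Lemma emb_exprz s (z : K) (a : int) : G s -> N z -> s (z ^ a) = z ^ a.
Proof.
move=> hs Nz; case: a => a; first by rewrite -exprnP (embX hs) (emb_id hs).
by rewrite NegzE -exprnN (embV hs) (embX hs) (emb_id hs).
Qed.

Lemma alg_is_char n chi (r : seq K) : (forall y, y \in r -> algP N y) ->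
  (forall s t, G s -> G t -> (n%:Z %| chi (s \o t) - (chi s + chi t))%Z) ->
  (forall s t, G s -> G t -> agree r s t -> (n%:Z %| chi s - chi t)%Z) -> is_char n chi.
Proof. by move=> ar hM hr; split=> //; exists r. Qed.

(** The generator is the Lagrange resolvent of [chi], nonzero for a suitable [x] by independence of
    the embeddings. *)
Lemma kummer_generator n z chi : n.-primitive_root z -> is_char n chi ->
  exists x, [/\ x != 0, algP N x & forall s, G s -> s x = z ^ chi s * x].
Proof.
move=> zP hchi; have n0 := prim_order_gt0 zP; have Nz := rootsN n0 (prim_expr_order zP).
have [m [rho [tau [W [Grho Walg repr tauP ded]]]]] := char_quotient hN hchi.
have z0 := prim_neq0 zP; have zX a : z ^ a != 0 by rewrite expfz_neq0.
have [|x [Wx x0]] := ded (fun i => z ^ (- chi (rho i))).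
  by have [i _] := repr id (emb_idfun N); exists i.
exists (\sum_i z ^ (- chi (rho i)) * rho i x); split=> //.
  apply: (subring_sum hAR) => i _; apply: (subringM hAR); last by apply: emb_alg => //; case: (Walg _ Wx).
  by case: (- chi _) => a; rewrite ?NegzE -?exprnP -?exprnN;
    [|apply: (subfieldV hA)]; apply: (subringX hAR); apply: alg_id.
move=> s hs; have [tinj tE] := tauP s hs; rewrite (emb_sum hs) mulr_sumr.
rewrite [RHS](reindex_inj tinj); apply: eq_bigr => i _ /=; have [ti tx] := tE i.
rewrite (embM hs) (emb_exprz _ hs Nz) tx // mulrA -expfzDr //; congr (_ * _).
apply: (exprz_dvd zP); apply: (dvdz_transport ti); ring.
Qed.

Lemma kummer_char n z x : n.-primitive_root z -> x != 0 -> algP N x ->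
    (forall s, G s -> s x ^+ n = x ^+ n) ->
  exists2 chi, is_char n chi & forall s, G s -> s x = z ^ chi s * x.
Proof.
move=> zP x0 ax sx; have n0 := prim_order_gt0 zP; have Nz := rootsN n0 (prim_expr_order zP).
have /choice[chi chiE] s : exists a : int, G s -> s x = z ^ a * x.
  have [hs|nhs] := pselect (G s); last by exists 0.
  have [|i iE] := prim_rootP zP (x := s x / x).
    by rewrite exprMn exprVn sx // divff // expf_neq0.
  by exists i => _; rewrite -exprnP -iE divfK.
exists chi => //; apply: (@alg_is_char n chi [:: x]).
- by move=> y; rewrite inE => /eqP->.
- move=> s t hs ht; rewrite -(prim_exprz_eq zP) -(inj_eq (mulIf x0)).
  rewrite -chiE ?[_ \o _]/= ?(chiE t) //; last exact: emb_comp.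
  rewrite /= (chiE t) // (embM hs) (chiE s) // (emb_exprz _ hs Nz).
  by rewrite expfzDr ?(prim_neq0 zP) // mulrA [z ^ chi t * _]mulrC.
- move=> s t hs ht st; rewrite -(prim_exprz_eq zP) -(inj_eq (mulIf x0)) -!chiE //.
  by rewrite st ?inE.
Qed.

(** With [z] of order [l n], [chi] is realized by some [x] with respect to [z^l]. An [l]-th root of
    [x] defines [psi] with respect to [z], and raising to the [l]-th power compares the two. *)
Lemma kummer_lift n l chi : (l * n)%:R != 0 :> K -> is_char n chi ->
  exists2 psi, is_char (l * n) psi & forall s, G s -> (n%:Z %| psi s - chi s)%Z.
Proof.
move=> ln0 hchi; have [z zP] := prim_root_exists ln0.
have ln_gt0 := prim_order_gt0 zP; have [l0 n0] : (0 < l)%N /\ (0 < n)%N by apply/andP; rewrite -muln_gt0.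
have zlP : n.-primitive_root (z ^+ l).
  by rewrite -[X in z ^+ X](mulnK l n0); apply: (dvdn_prim_root zP); rewrite dvdn_mull.
have [x [x0 ax xE]] := kummer_generator zlP hchi.
have [y yx] : exists y, y ^+ l = x.
  have [|y] := @closed_root K ('X^l - x%:P); first by rewrite size_XnsubC.
  by rewrite /root !hornerE subr_eq0 => /eqP; exists y.
have y0 : y != 0 by apply: contraNneq x0 => y0; rewrite -yx y0 expr0n eqn0Ngt l0.
have ay : algP N y by apply: (algX_inv hN l0); rewrite yx.
have zlX a : (z ^+ l) ^ a = z ^ (l%:Z * a) by rewrite exprnP exprz_exp.
have syl s : G s -> s y ^+ l = z ^ (l%:Z * chi s) * x.
  by move=> hs; rewrite -(embX hs) yx xE // zlX.
have [|psi psi_char psiE] := kummer_char zP y0 ay.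
  move=> s hs; rewrite !exprM syl // exprMn yx -[RHS]mul1r; congr (_ * _).
  rewrite exprnP exprz_exp; apply/eqP; rewrite (prim_exprz_eq1 zP).
  by rewrite mulrAC PoszM dvdz_mulr.
exists psi => // s hs; have := syl s hs; rewrite psiE // exprMn yx => /(mulIf x0).
rewrite exprnP exprz_exp => /eqP; rewrite (prim_exprz_eq zP) mulrC -mulrBr PoszM.
by rewrite dvdz_mul2l // eqz_nat -lt0n.
Qed.

Lemma int_frobenius p (a : int) : p \in [pchar K] -> (a%:~R : K) ^+ p = a%:~R.
Proof.
move=> pcp; rewrite -(pFrobenius_autE pcp); case: a => a; first exact: pFrobenius_aut_nat.
by rewrite NegzE mulrNz pFrobenius_autN -pmulrn pFrobenius_aut_nat.
Qed.

Lemma emb_int s (a : int) : G s -> s a%:~R = a%:~R.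
Proof. by move=> hs; apply: (emb_id hs); apply: (subringMz hNR); apply: (subring1 hNR). Qed.

Lemma artin_schreier_char p x : p \in [pchar K] -> algP N x ->
    (forall s, G s -> (s x - x) ^+ p = s x - x) ->
  exists2 chi, is_char p chi & forall s, G s -> s x = x + (chi s)%:~R.
Proof.
move=> pcp ax sx.
have /choice[chi chiE] s : exists a : int, G s -> s x = x + a%:~R.
  have [hs|nhs] := pselect (G s); last by exists 0.
  have [k kE] := frobenius_fixed pcp (sx s hs).
  by exists k => _; rewrite -pmulrn -kE addrC subrK.
exists chi => //; apply: (@alg_is_char p chi [:: x]).
- by move=> y; rewrite inE => /eqP->.
- move=> s t hs ht; rewrite -(intr_pchar_eq _ _ pcp) -(inj_eq (addrI x)) -chiE; last exact: emb_comp.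
  by rewrite /= (chiE t) // (embD hs) (emb_int _ hs) (chiE s) // rmorphD /= addrA.
- move=> s t hs ht st; rewrite -(intr_pchar_eq _ _ pcp) -(inj_eq (addrI x)) -!chiE //.
  by rewrite st ?inE.
Qed.

(* The weights [w i = rho_i theta / Tr theta] sum to [1] and are permuted by the
   Galois group, so averaging against them splits additive cocycles; applied to
   the carry cocycle of [chi] this is Albert's construction of cyclic extensions
   of degree [p n] above those of degree [n] in characteristic [p]. *)
Lemma albert_lift p n chi : p \in [pchar K] -> (0 < n)%N -> is_char n chi ->
  exists2 psi, is_char (p * n) psi & forall s, G s -> (n%:Z %| psi s - chi s)%Z.
Proof.
move=> pcp n0 hchi; have [chiM [r [ar chi_r]]] := hchi.
have [m [rho [tau [W [Grho Walg repr tauP ded]]]]] := char_quotient hN hchi.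
have p_nat : [pchar K].-nat p by rewrite (eq_pnat _ (pcharf_eq pcp)) pnat_id // (pcharf_prime pcp).
have powD (x y : K) : (x + y) ^+ p = x ^+ p + y ^+ p by rewrite exprDn_pchar.
have powB (x y : K) : (x - y) ^+ p = x ^+ p - y ^+ p by rewrite powD exprNn_pchar.
have pow0 : (0 : K) ^+ p = 0 by rewrite expr0n eqn0Ngt prime_gt0 // (pcharf_prime pcp).
have [|th [Wth tr0]] := ded (fun _ => 1).
  by have [i _] := repr id (emb_idfun N); exists i; rewrite oner_neq0.
have [ath Wsth] := Walg _ Wth.
set T := \sum_i _ in tr0.
have tauI s (hs : G s) := proj1 (tauP s hs).
have sT s : G s -> s T = T.
  move=> hs; rewrite (emb_sum hs) [RHS](reindex_inj (tauI s hs)); apply: eq_bigr => i _.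
  by rewrite !mul1r; have [_ /(_ i) [_ ->]] := tauP s hs.
pose w i := rho i th / T.
have sw s i : G s -> s (w i) = w (tau s i).
  move=> hs; rewrite (embM hs) (embV hs) sT // /w; have [_ /(_ i) [_ ->]] := tauP s hs; first by [].
  exact: Wth.
have w1 : \sum_i w i = 1.
  by rewrite -mulr_suml -(divff tr0); congr (_ / _); apply: eq_bigr => i _; rewrite mul1r.
have aw i : algP N (w i).
  apply: (subringM hAR); first exact: emb_alg.
  apply: (subfieldV hA); apply: (subring_sum hAR) => j _; rewrite mul1r; exact: emb_alg.
(* Reduced representatives make the carry [c] below depend only on the classes of its arguments. *)
pose c0 s : int := (chi s %% n%:Z)%Z.
have c0E s : (n%:Z %| c0 s - chi s)%Z.
  by rewrite /c0 {2}(divz_eq (chi s) n) opprD addrCA subrr addr0 rpredN dvdz_mull.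
have c0_eq s t : (n%:Z %| chi s - chi t)%Z -> c0 s = c0 t.
  by move=> d; apply/eqP; rewrite eqz_mod_dvd.
pose c s t : int := ((c0 s + c0 t - c0 (s \o t)) %/ n%:Z)%Z.
have cE s t : G s -> G t -> n%:Z * c s t = c0 s + c0 t - c0 (s \o t).
  move=> hs ht; rewrite mulrC divzK //.
  apply: (dvdz_transport (rpredB (rpredB (rpredD (c0E s) (c0E t)) (c0E (s \o t))) (chiM s t hs ht))).
  ring.
have nz : (n%:Z : int) != 0 by rewrite eqz_nat -lt0n.
have c_eq s t u v : G s -> G t -> G u -> G v -> c0 s = c0 u -> c0 t = c0 v ->
    c0 (s \o t) = c0 (u \o v).
  move=> hs ht hu hv E1 E2; apply: c0_eq.
  have d1 : (n%:Z %| chi s - chi u)%Z.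
    by apply: (dvdz_transport (rpredB (c0E u) (c0E s))); rewrite E1; ring.
  have d2 : (n%:Z %| chi t - chi v)%Z.
    by apply: (dvdz_transport (rpredB (c0E v) (c0E t))); rewrite E2; ring.
  apply: (dvdz_transport (rpredD (rpredB (chiM s t hs ht) (chiM u v hu hv)) (rpredD d1 d2))); ring.
have tau0 s i : G s -> c0 (rho (tau s i)) = c0 (s \o rho i).
  move=> hs; apply: c0_eq; have [_ /(_ i) [ti _]] := tauP s hs.
  by apply: (dvdz_transport (rpredB ti (chiM s (rho i) hs (Grho i)))); ring.
pose b s : K := \sum_i (c s (rho i))%:~R * s (w i).
have bE s t : G s -> G t -> b s + s (b t) - b (s \o t) = (c s t)%:~R.
  move=> hs ht; have -> : b s = \sum_i (c s (t \o rho i))%:~R * s (t (w i)).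
    rewrite /b (reindex_inj (tauI t ht)); apply: eq_bigr => i _.
    rewrite (sw t i ht); congr (_%:~R * _); rewrite /c (tau0 t i ht); congr (((_ + _ - _) %/ _)%Z).
    apply: c_eq => //; first exact: emb_comp.
    by rewrite tau0.
  rewrite /b (emb_sum hs) -big_split -sumrB /=.
  transitivity (\sum_i (c s t)%:~R * s (t (w i))); last first.
    by rewrite -mulr_sumr -(emb_sum hs) -(emb_sum ht) w1 (emb1 ht) (emb1 hs) mulr1.
  apply: eq_bigr => i _; rewrite (embM hs) (emb_int _ hs) -mulrDl -mulrBl; congr (_ * _).
  rewrite -!rmorphD -rmorphB /=; congr (_%:~R); apply: (mulfI nz).
  rewrite mulrBr mulrDr !cE //; try exact: emb_comp.
  have -> : c0 ((s \o t) \o rho i) = c0 (s \o (t \o rho i)) by [].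
  ring.
(* The carry takes values in the prime field, which [x -> x^p - x] kills; so [g] is an additive
   cocycle, and averaging yields [a] with [g s = a - s a]. *)
pose g s := b s ^+ p - b s.
have gE s t : G s -> G t -> g (s \o t) = g s + s (g t).
  move=> hs ht; have E := bE s t hs ht.
  have {}E : b (s \o t) = b s + s (b t) - (c s t)%:~R by rewrite -E; ring.
  by rewrite /g E powB powD int_frobenius // (embB hs) (embX hs); ring.
have g_tau s i : G s -> g (s \o rho i) = g (rho (tau s i)).
  move=> hs; suff E : b (s \o rho i) = b (rho (tau s i)) by rewrite /g E.
  apply: eq_bigr => j _; congr (_%:~R * _).
    rewrite /c tau0 //; congr (((_ + _ - _) %/ _)%Z); apply: c_eq => //; first exact: emb_comp.
    by rewrite tau0.
  have uw u : G u -> u (w j) = u (rho j th) / T by move=> hu; rewrite (embM hu) (embV hu) sT.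
  rewrite !uw //; last exact: emb_comp.
  congr (_ / _); have [_ /(_ i) [_ e]] := tauP s hs; exact/e/Wsth.
pose a := \sum_i g (rho i) * w i.
have sa s : G s -> s a = a - g s.
  move=> hs; rewrite /a (emb_sum hs) [in RHS](reindex_inj (tauI s hs)) /=.
  have -> : g s = \sum_i g s * s (w i) by rewrite -mulr_sumr -(emb_sum hs) w1 (emb1 hs) mulr1.
  rewrite -sumrB; apply: eq_bigr => i _; rewrite (embM hs) -sw // -mulrBl -g_tau // gE //.
  by congr (_ * _); ring.
have [al alE] : exists al, al ^+ p - al = a.
  have [|al] := @closed_root K ('X^p - 'X - a%:P).
    by rewrite size_artin_schreier ?ltnS ?prime_gt0 ?prime_gt1 ?(pcharf_prime pcp).
  by rewrite /root !hornerE subr_eq0 => /eqP; exists al.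
(* [d] differs from [b] by a coboundary, so it still splits the carry, but now with values in the
   prime field. *)
pose d s := b s + s al - al.
have dp s : G s -> d s ^+ p = d s.
  move=> hs; apply/eqP; rewrite -subr_eq0 /d powB powD -(embX hs).
  have -> : al ^+ p = a + al by rewrite -alE subrK.
  by rewrite (embD hs) sa // /g; apply/eqP; ring.
have /choice[dl dlE] s : exists k : int, G s -> d s = k%:~R.
  have [hs|nhs] := pselect (G s); last by exists 0.
  by have [k ->] := frobenius_fixed pcp (dp s hs); exists k.
have dl_eq s t : G s -> G t -> (p%:Z %| dl s + dl t - dl (s \o t) - c s t)%Z.
  move=> hs ht; rewrite -(intr_pchar_eq _ _ pcp) rmorphB rmorphD /= -!dlE ?bE //; last exact: emb_comp.
  have sd : d t = s (d t) by rewrite (dlE t ht) (emb_int _ hs).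
  by rewrite sd -bE // /d !(embB hs) !(embD hs); apply/eqP; rewrite /=; ring.
(* The term [n * dl s] cancels, modulo [p n], the failure of [c0] to be additive. *)
exists (fun s => c0 s - n%:Z * dl s); last first.
  move=> s hs; apply: (dvdz_transport (rpredB (c0E s) (dvdz_mulr (dl s) (dvdzz n%:Z)))); ring.
have aa : algP N a.
  have ab s : G s -> algP N (b s).
    move=> hs; apply: (subring_sum hAR) => i _; apply: (subringM hAR); last exact: emb_alg.
    by apply: (subringMz hAR); apply: (subring1 hAR).
  apply: (subring_sum hAR) => i _; apply: (subringM hAR) => //.
  by apply: (subringB hAR); [apply: (subringX hAR)|]; apply: ab.
have aal : algP N al.
  apply: (@alg_root _ _ hN ('X^p - 'X - a%:P)).
  - by rewrite -size_poly_gt0 size_artin_schreier ?prime_gt1 ?(pcharf_prime pcp).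
  - apply: (poly_inB hAR); last exact: (poly_inC hAR).
    by apply: (poly_inB hAR); [apply: (poly_inXn hAR)|]; apply: (poly_inX hAR).
  - by rewrite /root !hornerE alE subrr.
apply: (@alg_is_char (p * n) _ (al :: [seq w i | i <- enum 'I_m] ++ r)).
- move=> y; rewrite inE mem_cat => /orP[/eqP->//|/orP[/mapP[i _ ->]//|/ar//]].
- move=> s t hs ht; have -> : c0 (s \o t) - n%:Z * dl (s \o t)
      - (c0 s - n%:Z * dl s + (c0 t - n%:Z * dl t))
      = n%:Z * (dl s + dl t - dl (s \o t) - c s t).
    by rewrite mulrBr cE //; ring.
  by rewrite PoszM [p%:Z * _]mulrC dvdz_mul2l //; apply: dl_eq.
- move=> s t hs ht st.
  have E0 : c0 s = c0 t.
    by apply/c0_eq/chi_r => // y yr; apply: st; rewrite inE mem_cat yr !orbT.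
  have -> : c0 s - n%:Z * dl s - (c0 t - n%:Z * dl t) = n%:Z * (dl t - dl s).
    by rewrite E0; ring.
  rewrite PoszM [p%:Z * _]mulrC dvdz_mul2l // -(intr_pchar_eq _ _ pcp) -!dlE //; apply/eqP.
  have bts : b t = b s.
    apply: eq_bigr => i _; rewrite (st (w i)); last first.
      by rewrite inE mem_cat map_f ?mem_enum ?orbT.
    by rewrite /c E0 (c_eq s (rho i) t (rho i)).
  by rewrite /d bts st // mem_head.
Qed.

(** Additive resolvent: [s x = x - chi(s) T] for a nonzero trace [T], which is then divided out. *)
Lemma artin_schreier_generator p chi : p \in [pchar K] -> is_char p chi ->
  exists2 x, algP N x & forall s, G s -> s x = x + (chi s)%:~R.
Proof.
move=> pcp hchi.
have [m [rho [tau [W [Grho Walg repr tauP ded]]]]] := char_quotient hN hchi.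
have [|th [Wth tr0]] := ded (fun _ => 1).
  by have [i _] := repr id (emb_idfun N); exists i; rewrite oner_neq0.
have [ath Wsth] := Walg _ Wth; set T := \sum_i _ in tr0.
have sT s : G s -> s T = T.
  move=> hs; have [tinj tE] := tauP s hs; rewrite (emb_sum hs) [RHS](reindex_inj tinj).
  by apply: eq_bigr => i _; rewrite !mul1r; have [_ ->] := tE i.
pose x := \sum_i (chi (rho i))%:~R * rho i th.
have ax : algP N x.
  apply: (subring_sum hAR) => i _; apply: (subringM hAR); last exact: emb_alg.
  by apply: (subringMz hAR); apply: (subring1 hAR).
have aT : algP N T.
  by apply: (subring_sum hAR) => i _; rewrite mul1r; apply: emb_alg.
exists (- x / T) => [|s hs].
  by apply: (subringM hAR); [apply: (subringN hAR)|apply: (subfieldV hA)].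
have [tinj tE] := tauP s hs.
suff sx : s x = x - (chi s)%:~R * T.
  by rewrite (embM hs) (embN hs) (embV hs) sT // sx opprB mulrBl mulfK // mulNr addrC.
rewrite (emb_sum hs) /x [in RHS](reindex_inj tinj) /T [X in _ - _ * X](reindex_inj tinj) /=.
rewrite mulr_sumr -sumrB; apply: eq_bigr => i _; have [ti tx] := tE i.
rewrite (embM hs) (emb_int _ hs) tx // mul1r -mulrBl -rmorphB /=; congr (_ * _).
apply/eqP; rewrite (intr_pchar_eq _ _ pcp) -opprB rpredN.
by apply: (dvdz_transport ti); ring.
Qed.

End CharacterGenerators.

(** * Lifting characters to the profinite integers *)

Lemma crt_seq (ps : seq nat) (e : nat -> nat) (u : nat -> int) :
    uniq ps -> all prime ps ->
  exists a : int, forall l, l \in ps -> ((l ^ e l)%N%:Z %| a - u l)%Z.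
Proof.
elim: ps => [|p ps IH]; first by exists 0.
move=> /= /andP[p_ps ups] /andP[p_pr ps_pr]; have [a aE] := IH ups ps_pr.
pose P := (\prod_(l <- ps) l ^ e l)%N.
have cop : coprimez (p ^ e p)%N%:Z P%:Z.
  rewrite /coprimez /gcdz /= eqz_nat; apply: coprimeXl.
  rewrite /P big_seq; apply: (big_ind (coprime p)) => [|x y|l l_ps]; first exact: coprimen1.
    by rewrite coprimeMr => -> ->.
  apply: coprimeXr; rewrite prime_coprime // dvdn_prime2 //; last exact: (allP ps_pr).
  by apply: contraNneq p_ps => ->.
exists (zchinese (p ^ e p)%N%:Z P%:Z (u p) a) => l; rewrite inE => /orP[/eqP->|l_ps].
  by rewrite -eqz_mod_dvd zchinese_modl.
have d : (P%:Z %| zchinese (p ^ e p)%N%:Z P%:Z (u p) a - a)%Z.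
  by rewrite -eqz_mod_dvd zchinese_modr.
have lP : ((l ^ e l)%N%:Z %| P%:Z)%Z.
  by rewrite dvdzE /P (big_rem l) //= dvdn_mulr.
by have := rpredD (dvdz_trans lP d) (aE l l_ps); rewrite addrA subrK.
Qed.

Lemma crt n (u : nat -> int) : (0 < n)%N ->
  exists a : int, forall l, prime l -> ((l ^ logn l n)%N%:Z %| a - u l)%Z.
Proof.
move=> n0; have [|a aE] := @crt_seq (primes n) (fun l => logn l n) u (primes_uniq n).
  by apply/allP => l; rewrite mem_primes => /andP[].
exists a => l l_pr; have [/aE //|l_n] := boolP (l \in primes n).
by rewrite lognE; move: l_n; rewrite mem_primes l_pr n0 /= => /negPf->; rewrite expn0 dvd1z.
Qed.

Lemma dvdz_primary n (a : int) : (0 < n)%N ->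
  (forall l, prime l -> ((l ^ logn l n)%N%:Z %| a)%Z) -> (n%:Z %| a)%Z.
Proof.
move=> n0 h; rewrite dvdzE; apply/(dvdn_partP _ n0) => p p_n.
by rewrite p_part; have := h p; rewrite dvdzE; apply; move: p_n; rewrite mem_primes => /andP[].
Qed.

Section ProfiniteLift.
Variables (K : closedFieldType) (N : K -> Prop).
Hypothesis hN : is_subfield N.
Local Notation G := (N_emb N).
Local Notation is_char := (is_char N).
Hypothesis rootsN : forall n (z : K), (0 < n)%N -> z ^+ n = 1 -> N z.

Lemma is_charW m n chi : (m %| n)%N -> is_char n chi -> is_char m chi.
Proof.
move=> mn [hM [r [ar hr]]]; have d : (m%:Z %| n%:Z)%Z by rewrite dvdzE.
by split=> [s t hs ht|]; [apply: dvdz_trans d (hM _ _ _ _)|exists r; split=> // s t hs ht /hr h;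
   apply: dvdz_trans d (h _ _)].
Qed.

Lemma is_char_eq n chi psi : is_char n chi -> (forall s, G s -> (n%:Z %| psi s - chi s)%Z) ->
  is_char n psi.
Proof.
move=> [hM [r [ar hr]]] E; split=> [s t hs ht|].
  apply: (dvdz_transport (rpredB (rpredD (hM s t hs ht) (E _ (emb_comp hs ht))) (rpredD (E s hs) (E t ht)))).
  ring.
exists r; split=> // s t hs ht st.
apply: (dvdz_transport (rpredB (rpredD (hr s t hs ht st) (E s hs)) (E t ht))); ring.
Qed.

Lemma is_char0 n : is_char n (fun _ => 0).
Proof. by split=> [s t _ _|]; [rewrite dvdz0|exists [::]; split=> // s t _ _ _; rewrite dvdz0]. Qed.

Lemma is_charD n chi psi : is_char n chi -> is_char n psi -> is_char n (fun s => chi s + psi s).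
Proof.
move=> [hM [r [ar hr]]] [hM' [r' [ar' hr']]]; split=> [s t hs ht|].
  by apply: (dvdz_transport (rpredD (hM s t hs ht) (hM' s t hs ht))); ring.
exists (r ++ r'); split=> [y|s t hs ht st]; first by rewrite mem_cat => /orP[/ar|/ar'].
have st1 : agree r s t by move=> y yr; apply: st; rewrite mem_cat yr.
have st2 : agree r' s t by move=> y yr; apply: st; rewrite mem_cat yr orbT.
by apply: (dvdz_transport (rpredD (hr s t hs ht st1) (hr' s t hs ht st2))); ring.
Qed.

Lemma is_charZ n c chi : is_char n chi -> is_char n (fun s => c * chi s).
Proof.
move=> [hM [r [ar hr]]]; split=> [s t hs ht|].
  by apply: (dvdz_transport (dvdz_mull c (hM s t hs ht))); ring.
exists r; split=> // s t hs ht st.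
by apply: (dvdz_transport (dvdz_mull c (hr s t hs ht st))); ring.
Qed.

Lemma is_char_sum n I (r : seq I) (c : I -> int) (chi : I -> (K -> K) -> int) :
  (forall i, is_char n (chi i)) -> is_char n (fun s => \sum_(i <- r) c i * chi i s).
Proof.
move=> h; elim: r => [|i r IH].
  by under [X in is_char _ X]eq_fun => s do rewrite big_nil; apply: is_char0.
under [X in is_char _ X]eq_fun => s do rewrite big_cons.
by apply: is_charD IH; apply: is_charZ.
Qed.

Lemma char_lift l k chi : prime l -> is_char (l ^ k) chi ->
  exists2 psi, is_char (l ^ k.+1) psi & forall s, G s -> ((l ^ k)%N%:Z %| psi s - chi s)%Z.
Proof.
move=> l_pr hchi; rewrite expnS; have [lK|lK] := boolP (l \in [pchar K]).
  by apply: (albert_lift hN lK); rewrite ?expn_gt0 ?prime_gt0.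
apply: (kummer_lift hN rootsN) => //; rewrite -expnS natrX expf_neq0 //.
by move: lK; rewrite inE /= l_pr.
Qed.

Lemma char_tower l chi : prime l -> is_char l chi ->
  exists psi : nat -> (K -> K) -> int, [/\ forall k, is_char (l ^ k) (psi k),
    (forall s, G s -> (l%:Z %| psi 1%N s - chi s)%Z) &
    forall k k' s, (k <= k')%N -> G s -> ((l ^ k)%N%:Z %| psi k' s - psi k s)%Z].
Proof.
move=> l_pr hchi.
have /choice[f fE] (kx : nat * ((K -> K) -> int)) : exists psi, is_char (l ^ kx.1) kx.2 ->
    is_char (l ^ kx.1.+1) psi /\ forall s, G s -> ((l ^ kx.1)%N%:Z %| psi s - kx.2 s)%Z.
  have [/(char_lift l_pr)[psi ? ?]|nh] := pselect (is_char (l ^ kx.1) kx.2); first by exists psi.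
  by exists kx.2.
(* Indices 0 and 1 both hold [chi], the modulus [l^0] imposing nothing; lifting starts from index
   1. *)
pose psi := fix psi k := if k is k'.+1 then (if k' is 0 then chi else f (k', psi k')) else chi.
have psi_char k : is_char (l ^ k) (psi k).
  elim: k => [|[|k] IH]; first by apply: (is_charW (n := l)); rewrite ?dvd1n.
    by rewrite expn1.
  by have [] := fE (k.+1, psi k.+1) IH.
exists psi; split=> // [s _|k k' s]; first by rewrite /= subrr dvdz0.
move=> + hs; elim: k' => [|k' IH].
  by rewrite leqn0 => /eqP->; rewrite subrr dvdz0.
rewrite leq_eqVlt => /orP[/eqP->|]; first by rewrite subrr dvdz0.
rewrite ltnS => kk'; have {}IH := IH kk'.
have [k0|k0] := posnP k; first by rewrite k0 expn0 dvd1z.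
have d : ((l ^ k')%N%:Z %| psi k'.+1 s - psi k' s)%Z.
  case: (k') (leq_trans k0 kk') => // k1 _.
  by have [_ ->] := fE (k1.+1, psi k1.+1) (psi_char k1.+1).
have kl : ((l ^ k)%N%:Z %| (l ^ k')%N%:Z)%Z by rewrite dvdzE dvdn_exp2l.
by have := rpredD (dvdz_trans kl d) IH; rewrite addrA subrK.
Qed.

(** A homomorphism to the profinite integers, given by compatible continuous reductions modulo every
    positive [n]. *)
Definition zchar (Phi : nat -> (K -> K) -> int) : Prop :=
  (forall n, (0 < n)%N -> is_char n (Phi n)) /\
  forall m n s, (0 < n)%N -> (m %| n)%N -> G s -> (m%:Z %| Phi n s - Phi m s)%Z.

(** Each [chi l] is lifted along the powers of [l]. Values modulo [n] are then chosen pointwise by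
    the Chinese remainder theorem, and every property is checked one prime power at a time. *)
Lemma zchar_exists (chi : nat -> (K -> K) -> int) : (forall l, prime l -> is_char l (chi l)) ->
  exists2 Phi, zchar Phi & forall l s, prime l -> G s -> (l%:Z %| Phi l s - chi l s)%Z.
Proof.
move=> hchi.
have /choice[psi psiE] l : exists psi : nat -> (K -> K) -> int, prime l ->
   [/\ forall k, is_char (l ^ k) (psi k),
    (forall s, G s -> (l%:Z %| psi 1%N s - chi l s)%Z) &
    forall k k' s, (k <= k')%N -> G s -> ((l ^ k)%N%:Z %| psi k' s - psi k s)%Z].
  have [l_pr|_] := boolP (prime l); last by exists (fun _ _ => 0).
  by have [psi psiP] := char_tower l_pr (hchi l l_pr); exists psi.
have /choice[Phi0 Phi0E] (ns : nat * (K -> K)) : exists a : int, (0 < ns.1)%N ->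
    forall l, prime l -> ((l ^ logn l ns.1)%N%:Z %| a - psi l (logn l ns.1) ns.2)%Z.
  have [n0|_] := boolP (0 < ns.1)%N; last by exists 0.
  by have [a aE] := crt (fun l => psi l (logn l ns.1) ns.2) n0; exists a.
pose Phi n s := Phi0 (n, s).
have PhiE n s l : (0 < n)%N -> prime l ->
    ((l ^ logn l n)%N%:Z %| Phi n s - psi l (logn l n) s)%Z.
  by move=> n0; apply: (Phi0E (n, s) n0).
exists Phi; [split|] => [n n0|m n s n0 mn hs|l s l_pr hs].
- split=> [s t hs ht|].
    apply: dvdz_primary => // l l_pr; have [cl _ _] := psiE l l_pr; have [clM _] := cl (logn l n).
    apply: (dvdz_transport (rpredD (clM s t hs ht) (rpredB (PhiE n (s \o t) l n0 l_pr)
      (rpredD (PhiE n s l n0 l_pr) (PhiE n t l n0 l_pr))))); ring.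
  have /choice[r rE] l : exists r : seq K, prime l -> (forall y, y \in r -> algP N y) /\
      forall s t, G s -> G t -> agree r s t ->
        ((l ^ logn l n)%N%:Z %| psi l (logn l n) s - psi l (logn l n) t)%Z.
    have [l_pr|_] := boolP (prime l); last by exists [::].
    by have [cl _ _] := psiE l l_pr; have [_ [r ?]] := cl (logn l n); exists r.
  exists (flatten [seq r l | l <- primes n]); split.
    move=> y /flattenP[_ /mapP[l + ->]]; rewrite mem_primes => /andP[l_pr _].
    by case: (rE l l_pr) => h _; apply: h.
  move=> s t hs ht st; apply: dvdz_primary => // l l_pr.
  have [l_n|l_n] := boolP (l \in primes n); last first.
    by rewrite lognE; move: l_n; rewrite mem_primes l_pr n0 /= => /negPf->; rewrite expn0 dvd1z.
  have stl : agree (r l) s t.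
    by move=> y yr; apply: st; apply/flattenP; exists (r l) => //; apply: map_f.
  have [_ /(_ s t hs ht stl) d] := rE l l_pr.
  by apply: (dvdz_transport (rpredD d (rpredB (PhiE n s l n0 l_pr) (PhiE n t l n0 l_pr)))); ring.
- have m0 : (0 < m)%N by apply: dvdn_gt0 mn.
  apply: dvdz_primary => // l l_pr; have [_ _ cmp] := psiE l l_pr.
  have le : (logn l m <= logn l n)%N by apply: dvdn_leq_log.
  have lm : ((l ^ logn l m)%N%:Z %| (l ^ logn l n)%N%:Z)%Z by rewrite dvdzE dvdn_exp2l.
  apply: (dvdz_transport (rpredD (cmp _ _ s le hs) (rpredB (dvdz_trans lm (PhiE n s l n0 l_pr))
    (PhiE m s l m0 l_pr)))); ring.
- have [_ d _] := psiE l l_pr; have := PhiE l s l (prime_gt0 l_pr) l_pr.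
  rewrite logn_prime // eqxx expn1 => d1.
  by apply: (dvdz_transport (rpredD d1 (d s hs))); ring.
Qed.

End ProfiniteLift.

(** * Cardinal arithmetic *)

Section Cardinals.
Local Open Scope classical_set_scope.
Local Open Scope card_scope.

Definition injects T U (A : set T) (B : set U) : Prop :=
  exists f : T -> U, (forall x, A x -> B (f x)) /\ forall x y, A x -> A y -> f x = f y -> x = y.

Lemma injects_trans T U V (A : set T) (B : set U) (D : set V) :
  injects A B -> injects B D -> injects A D.
Proof.
move=> [f [fAB fi]] [g [gBD gi]]; exists (g \o f); split=> [x Ax|x y Ax Ay /=].
  exact/gBD/fAB.
by move/(gi _ _ (fAB _ Ax) (fAB _ Ay))/fi; apply.
Qed.

Lemma injects_sub T (A B : set T) : A `<=` B -> injects A B.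
Proof. by move=> AB; exists id; split. Qed.

Lemma injects_card T U (A : set T) (B : set U) : injects A B -> A #<= B.
Proof.
move=> [f [fAB fi]]; have [g] : $|{injfun A >-> B}|.
  apply/injfunPex; exists f => // x y; rewrite !inE; exact: fi.
exact: inj_card_le g.
Qed.

(** A maximal partial bijection uses up [A] or [B], since otherwise one more pair could be added. *)
Lemma injects_total T U (t0 : T) (u0 : U) (A : set T) (B : set U) : injects A B \/ injects B A.
Proof.
pose good (S : set (T * U)) := [/\ forall p, S p -> A p.1 /\ B p.2,
  forall x y y', S (x, y) -> S (x, y') -> y = y' & forall x x' y, S (x, y) -> S (x', y) -> x = x'].
have [||S [_ [SAB Sf Si] maxS]] := @Zorn_above _ good set0; first by split.
  move=> F F0 FP Ft.
  have two p q : (\bigcup_(X in F) X) p -> (\bigcup_(X in F) X) q ->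
      exists2 X, F X & X p /\ X q.
    move=> [X FX Xp] [Y FY Yq]; have [h|h] := Ft _ _ FX FY.
      by exists Y => //; split=> //; apply: h.
    by exists X => //; split=> //; apply: h.
  split.
  - by move=> p [X /FP[h _ _] /h].
  - by move=> x y y' h1 h2; have [X /FP[_ h _] []] := two _ _ h1 h2; apply: h.
  - by move=> x x' y h1 h2; have [X /FP[_ _ h] []] := two _ _ h1 h2; apply: h.
have [Adom|nA] := pselect (forall x, A x -> exists y, S (x, y)).
  left; have /choice[f fE] x : exists y, A x -> S (x, y).
    by have [/Adom[y ?]|?] := pselect (A x); [exists y|exists u0].
  exists f; split=> [x /fE/SAB[]//|x x' /fE h /fE h' E].
  by apply: Si h _; rewrite E.
have [Bdom|nB] := pselect (forall y, B y -> exists x, S (x, y)).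
  right; have /choice[f fE] y : exists x, B y -> S (x, y).
    by have [/Bdom[x ?]|?] := pselect (B y); [exists x|exists t0].
  exists f; split=> [y /fE/SAB[]//|y y' /fE h /fE h' E].
  by apply: Sf h _; rewrite E.
have [x /not_implyP[Ax nx]] := (not_existsP _).2 (fun h => nA (fun x => contrapT (h x))).
have [y /not_implyP[By ny]] := (not_existsP _).2 (fun h => nB (fun x => contrapT (h x))).
case: (nx); exists y; apply: (maxS (S `|` [set (x, y)])); last by right.
  by move=> p; left.
split.
- by move=> p [/SAB//|->].
- move=> x1 y1 y2 [h1|e1] [h2|e2].
  + exact: Sf h1 h2.
  + by case: e2 => E _; case: nx; exists y1; rewrite -E.
  + by case: e1 => E _; case: nx; exists y2; rewrite -E.
  + by case: e1 => _ ->; case: e2 => _ ->.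
- move=> x1 x2 y1 [h1|e1] [h2|e2].
  + exact: Si h1 h2.
  + by case: e2 => _ E; case: ny; exists x1; rewrite -E.
  + by case: e1 => _ E; case: ny; exists x2; rewrite -E.
  + by case: e1 => -> _; case: e2 => ->.
Qed.

Definition infinite T (A : set T) : Prop := injects [set: nat] A.

(** Zorn's lemma on injective pairings of a part [D] of [A], given as sets of triples, [D] being
    read off the diagonal. If the rest of [A] embeds into [D], so does [A], and the pairing
    transfers; otherwise [D] embeds into the rest and the pairing can be extended. *)
Lemma infinite_square T (A : set T) : infinite A -> exists f : T -> T -> T,
  (forall x y, A x -> A y -> A (f x y)) /\
  forall x y x' y', A x -> A y -> A x' -> A y' -> f x y = f x' y' -> x = x' /\ y = y'.
Proof.
move=> [e [eA ei]].
have {}eA n : A (e n) by apply: eA.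
have {}ei m n : e m = e n -> m = n by apply: ei.
pose dom (S : set (T * T * T)) x := exists z, S (x, x, z).
pose good (S : set (T * T * T)) := [/\ forall x y z z', S (x, y, z) -> S (x, y, z') -> z = z',
  forall x y x' y' z, S (x, y, z) -> S (x', y', z) -> x = x' /\ y = y',
  forall x y, dom S x -> dom S y -> exists z, S (x, y, z) &
  forall x y z, S (x, y, z) -> [/\ dom S x, dom S y, dom S z & A x]].
(* Starting from the pairing of [nat] keeps all [e n] in [D], where they serve as tags. *)
pose S0 : set (T * T * T) := [set p | exists m n, p = (e m, e n, e (pickle (m, n)))].
have [||S [S0S [Sf Si Sd SA] maxS]] := @Zorn_above _ good S0.
- split.
  + by move=> x y z z' [m [n [-> -> ->]]] [m' [n' [/ei-> /ei-> ->]]].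
  + move=> x y x' y' z [m [n [-> -> ->]]] [m' [n' [-> -> /ei/(pcan_inj pickleK)]]].
    by case=> -> ->.
  + move=> _ _ [_ [m [_ [-> _ _]]]] [_ [n [_ [-> _ _]]]].
    by exists (e (pickle (m, n))), m, n.
  + move=> _ _ _ [m [n [-> -> ->]]]; split=> //.
    * by exists (e (pickle (m, m))), m, m.
    * by exists (e (pickle (n, n))), n, n.
    * by exists (e (pickle (pickle (m, n), pickle (m, n)))), (pickle (m, n)), (pickle (m, n)).
- move=> F F0 FP Ft.
  have two p q : (\bigcup_(X in F) X) p -> (\bigcup_(X in F) X) q ->
      exists2 X, F X & X p /\ X q.
    move=> [X FX Xp] [Y FY Yq]; have [h|h] := Ft _ _ FX FY.
      by exists Y => //; split=> //; apply: h.
    by exists X => //; split=> //; apply: h.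
  have domU X x : F X -> dom X x -> dom (\bigcup_(X in F) X) x.
    by move=> FX [z Xz]; exists z, X.
  split.
  - by move=> x y z z' h1 h2; have [X /FP[h _ _ _] []] := two _ _ h1 h2; apply: h.
  - by move=> x y x' y' z h1 h2; have [X /FP[_ h _ _] []] := two _ _ h1 h2; apply: h.
  - move=> x y [z hx] [z' hy]; have [X FX [Xx Xy]] := two _ _ hx hy.
    have [_ _ h _] := FP _ FX; have [||w Xw] := h x y; first by exists z.
      by exists z'.
    by exists w, X.
  - move=> x y z [X FX Xx]; have [_ _ _ h] := FP _ FX; have [h1 h2 h3 Ax] := h _ _ _ Xx.
    by split=> //; apply: (domU X).
pose D := dom S.
have DA x : D x -> A x by move=> [z /SA[]].
have De n : D (e n) by exists (e (pickle (n, n))); apply: S0S; exists n, n.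
have /choice[f0 f0E] (p : T * T) : exists z, D p.1 -> D p.2 -> S (p.1, p.2, z).
  have [Dx|?] := pselect (D p.1); last by exists p.1.
  have [Dy|?] := pselect (D p.2); last by exists p.1.
  by have [z ?] := Sd _ _ Dx Dy; exists z.
pose f x y := f0 (x, y).
have fE x y : D x -> D y -> S (x, y, f x y) by apply: (f0E (x, y)).
have fD x y : D x -> D y -> D (f x y) by move=> Dx Dy; have [] := SA _ _ _ (fE _ _ Dx Dy).
have fi x y x' y' : D x -> D y -> D x' -> D y' -> f x y = f x' y' -> x = x' /\ y = y'.
  by move=> Dx Dy Dx' Dy' E; apply: Si (fE _ _ Dx Dy) _; rewrite E; apply: fE.
have Dfi : injects A D -> exists f : T -> T -> T, (forall x y, A x -> A y -> A (f x y)) /\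
    forall x y x' y', A x -> A y -> A x' -> A y' -> f x y = f x' y' -> x = x' /\ y = y'.
  move=> [h [hD hi]]; exists (fun x y => f (h x) (h y)); split.
    by move=> x y Ax Ay; apply/DA/fD; apply: hD.
  move=> x y x' y' Ax Ay Ax' Ay' /fi[]; try exact: hD.
  by move=> /hi-> // /hi->.
apply: Dfi; pose E := A `\` D.
have [[g [gD gi]]|[g [gE gi]]] := injects_total (e 0) (e 0) E D.
  exists (fun x => if pselect (D x) is left _ then f (e 0) x else f (e 1) (g x)); split.
    by move=> x Ax; case: pselect => Dx; apply: fD => //; apply: gD.
  have e01 : e 0 <> e 1 by move/ei.
  move=> x y Ax Ay; case: pselect => Dx; case: pselect => Dy /fi[] //; try exact: gD.
  - by move=> /esym/e01.
  - by move=> _; apply: gi.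
exfalso; have gnD x : D x -> ~ D (g x) by move=> /gE[].
have gA x : D x -> A (g x) by move=> /gE[].
(* Since [D] embeds into its complement by [g], the pairing extends to [D] and
   [g D], the three new blocks of pairs being sent to disjoint parts of [g D]. *)
pose code k x y := g (f (e k) (f x y)).
have cD k x y : D x -> D y -> D (f (e k) (f x y)) by move=> Dx Dy; apply: (fD) => //; apply: fD.
have code_inj k x y k' x' y' : D x -> D y -> D x' -> D y' -> code k x y = code k' x' y' ->
    [/\ k = k', x = x' & y = y'].
  move=> Dx Dy Dx' Dy' /gi E1; have /fi[||||/ei-> E2] := E1 (cD _ _ _ Dx Dy) (cD _ _ _ Dx' Dy');
    do ?exact: fD; do ?exact: De.
  by have [|||| -> ->] := fi _ _ _ _ _ _ _ _ E2.
pose S' : set (T * T * T) := [set p | S p \/ exists x y, [/\ D x, D y &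
  [\/ p = (x, g y, code 0 x y), p = (g x, y, code 1 x y) | p = (g x, g y, code 2 x y)]]].
have domS' x : dom S' x <-> D x \/ exists2 y, D y & x = g y.
  split=> [[z [Sx|[u [v [Du Dv [] []]]]]]|[[z Sx]|[y Dy ->]]].
  - by left; exists z.
  - by move=> -> E0; case: (gnD _ Dv); rewrite -E0.
  - by move=> E1 E2; case: (gnD _ Du); rewrite -E1 E2.
  - by move=> -> _ _; right; exists u.
  - by exists z; left.
  - by exists (code 2 y y); right; exists y, y; split=> //; constructor 3.
have SD x y z : S (x, y, z) -> [/\ D x, D y & D z] by move=> /SA[].
have Dg x y : D x -> D (g y) -> D y -> False by move=> _ h /gnD.
case: (gnD _ (De 0)); have : S (g (e 0), g (e 0), code 2 (e 0) (e 0)).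
  apply: (maxS S'); first by move=> p; left.
  2: by right; exists (e 0), (e 0); split=> //; constructor 3.
  have ngD x : D x -> forall y, D y -> x = g y -> False.
    by move=> Dx y Dy xE; apply: (gnD _ Dy); rewrite -xE.
  split.
  - move=> x y z z' [h|[u [v [Du Dv h]]]] [h'|[u' [v' [Du' Dv' h']]]].
    + exact: Sf h h'.
    + have [Dx Dy _] := SD _ _ _ h.
      by case: h' => -[xE yE _]; [case: (ngD _ Dy _ Dv')|case: (ngD _ Dx _ Du')|case: (ngD _ Dx _ Du')].
    + have [Dx Dy _] := SD _ _ _ h'.
      by case: h => -[xE yE _]; [case: (ngD _ Dy _ Dv)|case: (ngD _ Dx _ Du)|case: (ngD _ Dx _ Du)].
    + move: h'; case: h => -[-> -> ->] h'; case: h' => -[E1 E2 ->].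
      * by rewrite E1 (gi _ _ Dv Dv' E2).
      * by case: (ngD _ Du _ Du').
      * by case: (ngD _ Du _ Du').
      * by case: (ngD _ Du' _ Du (esym E1)).
      * by rewrite E2 (gi _ _ Du Du' E1).
      * by case: (ngD _ Dv _ Dv').
      * by case: (ngD _ Du' _ Du (esym E1)).
      * by case: (ngD _ Dv' _ Dv (esym E2)).
      * by rewrite (gi _ _ Du Du' E1) (gi _ _ Dv Dv' E2).
  - have nS u v w k : D u -> D v -> S w -> w.2 = code k u v -> False.
      case: w => -[x y] z Du Dv /SD[_ _ Dz] /= zE.
      by apply: (ngD _ Dz _ (cD k _ _ Du Dv)).
    move=> x y x' y' z [h|[u [v [Du Dv h]]]] [h'|[u' [v' [Du' Dv' h']]]].
    + exact: Si h h'.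
    + by case: h' => -[_ _ zE]; case: (nS _ _ _ _ Du' Dv' h zE).
    + by case: h => -[_ _ zE]; case: (nS _ _ _ _ Du Dv h' zE).
    + move: h'; case: h => -[-> -> ->] h'; case: h' => -[-> -> E0];
        by have [] := code_inj _ _ _ _ _ _ Du Dv Du' Dv' E0 => // _ -> ->.
  - move=> x y /domS'[Dx|[u Du ->]] /domS'[Dy|[v Dv ->]].
    + by exists (f x y); left; apply: fE.
    + by exists (code 0 x v); right; exists x, v; split=> //; constructor 1.
    + by exists (code 1 u y); right; exists u, y; split=> //; constructor 2.
    + by exists (code 2 u v); right; exists u, v; split=> //; constructor 3.
  - move=> x y z [/SA[Dx Dy Dz Ax]|[u [v [Du Dv h]]]].
      by split=> //; apply/domS'; left.
    have dz k : dom S' (code k u v) by apply/domS'; right; exists (f (e k) (f u v)) => //; apply: cD.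
    have dg w : D w -> dom S' (g w) by move=> Dw; apply/domS'; right; exists w.
    have dD w : D w -> dom S' w by move=> Dw; apply/domS'; left.
    case: h => -[-> -> ->]; split; by [apply: dz|apply: dg|apply: dD|apply: DA|apply: gA].
by move=> /SD[].
Qed.

Lemma infinite_seqs (T : eqType) (A : set T) : infinite A ->
  injects [set r : seq T | forall x, x \in r -> A x] A.
Proof.
move=> infA; have [e [eA ei]] := infA; have [f [fA fi]] := infinite_square infA.
pose c := foldr f (e 0%N); have cA r : (forall x, x \in r -> A x) -> A (c r).
  elim: r => [|x r IH] hr; first exact: eA.
  apply: fA; first exact/hr/mem_head.
  by apply: IH => y yr; apply: hr; rewrite inE yr orbT.
(* The length is recorded because the fold alone does not tell where a list ends. *)
exists (fun r => f (e (size r)) (c r)); split=> [r hr|r r' hr hr'].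
  by apply: fA; [apply: eA|apply: cA].
move=> /fi[]; [exact: eA|exact: cA|exact: eA|exact: cA|].
move=> /ei-/(_ I I); elim: r r' hr hr' => [|x r IH] [|x' r'] //= hr hr' [] sz.
have Ar y : y \in r -> A y by move=> yr; apply: hr; rewrite inE yr orbT.
have Ar' y : y \in r' -> A y by move=> yr; apply: hr'; rewrite inE yr orbT.
move=> /fi[]; [exact/hr/mem_head|exact: cA|exact/hr'/mem_head|exact: cA|].
by move=> -> /(IH r' Ar Ar' sz) ->.
Qed.

(** [L] embeds into its part [A] outside [M]: elements of [M] are translated by [a0], and tags
    separate the two cases. As [A] is infinite, it also has room for codes of pairs of finite lists
    in [L * M], that is, for fractions of the compositum. *)
Lemma compositum_injects (K : fieldType) (L M : set K) a0 :
    alg_closed_subfield L -> alg_closed_subfield M -> L a0 -> ~ M a0 -> injects M L ->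
  injects (compositum L M) [set x | L x /\ ~ M x].
Proof.
move=> hL hM La0 nMa0 [g [gL gi]]; set A := [set x | _].
have [hLf _] := hL; have [hMf _] := hM.
have hLR := subfield_subring hLf; have hMR := subfield_subring hMf.
(* This makes the positive powers of [a0] distinct elements of [A]. *)
have a0M n : (0 < n)%N -> ~ M (a0 ^+ n).
  by move=> n0 Mn; apply/nMa0/(alg_closed_in hM)/(algX_inv hMf n0)/(alg_id hMf).
have a00 : a0 != 0 by apply: contra_notN nMa0 => /eqP->; apply: (subring0 hMR).
have infA : infinite A.
  exists (fun n => a0 ^+ n.+1); split=> [n _|m n _ _].
    by split; [apply: (subringX hLR)|apply: a0M].
  wlog le_mn : m n / (m <= n)%N.
    by move=> h; case: (leqP m n) => [|/ltnW] mn E; [apply: h|apply/esym/h].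
  move=> E; apply/eqP; rewrite eqn_leq le_mn leqNgt; apply/negP => lt_mn.
  have nm0 : (0 < n - m)%N by rewrite subn_gt0.
  apply: (a0M _ nm0); have -> : a0 ^+ (n - m) = 1.
    apply: (mulfI (expf_neq0 m.+1 a00)); rewrite -exprD mulr1 E; congr (_ ^+ _).
    by rewrite addSn subnKC.
  exact: (subring1 hMR).
have [e [eA ei]] := infA; have [f [fA fi]] := infinite_square infA.
have LA : injects L A.
  exists (fun x => if pselect (M x) is left _ then f (e 1%N) (a0 + x) else f (e 0%N) x).
  have a0x x : L x -> M x -> A (a0 + x).
    move=> Lx Mx; split; first exact: (subringD hLR).
    by move=> Ma; apply: nMa0; rewrite -(addrK x a0); apply: (subringB hMR).
  have e01 : e 0%N <> e 1%N by move/ei => /(_ I I).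
  split=> [x Lx|x x' Lx Lx'].
    by case: pselect => Mx; apply: fA; try exact: eA; [apply: a0x|split].
  have b x0 : L x0 -> ~ M x0 -> A x0 by split.
  have eA' n : A (e n) by apply: eA.
  case: pselect => Mx; case: pselect => Mx' E.
  - by have [_ /addrI] := fi _ _ _ _ (eA' _) (a0x _ Lx Mx) (eA' _) (a0x _ Lx' Mx') E.
  - by have [/esym/e01] := fi _ _ _ _ (eA' _) (a0x _ Lx Mx) (eA' _) (b _ Lx' Mx') E.
  - by have [/e01] := fi _ _ _ _ (eA' _) (b _ Lx Mx) (eA' _) (a0x _ Lx' Mx') E.
  - by have [_] := fi _ _ _ _ (eA' _) (b _ Lx Mx) (eA' _) (b _ Lx' Mx') E.
have MA : injects M A by apply: injects_trans LA; exists g.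
have [i [iA ii]] := LA; have [j [jA ji]] := MA.
pose PR := [set r : seq (K * K) | forall p, p \in r -> L p.1 /\ M p.2].
have PRA : injects PR A.
  apply: injects_trans (infinite_seqs infA); exists (map (fun p => f (i p.1) (j p.2))); split.
    by move=> r hr _ /mapP[p /hr[Lp Mp] ->]; apply: fA; [apply: iA|apply: jA].
  elim=> [|[x y] r IH] [|[x' y'] r'] //= hr hr' [].
  have [Lx My] := hr _ (mem_head _ _); have [Lx' My'] := hr' _ (mem_head _ _).
  rewrite /= in Lx Lx' My My' *; move=> E0 E1.
  have [Ei Ej] := fi _ _ _ _ (iA _ Lx) (jA _ My) (iA _ Lx') (jA _ My') E0.
  rewrite (ii _ _ Lx Lx' Ei) (ji _ _ My My' Ej) (IH r') //.
    by move=> p pr; apply: hr; rewrite inE pr orbT.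
  by move=> p pr; apply: hr'; rewrite inE pr orbT.
have [h [hA hi]] := PRA.
have /choice[rr rrE] w : exists rs : seq (K * K) * seq (K * K), compositum L M w ->
   [/\ PR rs.1, PR rs.2 & w = (\sum_(p <- rs.1) p.1 * p.2) / (\sum_(p <- rs.2) p.1 * p.2)].
  have [/(span_frac hLR hMR hLf)|?] := pselect (compositum L M w); last by exists ([::], [::]).
  by move=> [_ [_ [[r [hr ->]] [s [hs ->]] _ ->]]]; exists (r, s).
exists (fun w => f (h (rr w).1) (h (rr w).2)); split=> [w /rrE[h1 h2 _]|w w' /rrE[h1 h2 wE] /rrE[h1' h2' wE']].
  by apply: fA; apply: hA.
move=> /fi[]; try exact: hA.
by move=> /(hi _ _ h1 h1') E1 /(hi _ _ h2 h2') E2; rewrite wE wE' E1 E2.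
Qed.

End Cardinals.

(** * Bases of the character groups *)

Section CharBasis.
Variables (K : closedFieldType) (N : K -> Prop).
Hypothesis hN : is_subfield N.
Local Notation G := (N_emb N).
Local Notation is_char := (is_char N).
Local Notation T := ((K -> K) -> int).
Let hNR := subfield_subring hN.
Hypothesis perfN : forall e x, [pchar K].-nat e -> N x -> exists2 w, N w & w ^+ e = x.
Hypothesis rootsN : forall n (z : K), (0 < n)%N -> z ^+ n = 1 -> N z.

Section Prime.
Variable l : nat.
Hypothesis l_pr : prime l.

(** Linear independence over the field with [l] elements, for functions on embeddings taken modulo
    [l]. *)
Definition char_indep (I : Type) (D : set I) (v : I -> T) : Prop :=
  forall n (j : 'I_n -> I), injective j -> (forall i, D (j i)) -> forall c : 'I_n -> int,
    (forall s, G s -> (l%:Z %| \sum_i c i * v (j i) s)%Z) -> forall i, (l%:Z %| c i)%Z.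

Definition char_spans (I : Type) (v : I -> T) : Prop :=
  forall chi, is_char l chi -> exists n (j : 'I_n -> I) (c : 'I_n -> int),
    forall s, G s -> (l%:Z %| chi s - \sum_i c i * v (j i) s)%Z.

Lemma char_indep_inj (I : Type) (D : set I) (v : I -> T) i i' : char_indep D v ->
  D i -> D i' -> (forall s, G s -> (l%:Z %| v i s - v i' s)%Z) -> i = i'.
Proof.
move=> hv Di Di' d; apply: contrapT => ne.
pose j (k : 'I_2) := if k == ord0 then i else i'.
have ji : injective j.
  move=> a b; rewrite /j; case: (eqVneq a ord0) => [->|a0]; case: (eqVneq b ord0) => [->|b0] // E0;
    try by case: ne; rewrite E0.
  by apply: val_inj; case: a a0 => -[|[|]] // ? _; case: b b0 => -[|[|]].
have h := hv _ j ji _ (fun k => if k == ord0 then 1 else -1).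
have : (l%:Z %| 1)%Z.
  have := h _ _ ord0; rewrite eqxx; apply=> [k|s hs]; first by rewrite /j; case: ifP.
  by rewrite !big_ord_recl big_ord0 /j /= mul1r mulN1r addr0; apply: d.
by rewrite dvdzE /= dvdn1 => /eqP l1; move: l_pr; rewrite l1.
Qed.

Lemma invz_prime (c : int) : ~~ (l%:Z %| c)%Z -> exists d : int, (l%:Z %| 1 - d * c)%Z.
Proof.
move=> lc; have cop : coprimez l%:Z c.
  by rewrite coprimezE /= prime_coprime //; rewrite dvdzE in lc.
have [[u v] /= uv] := coprimezP _ _ cop; exists v; rewrite -uv.
by apply: (dvdz_transport (dvdz_mull u (dvdzz l%:Z))); ring.
Qed.

Section ZornBasis.
Local Open Scope classical_set_scope.

Lemma char_basis (B0 : set T) : B0 `<=` is_char l -> char_indep B0 id ->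
  exists B, [/\ B0 `<=` B, B `<=` is_char l, char_indep B id &
    forall chi, is_char l chi -> exists n (v : 'I_n -> T) (c : 'I_n -> int),
      (forall i, B (v i)) /\ forall s, G s -> (l%:Z %| chi s - \sum_i c i * v i s)%Z].
Proof.
move=> B0c B0i.
have [||B [B0B [Bc Bi] maxB]] := @Zorn_above _ (fun B => B `<=` is_char l /\ char_indep B id) B0.
- by split.
- move=> F F0 FP Ft; split; first by move=> chi [X /FP[Xc _] /Xc].
  move=> n v vi Fv; have [|X FX Xv] := @chain_seq _ _ F (enum 'I_n) v F0 Ft.
    by move=> i _; apply: Fv.
  have [_ Xi] := FP _ FX; apply: (Xi _ v vi) => i; apply: Xv.
  by rewrite mem_enum.
exists B; split=> // chi chi_c; have [Bchi|nBchi] := pselect (B chi).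
  exists 1%N, (fun _ => chi), (fun _ => 1); split=> // s _.
  by rewrite big_ord1 mul1r subrr dvdz0.
have : ~ char_indep (B `|` [set chi]) id.
  move=> hi; apply: nBchi; apply: (maxB (B `|` [set chi])); last by right.
    by move=> x; left.
  by split=> // x [/Bc|->].
(* Maximality yields a relation involving [chi]. Its coefficient there is prime to [l], as otherwise
   [B] itself would be dependent, so it can be inverted. *)
move=> /existsNP[n] /existsNP[v] /not_implyP[vi] /not_implyP[Bv] /existsNP[c].
move=> /not_implyP[cv] /existsNP[i0 ci0].
have [[j vj]|nj] := pselect (exists j, v j = chi); last first.
  case: ci0; apply: (Bi _ v vi) => // i; case: (Bv i) => // vi0.
  by case: nj; exists i.
case: n => [|n] in v vi Bv c cv i0 ci0 j vj *; first by case: (i0).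
have Bvj i : B (v (lift j i)).
  have [//|E] := Bv (lift j i); have /vi/eqP : v (lift j i) = v j by rewrite E vj.
  by rewrite eq_sym (negPf (neq_lift _ _)).
have lcj : ~~ (l%:Z %| c j)%Z.
  apply/negP => lcj; apply: ci0.
  have vji : injective (fun i => v (lift j i)) by move=> a b /vi/lift_inj.
  have h := Bi _ _ vji Bvj (fun i => c (lift j i)).
  have [k ->|->] := unliftP j i0 => //; apply: h => s hs.
  by have := cv s hs; rewrite (bigD1_ord j) //= rpredDl // dvdz_mulr.
have [d dE] := invz_prime lcj.
exists n, (fun i => v (lift j i)), (fun i => - d * c (lift j i)); split=> // s hs.
have := cv s hs; rewrite (bigD1_ord j) //= vj => E.
have -> : \sum_i - d * c (lift j i) * v (lift j i) s = - d * \sum_i c (lift j i) * v (lift j i) s.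
  by rewrite mulr_sumr; apply: eq_bigr => i _; rewrite mulrA.
by apply: (dvdz_transport (rpredD (dvdz_mulr (chi s) dE) (dvdz_mull d E))); ring.
Qed.

End ZornBasis.

(** The code is [x^l], or [x^l - x] in characteristic [l], for a generator [x]. Generators with the
    same code differ by a root of unity or by an element of the prime field; embeddings fix it, so
    the characters agree. *)
Lemma char_code : exists code : T -> K, forall chi, is_char l chi -> N (code chi) /\
  forall chi', is_char l chi' -> code chi = code chi' ->
    forall s, G s -> (l%:Z %| chi s - chi' s)%Z.
Proof.
have l0 := prime_gt0 l_pr; have hA := alg_subfield hN; have hAR := subfield_subring hA.
have [lK|lK] := boolP (l \in [pchar K]).
  have powB (x y : K) : (x - y) ^+ l = x ^+ l - y ^+ l.
    by rewrite exprDn_pchar ?exprNn_pchar // (eq_pnat _ (pcharf_eq lK)) pnat_id.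
  have /choice[x xE] chi : exists x, is_char l chi ->
      algP N x /\ forall s, G s -> s x = x + (chi s)%:~R.
    have [h|h] := pselect (is_char l chi); last by exists 0.
    by have [x ax xE] := artin_schreier_generator hN lK h; exists x.
  exists (fun chi => x chi ^+ l - x chi) => chi hchi; have [ax sx] := xE _ hchi; split.
    apply: (fixedN hN perfN) => [|s hs].
      by apply: (subringB hAR) => //; apply: (subringX hAR).
    have powD (u w : K) : (u + w) ^+ l = u ^+ l + w ^+ l.
      by rewrite exprDn_pchar // (eq_pnat _ (pcharf_eq lK)) pnat_id.
    by rewrite (embB hs) (embX hs) sx // powD int_frobenius //; ring.
  move=> chi' hchi' E s hs; have [ax' sx'] := xE _ hchi'.
  have [k kE] : exists k : nat, x chi' - x chi = k%:R.
    apply: (frobenius_fixed lK); rewrite powB.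
    have -> : x chi' ^+ l = x chi ^+ l - x chi + x chi' by rewrite E subrK.
    by ring.
  rewrite -(intr_pchar_eq _ _ lK); apply/eqP; apply: (addrI (x chi)).
  have x'E : x chi' = x chi + k%:R by rewrite -kE addrC subrK.
  have := sx' s hs; rewrite {1}x'E (embD hs) sx // -[k%:R]/(k%:~R) (emb_int hN _ hs) x'E.
  by move=> E2; apply: (addIr (k%:~R)); rewrite E2 addrAC.
have lK0 : l%:R != 0 :> K by move: lK; rewrite inE /= l_pr.
have [z zP] := prim_root_exists lK0; have Nz := rootsN l0 (prim_expr_order zP).
have /choice[x xE] chi : exists x, is_char l chi ->
    [/\ x != 0, algP N x & forall s, G s -> s x = z ^ chi s * x].
  have [h|h] := pselect (is_char l chi); last by exists 0.
  by have [x xP] := kummer_generator hN rootsN zP h; exists x.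
exists (fun chi => x chi ^+ l) => chi hchi; have [x0 ax sx] := xE _ hchi; split.
  apply: (fixedN hN perfN) => [|s hs]; first exact: (subringX hAR).
  rewrite (embX hs) sx // exprMn [X in X * _](_ : _ = 1) ?mul1r //.
  by rewrite exprnP exprz_exp; apply/eqP; rewrite (prim_exprz_eq1 zP) dvdz_mull.
move=> chi' hchi' E s hs; have [x0' ax' sx'] := xE _ hchi'.
have [|k kE] := prim_rootP zP (x := x chi' / x chi).
  by rewrite exprMn exprVn -E divff // expf_neq0.
have x'E : x chi' = z ^+ k * x chi by rewrite -kE divfK.
have e : s (x chi') = z ^ chi s * x chi'.
  by rewrite x'E (embM hs) (embX hs) (emb_id hs Nz) sx // mulrCA.
by rewrite -(prim_exprz_eq zP) -(inj_eq (mulIf x0')) -e sx'.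
Qed.

(** Reindexing by [N] through Cantor-Bernstein gives the bases for all primes a common index set, as
    needed to glue them. *)
Lemma char_basis_indexed (B0 : set T) : (forall chi, B0 chi -> is_char l chi) -> char_indep B0 id ->
    injects (N : set K) B0 ->
  exists v : (N : set K) -> T, [/\ forall i, is_char l (v i), char_indep setT v & char_spans v].
Proof.
move=> B0c B0i NB0; have [B [B0B Bc Bi Bs]] := char_basis B0c B0i.
have [code codeE] := char_code.
have BN : injects B N.
  exists code; split=> [chi /Bc/codeE[]//|chi chi' Bchi Bchi' E].
  have [_ d] := codeE _ (Bc _ Bchi).
  by apply: (char_indep_inj Bi) => //; apply: d => //; apply: Bc.
have NB : injects (N : set K) B by apply: injects_trans NB0 (injects_sub B0B).
have /card_bijP[f fbij] := Cantor_Bernstein (injects_card NB) (injects_card BN).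
have fB i : B (val (f i)) by apply: set_mem (valP (f i)).
exists (fun i => val (f i)); split=> [i|n j ji _ c|chi /Bs[n [v [c [Bv cE]]]]]; first exact/Bc/fB.
  apply: (Bi n (fun i => val (f (j i)))) => [a b|i]; last exact: fB.
  by move/val_inj/(bij_inj fbij)/ji.
have [g fg gf] := fbij.
exists n, (fun i => g (SigSub (mem_set (Bv i)))), c => s hs.
by under eq_bigr do rewrite gf /=; apply: cE.
Qed.

End Prime.

End CharBasis.

(** * Dual bases *)

Section DualBasis.
Variables (K : closedFieldType) (N : K -> Prop).
Hypothesis hN : is_subfield N.
Local Notation G := (N_emb N).
Local Notation is_char := (is_char N).
Hypothesis perfN : forall e x, [pchar K].-nat e -> N x -> exists2 w, N w & w ^+ e = x.
Hypothesis rootsN : forall n (z : K), (0 < n)%N -> z ^+ n = 1 -> N z.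
Variable N' : K -> Prop.
Hypotheses (hN' : is_subfield N') (NN' : forall x, N x -> N' x) (aN' : forall x, algP N' x)
  (rN' : forall x, N' x -> algP N x -> N x).
Local Notation G' := (N_emb N').

Variables (I : eqType) (Phi : I -> nat -> (K -> K) -> int).
Hypotheses (Phi_zchar : forall i, zchar N (Phi i))
  (Phi_indep : forall l, prime l -> char_indep N l setT (fun i => Phi i l))
  (Phi_spans : forall l, prime l -> char_spans N l (fun i => Phi i l)).

Let emb' s : G' s -> G s. Proof. exact: emb_sub. Qed.

(** Restricting to [N']-embeddings loses no character modulo [l]: if they all fix the generator of
    [chi], it lies in [N]. *)
Lemma char_faithful l chi : prime l -> is_char l chi ->
    (forall s, G' s -> (l%:Z %| chi s)%Z) -> forall s, G s -> (l%:Z %| chi s)%Z.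
Proof.
move=> l_pr hchi h0 s hs; have [lK|lK] := boolP (l \in [pchar K]).
  have [x ax xE] := artin_schreier_generator hN lK hchi.
  have Nx : N x.
    apply: (fixed_in hN perfN hN' aN' rN' ax) => t ht; rewrite xE; last exact: emb'.
    have /eqP-> : (chi t)%:~R == 0%:~R :> K by rewrite (intr_pchar_eq _ _ lK) subr0 h0.
    by rewrite addr0.
  have /eqP := xE s hs; rewrite (emb_id hs Nx) -subr_eq0 opprD addNKr oppr_eq0.
  by rewrite -[0]/(0%:~R) (intr_pchar_eq _ _ lK) subr0.
have lK0 : l%:R != 0 :> K by move: lK; rewrite inE /= l_pr.
have [z zP] := prim_root_exists lK0.
have [x [x0 ax xE]] := kummer_generator hN rootsN zP hchi.
have Nx : N x.
  apply: (fixed_in hN perfN hN' aN' rN' ax) => t ht; rewrite xE; last exact: emb'.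
  by have /eqP-> : z ^ chi t == 1; rewrite ?mul1r // (prim_exprz_eq1 zP) h0.
have := xE s hs; rewrite (emb_id hs Nx) -{1}[x]mul1r => /(mulIf x0)/esym/eqP.
by rewrite (prim_exprz_eq1 zP).
Qed.

Lemma char_id n chi : is_char n chi -> (n%:Z %| chi id)%Z.
Proof.
move=> [hM _]; have := hM id id (emb_idfun N) (emb_idfun N).
by rewrite opprD addrA subrr sub0r rpredN.
Qed.

Lemma char_iter n chi s k : is_char n chi -> G s ->
  G (iter k (fun t => s \o t) id) /\
  (n%:Z %| chi (iter k (fun t => s \o t) id) - k%:Z * chi s)%Z.
Proof.
move=> hchi hs; have [hM _] := hchi; elim: k => [|k [IHG IH]].
  by split=> //; rewrite mul0r subr0; apply: char_id.
split; first exact: emb_comp.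
rewrite iterS; apply: (dvdz_transport (rpredD (hM _ _ hs IHG) IH)).
rewrite -addn1 PoszD; ring.
Qed.

Lemma iter_emb' s k : G' s -> G' (iter k (fun t => s \o t) id).
Proof. by move=> hs; elim: k => [|k IH] //; apply: emb_comp. Qed.

(* The values taken form a subspace of [F_l^m]; were it proper, a nonzero linear
   form vanishing on it would be a relation between the characters. *)
Lemma dual_prime l m (j : 'I_m -> I) (z : 'I_m -> int) : prime l -> injective j ->
  exists2 s, G' s & forall i, (l%:Z %| Phi (j i) l s - z i)%Z.
Proof.
move=> l_pr ji; have lF := pchar_Fp l_pr; have l0 := prime_gt0 l_pr.
have Pc i : is_char l (Phi i l) by case: (Phi_zchar i) => h _; apply: h.
pose vec s : 'rV['F_l]_m := \row_i (Phi (j i) l s)%:~R.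
pose A := [set v | `[< exists2 s, G' s & vec s = v >]].
have AP v : reflect (exists2 s, G' s & vec s = v) (v \in A).
  by rewrite inE; apply: asboolP.
have vecM s t : G' s -> G' t -> vec (s \o t) = vec s + vec t.
  move=> hs ht; apply/rowP => i; rewrite !mxE -rmorphD /=; apply/eqP.
  rewrite (intr_pchar_eq _ _ lF); have [hM _] := Pc (j i).
  by apply: hM; apply: emb'.
have A0 : 0 \in A.
  apply/AP; exists id => //; apply/rowP => i; rewrite !mxE; apply/eqP.
  by rewrite -[0]/(0%:~R) (intr_pchar_eq _ _ lF) subr0; apply: char_id.
have AD u v : u \in A -> v \in A -> u + v \in A.
  move=> /AP[s hs <-] /AP[t ht <-]; apply/AP; exists (s \o t); first exact: emb_comp.
  exact: vecM.
have AZ (a : 'F_l) v : v \in A -> a *: v \in A.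
  move=> Av; rewrite -[a]natr_Zp scaler_nat; elim: (val a) => [|k IH]; first by rewrite mulr0n.
  by rewrite mulrS AD.
pose X := \matrix_(i < #|A|) (enum_val i : 'rV['F_l]_m).
have rX i : row i X = enum_val i by rewrite rowK.
have [Xfull|nfull] := boolP (row_full X).
  pose zv : 'rV['F_l]_m := \row_i (z i)%:~R.
  have /AP[s hs sE] : zv \in A.
    have /submxP[u ->] : (zv <= X)%MS by apply: submx_full.
    rewrite mulmx_sum_row; apply: (big_ind (fun v => v \in A)) => // i _.
    by apply: AZ; rewrite rX enum_valP.
  exists s => // i; rewrite -(intr_pchar_eq _ _ lF).
  by move/rowP: sE => /(_ i); rewrite !mxE => ->.
have : cokermx X != 0 by rewrite -mxrank_eq0 mxrank_coker subn_eq0 -ltnNge ltn_neqAle rank_leq_col andbT.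
move=> /matrix0Pn[k [q ckq]].
pose c i : int := (val (cokermx X i q))%:Z.
have cE i : (c i)%:~R = cokermx X i q by rewrite -pmulrn natr_Zp.
case/negP: ckq; rewrite -cE -[0]/(0%:~R) (intr_pchar_eq _ _ lF) subr0.
apply: (Phi_indep l_pr ji) => //; apply: char_faithful => //; first exact: is_char_sum.
move=> s hs; have As : vec s \in A by apply/AP; exists s.
have : vec s *m cokermx X = 0.
  rewrite -(enum_rankK_in As As) -rX -row_mul mulmx_coker; exact: row0.
move=> /matrixP/(_ ord0 q); rewrite !mxE => E.
rewrite -[X in (_ %| X)%Z]subr0 -(intr_pchar_eq _ _ lF) rmorph_sum /=; apply/eqP.
rewrite -[RHS]E; apply: eq_bigr => i _.
by rewrite intrM cE mulrC; congr (_ * _); rewrite mxE.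
Qed.

Lemma Phi_mod m n i s : (0 < n)%N -> (m %| n)%N -> G s -> (m%:Z %| Phi i n s - Phi i m s)%Z.
Proof. by have [_ h] := Phi_zchar i; apply: h. Qed.

Lemma Phi_char n i : (0 < n)%N -> is_char n (Phi i n).
Proof. by have [h _] := Phi_zchar i; apply: h. Qed.

(* For [n = l n'], match the target mod [n'] first, then correct by the [n']-th
   power of an embedding with prescribed values mod [l]. *)
Lemma dual_mod n m (j : 'I_m -> I) (z : 'I_m -> int) : (0 < n)%N -> injective j ->
  exists2 s, G' s & forall i, (n%:Z %| Phi (j i) n s - z i)%Z.
Proof.
have [b] := ubnP n; elim: b => // b IH in n z *; rewrite ltnS => nb n0 ji.
have [n1|n1] := leqP n 1.
  have -> : n = 1%N by apply/eqP; rewrite eqn_leq n1.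
  by exists id => // i; rewrite dvd1z.
have l_pr := pdiv_prime n1; set l := pdiv n in l_pr.
have nE : n = (l * (n %/ l))%N by rewrite mulnC divnK // pdiv_dvd.
set n' := (n %/ l)%N in nE.
have n'0 : (0 < n')%N by move: n0; rewrite {1}nE muln_gt0 => /andP[].
have ln : (l %| n)%N by rewrite nE dvdn_mulr.
have n'n : (n' %| n)%N by rewrite nE dvdn_mull.
have [|s1 hs1 s1E] := IH n' z _ n'0 ji.
  by apply: leq_trans nb; rewrite nE ltn_Pmull // prime_gt1.
have s1E' i : (n'%:Z %| z i - Phi (j i) n s1)%Z.
  have := rpredD (s1E i) (Phi_mod (j i) n0 n'n (emb' hs1)).
  by rewrite -rpredN => d; apply: (dvdz_transport d); ring.
pose w i : int := ((z i - Phi (j i) n s1) %/ n'%:Z)%Z.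
have wE i : w i * n'%:Z = z i - Phi (j i) n s1 by rewrite divzK.
have [s2 hs2 s2E] := dual_prime w l_pr ji.
have hs2k := iter_emb' n' hs2; set s2k := iter n' _ id in hs2k.
exists (s2k \o s1); first exact: emb_comp.
move=> i; have ch := Phi_char (j i) n0; have [hM _] := ch.
have [_ d1] := char_iter n' ch (emb' hs2); rewrite -/s2k in d1.
have d2 := hM _ _ (emb' hs2k) (emb' hs1).
have d3 : (n%:Z %| n'%:Z * (Phi (j i) n s2 - w i))%Z.
  rewrite nE PoszM [l%:Z * _]mulrC dvdz_mul2l ?eqz_nat -?lt0n // -nE.
  by apply: (dvdz_transport (rpredD (Phi_mod (j i) n0 ln (emb' hs2)) (s2E i))); ring.
apply: (dvdz_transport (rpredD d2 (rpredD d1 d3))).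
have -> : z i = w i * n'%:Z + Phi (j i) n s1 by rewrite wE subrK.
ring.
Qed.

(** Modulo a prime [l] dividing [n], [chi] is a combination of coordinates. Subtracting it leaves
    [l] times a character modulo [n / l], to which induction applies. *)
Lemma span_mod n chi : (0 < n)%N -> is_char n chi -> exists m (j : 'I_m -> I) (c : 'I_m -> int),
  forall s, G s -> (n%:Z %| chi s - \sum_i c i * Phi (j i) n s)%Z.
Proof.
have [b] := ubnP n; elim: b => // b IH in n chi *; rewrite ltnS => nb n0 hchi.
have [n1|n1] := leqP n 1.
  have -> : n = 1%N by apply/eqP; rewrite eqn_leq n1.
  have [i0|noI] := pselect (exists i : I, True); last first.
    by exists 0%N; have j (k : 'I_0) : I by [case: k]; exists j, (fun _ => 0) => s _; rewrite dvd1z.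
  by have [i _] := i0; exists 0%N, (fun _ => i), (fun _ => 0) => s _; rewrite dvd1z.
have l_pr := pdiv_prime n1; set l := pdiv n in l_pr.
have nE : n = (l * (n %/ l))%N by rewrite mulnC divnK // pdiv_dvd.
set n' := (n %/ l)%N in nE.
have n'0 : (0 < n')%N by move: n0; rewrite {1}nE muln_gt0 => /andP[].
have ln : (l %| n)%N by rewrite nE dvdn_mulr.
have n'n : (n' %| n)%N by rewrite nE dvdn_mull.
have lz : (l%:Z : int) != 0 by rewrite eqz_nat -lt0n prime_gt0.
have [m [j [c cE]]] := Phi_spans l_pr (is_charW ln hchi).
pose th s := chi s - \sum_i c i * Phi (j i) n s.
have th_char : is_char n th.
  apply: is_charD => //; apply: (is_char_eq (chi := fun s => -1 * \sum_i c i * Phi (j i) n s)).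
    by apply: is_charZ; apply: is_char_sum => i; apply: Phi_char.
  by move=> s _; rewrite mulN1r subrr dvdz0.
have thl s : G s -> (l%:Z %| th s)%Z.
  move=> hs; have d : (l%:Z %| \sum_i c i * (Phi (j i) n s - Phi (j i) l s))%Z.
    by apply: rpred_sum => i _; apply/dvdz_mull/Phi_mod.
  apply: (dvdz_transport (rpredB (cE s hs) d)); rewrite /th.
  under [X in _ - X]eq_bigr do rewrite mulrBr.
  by rewrite sumrB; ring.
pose chi' s : int := (th s %/ l%:Z)%Z.
have chi'E s : G s -> th s = l%:Z * chi' s by move=> hs; rewrite mulrC divzK // thl.
have chi'_char : is_char n' chi'.
  have [hM [r [ar hr]]] := th_char; split=> [s t hs ht|].
    have := hM s t hs ht; rewrite !chi'E //; last exact: emb_comp.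
    by rewrite -mulrDr -mulrBr nE PoszM dvdz_mul2l.
  exists r; split=> // s t hs ht st; have := hr s t hs ht st.
  by rewrite !chi'E // -mulrBr nE PoszM dvdz_mul2l.
have [|m' [j' [c' c'E]]] := IH n' chi' _ n'0 chi'_char.
  by apply: leq_trans nb; rewrite nE ltn_Pmull // prime_gt1.
exists (m + m')%N, (fun i => match fintype.split i with inl a => j a | inr b => j' b end),
  (fun i => match fintype.split i with inl a => c a | inr b => l%:Z * c' b end) => s hs.
rewrite big_split_ord /=.
under eq_bigr do rewrite (unsplitK (inl _)).
under [X in _ - (_ + X)]eq_bigr do rewrite (unsplitK (inr _)).
have d1 : (n%:Z %| l%:Z * (chi' s - \sum_i c' i * Phi (j' i) n' s))%Z.
  by rewrite nE PoszM dvdz_mul2l //; apply: c'E.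
have d2 : (n%:Z %| \sum_i c' i * (l%:Z * (Phi (j' i) n s - Phi (j' i) n' s)))%Z.
  apply: rpred_sum => i _; apply: dvdz_mull; rewrite {2}nE PoszM dvdz_mul2l //.
  exact: Phi_mod.
have E2 : \sum_i c' i * (l%:Z * (Phi (j' i) n s - Phi (j' i) n' s)) =
    \sum_i l%:Z * c' i * Phi (j' i) n s - l%:Z * \sum_i c' i * Phi (j' i) n' s.
  by rewrite mulr_sumr -sumrB; apply: eq_bigr => i _; ring.
apply: (dvdz_transport (rpredB d1 d2)); rewrite E2 mulrBr -chi'E // /th; ring.
Qed.

End DualBasis.

(** * Compactness *)

Section Compactness.
Local Open Scope classical_set_scope.
Variables (K : closedFieldType) (N : K -> Prop).
Hypothesis aN : forall x, algP N x.
Local Notation G := (N_emb N).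

(* Along an ultrafilter containing all the [D j], each [s x] is eventually constant,
   since it ranges over the finitely many conjugates of [x]. *)
Lemma compact_embeddings (J : eqType) (D : J -> (K -> K) -> Prop) :
    (forall r : seq J, exists2 s, G s & forall j, j \in r -> D j s) ->
    (forall j, exists ys : seq K, forall s t, G s -> G t -> agree ys s t -> D j s -> D j t) ->
  exists2 s, G s & forall j, D j s.
Proof.
move=> fip Dclosed.
pose F : set_system (K -> K) := [set X | exists r : seq J, forall s, G s ->
  (forall j, j \in r -> D j s) -> X s].
have FF : ProperFilter F.
  apply: Build_ProperFilter_ex => [X [r hr]|].
    by have [s hs Ds] := fip r; exists s; apply: hr.
  split; first by exists [::].
  - move=> X Y [r hr] [r' hr']; exists (r ++ r') => s hs Ds; split.
      by apply: hr => // j jr; apply: Ds; rewrite mem_cat jr.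
    by apply: hr' => // j jr; apply: Ds; rewrite mem_cat jr orbT.
  - by move=> X Y XY [r hr]; exists r => s hs Ds; apply/XY/hr.
have [U [Uultra FU]] := ultraFilterLemma FF.
have UG : U [set s | G s] by apply: FU; exists [::].
have UD j : U [set s | D j s].
  by apply: FU; exists [:: j] => s _; apply; rewrite inE.
have /choice[f fE] x : exists y, U [set s | s x = y].
  have [r rE] := emb_fin_orbit (aN x).
  have : U [set s | s x \in r] by apply: filterS UG => s; apply: rE.
  elim: r {rE} => [|y r IH] Ur.
    by case: (filter_not_empty U); apply: filterS Ur => s.
  have [Uy|Uny] := in_ultra_setVsetC [set s | s x = y] Uultra; first by exists y.
  apply: IH; apply: filterS (filterI Ur Uny) => s [] /=.
  by rewrite inE => /orP[/eqP|].
have Uf (ys : seq K) : U [set s | agree ys s f].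
  elim: ys => [|y ys IH]; first by apply: filterS UG => s _ y.
  apply: filterS (filterI (fE y) IH) => s [sy sys] z.
  by rewrite inE => /orP[/eqP->|/sys].
have pickU (X : set (K -> K)) : U X -> exists s, X s by apply: filter_ex.
have Gf : G f.
  split.
  - move=> x y; have [s [hs st]] := pickU _ (filterI UG (Uf [:: x; y; x + y])).
    by rewrite -!st ?inE ?eqxx ?orbT // (embD hs).
  - move=> x y; have [s [hs st]] := pickU _ (filterI UG (Uf [:: x; y; x * y])).
    by rewrite -!st ?inE ?eqxx ?orbT // (embM hs).
  - have [s [hs st]] := pickU _ (filterI UG (Uf [:: 1])).
    by rewrite -!st ?inE ?eqxx // (emb1 hs).
  - move=> x Nx; have [s [hs st]] := pickU _ (filterI UG (Uf [:: x])).
    by rewrite -!st ?inE ?eqxx // (emb_id hs).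
exists f => // j; have [ys ysD] := Dclosed j.
have [s [[hs Ds] st]] := pickU _ (filterI (filterI UG (UD j)) (Uf ys)).
exact: ysD Ds.
Qed.

End Compactness.

(** * Abelian duality *)

Section AbelianDuality.
Variables (K : closedFieldType) (N : K -> Prop).
Local Notation G := (N_emb N).
Local Notation is_char := (is_char N).

(** The action on [r] factors through a finite abelian group of permutations, whose linear
    characters separate its elements. Their values are powers of one complex root of unity, and the
    exponents are the characters sought. *)
Lemma max_ab_characters y : max_ab_ext N y ->
  exists n m (chi : 'I_m -> (K -> K) -> int), [/\ (0 < n)%N, forall i, is_char n (chi i) &
    forall s, G s -> (forall i, (n%:Z %| chi i s)%Z) -> s y = y].
Proof.
move=> [r [yr ur Nr comm_r]].
have rroot z : (z \in r) = root (\prod_(x <- r) ('X - x%:P)) z by rewrite root_prod_XsubC.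
have sr s z : G s -> z \in r -> s z \in r.
  by move=> hs; rewrite !rroot; exact: (emb_root hs Nr).
have /choice[sg sgE] s : exists p : 'S_(size r), G s -> forall i : 'I_(size r), s r`_i = r`_(p i).
  have [hs|nhs] := pselect (G s); last by exists 1%g.
  have idx (i : 'I_(size r)) : (index (s (r`_i)%R) r < size r)%N.
    by rewrite index_mem; apply/sr/mem_nth.
  have fi : injective (fun i => Ordinal (idx i)).
    move=> i j /(congr1 val)/= E; apply: val_inj; apply/eqP.
    rewrite -(nth_uniq 0 (ltn_ord i) (ltn_ord j) ur); apply/eqP/(emb_inj hs).
    have := congr1 (nth 0 r) E; rewrite !nth_index //; exact/sr/mem_nth.
  exists (perm fi) => _ i; rewrite permE /= nth_index //; exact/sr/mem_nth.
have sg_eq s (p : 'S_(size r)) : G s -> (forall i : 'I_(size r), s r`_i = r`_(p i)) -> sg s = p.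
  move=> hs E; apply/permP => i; apply: val_inj; apply/eqP.
  have := sgE s hs i; rewrite E => Es.
  by rewrite -(nth_uniq 0 (ltn_ord _) (ltn_ord _) ur); apply/eqP; rewrite -Es.
pose A := [set p | `[< exists2 s, G s & sg s = p >]].
have AP p : reflect (exists2 s, G s & sg s = p) (p \in A) by rewrite inE; apply: asboolP.
(* Products of permutations act from left to right, hence the reversal. *)
have sgM s t : G s -> G t -> sg (s \o t) = (sg t * sg s)%g.
  move=> hs ht; apply: sg_eq => [|i]; first exact: emb_comp.
  by rewrite permM /= (sgE t) // (sgE s).
have A_group : group_set A.
  apply/group_setP; split.
    by apply/AP; exists id => //; apply: sg_eq => // i; rewrite perm1.
  move=> p q /AP[s hs <-] /AP[t ht <-]; apply/AP; exists (t \o s); first exact: emb_comp.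
  exact: sgM.
pose gA := Group A_group.
have gAab : abelian gA.
  apply/centsP => p /AP[s hs <-] q /AP[t ht <-]; rewrite /commute -!sgM //.
  apply: sg_eq => [|i]; first exact: emb_comp.
  rewrite -sgE; last exact: emb_comp.
  by rewrite /= comm_r // mem_nth.
have lin t : 'chi[gA]_t \is a linear_char by have /char_abelianP := gAab; apply.
have n0 : (0 < #|gA|)%N by apply: cardG_gt0.
have [z zP] := C_prim_root_exists n0.
have /choice[e eE] (tp : Iirr gA * 'S_(size r)) : exists k : int, tp.2 \in gA -> 'chi_tp.1 tp.2 = z ^ k.
  have [Ap|_] := boolP (tp.2 \in gA); last by exists 0.
  have [|i iE] := prim_rootP zP (x := 'chi_tp.1 tp.2).
    by rewrite -(lin_charX (lin _)) // expg_cardG // lin_char1.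
  by exists i => _; rewrite -exprnP.
have Asg s : G s -> sg s \in gA by move=> hs; apply/AP; exists s.
exists #|gA|, (Nirr gA), (fun t s => e (t, sg s)); split=> //.
- move=> t; split=> [s u hs hu|].
    rewrite -(prim_exprz_eq zP) expfzDr ?(prim_neq0 zP) //.
    rewrite -(eE (t, _) (Asg _ (emb_comp hs hu))) -(eE (t, _) (Asg _ hs)) -(eE (t, _) (Asg _ hu)) /=.
    by rewrite sgM // (lin_charM (lin t)) ?Asg // mulrC.
  exists r; split=> [x xr|s u hs hu su].
    exists (\prod_(x <- r) ('X - x%:P)); split=> //; last by rewrite -rroot.
    by rewrite monic_neq0 // monic_prod_XsubC.
  suff -> : sg s = sg u by rewrite subrr dvdz0.
  by apply: sg_eq => // i; rewrite -sgE // su // mem_nth.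
(* The kernels of the linear characters meet in the derived subgroup, which is trivial. *)
- move=> s hs h; have sg1 : sg s = 1%g.
    have : sg s \in \bigcap_(i | 'chi[gA]_i \is a linear_char) cfker 'chi_i.
      apply/bigcapP => t _; rewrite cfkerEirr inE (lin_char1 (lin t)).
      by rewrite (eE (t, _) (Asg _ hs)) /= (prim_exprz_eq1 zP).
    by rewrite cap_cfker_lin_irr (derG1P gAab) => /set1P.
  have iy : (index y r < size r)%N by rewrite index_mem.
  have := sgE s hs (Ordinal iy); rewrite sg1 perm1 /= nth_index //.
Qed.

End AbelianDuality.

(** * The isomorphism *)

Definition residue (a : int) (n : nat) : nat := `|(a %% n.+1%:Z)%Z|%N.

Lemma residueE a n : (residue a n)%:Z = (a %% n.+1%:Z)%Z.
Proof. by rewrite /residue gez0_abs // modz_ge0. Qed.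

Lemma residue_lt a n : (residue a n < n.+1)%N.
Proof. by rewrite -ltz_nat residueE ltz_pmod. Qed.

Lemma residue_dvd a n : (n.+1%:Z %| (residue a n)%:Z - a)%Z.
Proof. by rewrite residueE -eqz_mod_dvd modz_mod. Qed.

Lemma residue_eqP a b n : reflect (residue a n = residue b n) (n.+1%:Z %| a - b)%Z.
Proof.
rewrite -eqz_mod_dvd -!residueE eqz_nat; exact: eqP.
Qed.

Lemma residue_nat k a n : (k < n.+1)%N -> (n.+1%:Z %| a - k%:Z)%Z -> residue a n = k.
Proof.
move=> kn /residue_eqP->; apply/eqP; rewrite -eqz_nat residueE.
by rewrite modz_nat modn_small.
Qed.

Lemma residue_eq0 a n : residue a n = 0%N <-> (n.+1%:Z %| a)%Z.
Proof.
split=> [E|d]; first by have := residue_dvd a n; rewrite E sub0r rpredN.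
by apply: residue_nat; rewrite ?subr0.
Qed.

Section Assembly.
Variables (K : closedFieldType) (N : K -> Prop).
Hypothesis hN : is_subfield N.
Local Notation G := (N_emb N).
Local Notation is_char := (is_char N).
Hypothesis perfN : forall e x, [pchar K].-nat e -> N x -> exists2 w, N w & w ^+ e = x.
Hypothesis rootsN : forall n (z : K), (0 < n)%N -> z ^+ n = 1 -> N z.

Variables (I : eqType) (Phi : I -> nat -> (K -> K) -> int).
Hypotheses (Phi_zchar : forall i, zchar N (Phi i))
  (Phi_indep : forall l, prime l -> char_indep N l setT (fun i => Phi i l))
  (Phi_spans : forall l, prime l -> char_spans N l (fun i => Phi i l)).

Lemma max_ab_coordinates y : max_ab_ext N y -> exists n (js : seq I), (0 < n)%N /\
  forall s, G s -> (forall i, i \in js -> (n%:Z %| Phi i n s)%Z) -> s y = y.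
Proof.
move=> /max_ab_characters[n [m [chi [n0 hchi sep]]]].
have /choice[js jsE] t : exists js : seq I, forall s, G s ->
    (forall i, i \in js -> (n%:Z %| Phi i n s)%Z) -> (n%:Z %| chi t s)%Z.
  have [m' [j [c cE]]] := span_mod Phi_zchar Phi_spans n0 (hchi t).
  exists [seq j i | i <- enum 'I_m'] => s hs js0.
  have d : (n%:Z %| \sum_i c i * Phi (j i) n s)%Z.
    by apply: rpred_sum => i _; apply/dvdz_mull/js0/map_f; rewrite mem_enum.
  by have := rpredD (cE s hs) d; rewrite subrK.
exists n, (flatten [seq js t | t <- enum 'I_m]); split=> // s hs js0.
apply: sep => // t; apply: jsE => // i it; apply: js0.
by apply/flattenP; exists (js t) => //; apply: map_f; rewrite mem_enum.
Qed.

Lemma max_ab_coordinates_fin l (y : 'I_l -> K) : (forall u, max_ab_ext N (y u)) ->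
  exists m (j : 'I_m -> I) (k : nat), forall s, G s ->
    (forall u, residue (Phi (j u) k.+1 s) k = 0%N) -> forall u, s (y u) = y u.
Proof.
move=> yab; have /choice[n /choice[js h]] u := max_ab_coordinates (yab u).
pose P := (\prod_u n u)%N; have P0 : (0 < P)%N by apply/prodn_gt0 => u; case: (h u).
pose r := flatten [seq js u | u <- enum 'I_l].
(* [P.-1] because coordinate [k] is a residue modulo [k + 1]. *)
exists (size r), (tnth (in_tuple r)), P.-1 => s hs r0 u; have [nu hu] := h u.
apply: hu => // i iu; have nP : (n u %| P)%N by rewrite /P (bigD1 u) //= dvdn_mulr.
have ir : i \in r.
  by apply/flattenP; exists (js u) => //; apply: map_f; rewrite mem_enum.
have /tnthP[a ia] : i \in in_tuple r by [].
have d : (P%:Z %| Phi i P s)%Z by rewrite -(prednK P0) ia; apply/residue_eq0.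
have nPz : ((n u)%:Z %| P%:Z)%Z by rewrite dvdzE.
have [_ cmp] := Phi_zchar i.
by have := rpredB (dvdz_trans nPz d) (cmp _ _ s P0 nP hs); rewrite opprB addrC subrK.
Qed.

Lemma Phi_continuous i k : exists ys : seq K, (forall y, y \in ys -> max_ab_ext N y) /\
  forall s t, G s -> G t -> agree ys s t -> residue (Phi i k.+1 s) k = residue (Phi i k.+1 t) k.
Proof.
have [ch _] := Phi_zchar i; have [ys [yab ysE]] := char_max_ab hN perfN (ch k.+1 isT).
by exists ys; split=> // s t hs ht st; apply/residue_eqP/ysE.
Qed.

(** Finitely many requirements follow from prescribing finitely many coordinates modulo the product
    of the moduli. Compactness then gives all of them at once; it is applied over [N'], over which
    [K] is algebraic. *)
Lemma Phi_surjective (z : I -> nat -> nat) : (forall i, zhat_elt (z i)) ->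
  exists s, G s /\ forall i n, residue (Phi i n.+1 s) n = z i n.
Proof.
move=> hz; have [N' [hN' NN' aN' rN']] := regular_extension hN.
have emb' s : N_emb N' s -> G s by apply: emb_sub.
have [||s hs sE] := @compact_embeddings K N' aN' _ (fun (p : I * nat) s =>
    residue (Phi p.1 p.2.+1 s) p.2 = z p.1 p.2).
- move=> r; pose P := (\prod_(p <- r) p.2.+1)%N; have P0 : (0 < P)%N by apply/prodn_gt0.
  pose js := undup [seq p.1 | p <- r].
  have ji : injective (tnth (in_tuple js)) by apply/tuple_uniqP/undup_uniq.
  have [s hs sE] := dual_mod hN perfN rootsN hN' NN' aN' rN' Phi_zchar Phi_indep
    (fun i => (z (tnth (in_tuple js) i) P.-1)%:Z) P0 ji.
  exists s => // -[i n] inr /=.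
  have /tnthP[a ia] : i \in in_tuple js by rewrite mem_undup; apply: (map_f fst inr).
  have nP : (n.+1 %| P)%N by rewrite /P (big_rem (i, n)) //= dvdn_mulr.
  have [zlt zcmp] := hz i; apply: residue_nat; first exact: zlt.
  have nPz : (n.+1%:Z %| P%:Z)%Z by rewrite dvdzE.
  have [_ cmp] := Phi_zchar i; have d1 := cmp _ _ s P0 nP (emb' _ hs).
  have d2 := dvdz_trans nPz (sE a); rewrite -ia in d2.
  have d3 : (n.+1%:Z %| (z i P.-1)%:Z - (z i n)%:Z)%Z.
    by rewrite -eqz_mod_dvd !modz_nat eqz_nat -(zcmp n P.-1) ?prednK // modn_mod.
  apply: (dvdz_transport (rpredD (rpredB d2 d1) d3)); ring.
- move=> [i n]; have [ys [_ ysE]] := Phi_continuous i n; exists ys => s t hs ht st /= <-.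
  by apply/esym/ysE => //; apply: emb'.
by exists s; split; [apply: emb'|move=> i n; apply: (sE (i, n))].
Qed.

Lemma Phi_comp s t i n : G s -> G t ->
  residue (Phi i n.+1 (s \o t)) n = ((residue (Phi i n.+1 s) n + residue (Phi i n.+1 t) n) %% n.+1)%N.
Proof.
move=> hs ht; apply: residue_nat; first by rewrite ltn_mod.
have [ch _] := Phi_zchar i; have [hM _] := ch n.+1 isT; have d := hM s t hs ht.
rewrite -modz_nat PoszD; set a := (residue _ n)%:Z; set b := (residue _ n)%:Z.
have dm : (n.+1%:Z %| (a + b) - ((a + b) %% n.+1%:Z)%Z)%Z by rewrite -eqz_mod_dvd modz_mod.
have da := residue_dvd (Phi i n.+1 s) n; have db := residue_dvd (Phi i n.+1 t) n.
apply: (dvdz_transport (rpredD (rpredB (rpredB d da) db) dm)); rewrite -/a -/b; ring.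
Qed.

Lemma Phi_zhat s i : G s -> zhat_elt (fun n => residue (Phi i n.+1 s) n).
Proof.
move=> hs; split=> [n|m n mn]; first exact: residue_lt.
apply/esym/residue_nat; first by rewrite ltn_mod.
have [_ cmp] := Phi_zchar i; have d := cmp m.+1 n.+1 s isT mn hs.
have mnz : (m.+1%:Z %| n.+1%:Z)%Z by rewrite dvdzE.
have d1 := dvdz_trans mnz (residue_dvd (Phi i n.+1 s) n).
rewrite -modz_nat; set a := (residue _ n)%:Z in d1 *.
have dm : (m.+1%:Z %| a - (a %% m.+1%:Z)%Z)%Z by rewrite -eqz_mod_dvd modz_mod.
apply: (dvdz_transport (rpredB dm (rpredD d1 d))); ring.
Qed.

Lemma Phi_kernel s y : G s -> (forall i n, residue (Phi i n.+1 s) n = 0%N) ->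
  max_ab_ext N y -> s y = y.
Proof.
move=> hs s0 yab; have [m [j [k h]]] := max_ab_coordinates_fin (fun _ : 'I_1 => yab).
exact: (h s hs _ ord0).
Qed.

(** [s] may have no inverse among the embeddings. Surjectivity supplies [u] with coordinates
    opposite to those of [s]; then [u \o s] and [u \o t] have zero coordinates and fix [y], and [u]
    is injective. *)
Lemma Phi_injective s t y : G s -> G t ->
    (forall i n, residue (Phi i n.+1 s) n = residue (Phi i n.+1 t) n) ->
  max_ab_ext N y -> s y = t y.
Proof.
move=> hs ht st yab.
have [|u [hu uE]] := @Phi_surjective (fun i n => residue (- Phi i n.+1 s) n).
  move=> i; split=> [n|m n mn]; first exact: residue_lt.
  apply/esym/residue_nat; first by rewrite ltn_mod.
  have [_ cmp] := Phi_zchar i; have d := cmp m.+1 n.+1 s isT mn hs.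
  have mnz : (m.+1%:Z %| n.+1%:Z)%Z by rewrite dvdzE.
  have d1 := dvdz_trans mnz (residue_dvd (- Phi i n.+1 s) n).
  rewrite -modz_nat; set a := (residue _ n)%:Z in d1 *.
  have dm : (m.+1%:Z %| a - (a %% m.+1%:Z)%Z)%Z by rewrite -eqz_mod_dvd modz_mod.
  apply: (dvdz_transport (rpredB dm (rpredB d1 d))); ring.
have ker v : G v -> (forall i n, residue (Phi i n.+1 v) n = residue (Phi i n.+1 s) n) ->
    u (v y) = y.
  move=> hv vE; apply: (@Phi_kernel (u \o v)) => //; first exact: emb_comp.
  move=> i n; rewrite Phi_comp // uE vE; apply/eqP; rewrite -/(dvdn _ _).
  have d := rpredD (residue_dvd (- Phi i n.+1 s) n) (residue_dvd (Phi i n.+1 s) n).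
  rewrite -[(_ %| _)%N]/((n.+1%:Z %| (_ + _)%N%:Z)%Z) PoszD.
  by apply: (dvdz_transport d); ring.
by apply: (emb_inj hu); rewrite !ker.
Qed.

Lemma zhat_pow_iso :
  galois_ab_iso_zhat_pow N (fun s i n => residue (Phi i n.+1 s) n).
Proof.
split; first by move=> s hs i; apply: Phi_zhat.
split.
  move=> s t hs ht st i n; have [ys [yab ysE]] := Phi_continuous i n.
  by apply: ysE => // y /yab/st.
split; first by move=> s t hs ht i n; apply: Phi_comp.
split; first by move=> s t hs ht st y; apply: Phi_injective.
split; first exact: Phi_surjective.
split; last exact: max_ab_coordinates_fin.
move=> m j k; have /choice[ys ysE] u := Phi_continuous (j u) k.
pose r := flatten [seq ys u | u <- enum 'I_m].
exists (size r), (tnth (in_tuple r)); split.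
  move=> a; have /flattenP[_ /mapP[u _ ->]] : tnth (in_tuple r) a \in r by apply: mem_tnth.
  by case: (ysE u) => h _; apply: h.
move=> s hs sr u; have [_ h] := ysE u; rewrite (h s id) //.
  have [ch _] := Phi_zchar (j u).
  by apply/residue_eq0; apply: char_id (ch k.+1 isT).
move=> y yu; have /tnthP[a ->] : y \in in_tuple r; last exact: sr.
by apply/flattenP; exists (ys u) => //; apply: map_f; rewrite mem_enum.
Qed.

End Assembly.

(** * Characters of a compositum *)

Section CompositumCharacters.
Variables (K : closedFieldType) (L M : K -> Prop).
Hypotheses (hL : alg_closed_subfield L) (hM : alg_closed_subfield M).
Hypothesis hdisj : linearly_disjoint (fun x => L x /\ M x) L M.
Local Notation N := (compositum L M).
Local Notation G := (N_emb N).
Let hN : is_subfield N := compositum_subfield L M.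
Let hNR := subfield_subring hN.
Let hA := alg_subfield hN.
Let hAR := subfield_subring hA.

Lemma compositum_roots n (z : K) : (0 < n)%N -> z ^+ n = 1 -> N z.
Proof.
move=> n0 zn; apply: compositum_l; have [hLf _] := hL.
apply: (alg_closed_in hL); apply: (algX_inv hLf n0); rewrite zn.
exact/(alg_id hLf)/(subring1 (subfield_subring hLf)).
Qed.

Lemma alg_closed_power_root (S : K -> Prop) n x : alg_closed_subfield S -> (0 < n)%N -> S x ->
  exists2 w, S w & w ^+ n = x.
Proof.
move=> hS n0 Sx; have [hSf cS] := hS; have hSR := subfield_subring hSf.
have [||w [Sw wx]] := cS ('X^n - x%:P); first by rewrite size_XnsubC.
  by apply: (poly_inB hSR); [apply/(poly_inXn hSR)/(poly_inX hSR)|apply: (poly_inC hSR)].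
by exists w => //; move: wx; rewrite /root !hornerE subr_eq0 => /eqP.
Qed.

(** Taking [e]-th powers is additive, so the elements with an [e]-th root in [N] form a subfield; it
    contains [L] and [M]. *)
Lemma compositum_perfect e x : [pchar K].-nat e -> N x -> exists2 w, N w & w ^+ e = x.
Proof.
move=> pe Nx; have e0 : (0 < e)%N by case/andP: pe.
apply: (Nx (fun x => exists2 w, N w & w ^+ e = x)) => [|y Ly|y My]; last 2 first.
- have [w Lw wy] := alg_closed_power_root hL e0 Ly.
  by exists w => //; apply: compositum_l.
- have [w Mw wy] := alg_closed_power_root hM e0 My.
  by exists w => //; apply: compositum_r.
split.
- by exists 0; [apply: (subring0 hNR)|rewrite expr0n eqn0Ngt e0].
- by exists 1; [apply: (subring1 hNR)|rewrite expr1n].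
- move=> _ _ [u Nu <-] [w Nw <-]; exists (u - w); first exact: (subringB hNR).
  by rewrite exprDn_pchar ?exprNn_pchar.
- by move=> _ _ [u Nu <-] [w Nw <-]; exists (u * w); [apply: (subringM hNR)|rewrite exprMn].
- by move=> _ [u Nu <-]; exists u^-1; [apply: (subfieldV hN)|rewrite exprVn].
Qed.

Variable y : K.
Hypotheses (My : M y) (nLy : ~ L y).
Let A : set K := fun a => L a /\ ~ M a.

Let ya a : A a -> y - a != 0.
Proof. by move=> [La _]; apply/eqP => /subr0_eq E; apply: nLy; rewrite E. Qed.

Let Nya a : A a -> N (y - a).
Proof.
by move=> [La _]; apply: (subringB hNR); [apply: compositum_r|apply: compositum_l].
Qed.

(** Relations between characters have integer coefficients, while the independence results take
    natural numbers; reduction modulo [l] connects them. *)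
Let int_rep (l : nat) (c : int) : (0 < l)%N -> exists k : nat, (l%:Z %| c - k%:Z)%Z.
Proof.
move=> l0; exists `|(c %% l%:Z)%Z|%N; rewrite gez0_abs ?modz_ge0 ?eqz_nat -?lt0n //.
by rewrite -eqz_mod_dvd modz_mod.
Qed.

Let sum_rep l n (c : 'I_n -> int) (k : 'I_n -> nat) (v : 'I_n -> int) :
  (forall i, (l%:Z %| c i - (k i)%:Z)%Z) -> (l%:Z %| \sum_i c i * v i)%Z ->
  (l%:Z %| \sum_i (k i)%:Z * v i)%Z.
Proof.
move=> ck d; have d' : (l%:Z %| \sum_i (c i - (k i)%:Z) * v i)%Z.
  by apply: rpred_sum => i _; apply: dvdz_mulr.
apply: (dvdz_transport (rpredB d d')); rewrite -sumrB; apply: eq_bigr => i _; ring.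
Qed.

(** A relation modulo [l] says that the product [w] of powers of [l]-th roots of the [y - a] is
    fixed, hence in [N]; then the product of the same powers of the [y - a] is [w^l], and [l]
    divides all exponents. *)
Lemma kummer_family l : prime l -> l \notin [pchar K] ->
  exists chi : K -> (K -> K) -> int, (forall a, A a -> is_char N l (chi a)) /\
    char_indep N l A chi.
Proof.
move=> l_pr lK; have l0 := prime_gt0 l_pr.
have lK0 : l%:R != 0 :> K by move: lK; rewrite inE /= l_pr.
have [z zP] := prim_root_exists lK0.
have /choice[x xE] a : exists x : K, x ^+ l = y - a.
  have [|x] := @closed_root K ('X^l - (y - a)%:P); first by rewrite size_XnsubC.
  by rewrite /root !hornerE subr_eq0 => /eqP; exists x.
have ax a : A a -> algP N (x a).
  by move=> Aa; apply: (algX_inv hN l0); rewrite xE; apply: (alg_id hN); apply: Nya.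
have x0 a : A a -> x a != 0.
  by move=> Aa; have := ya Aa; rewrite -xE expf_eq0 l0.
have /choice[chi chiE] a : exists chi, A a -> is_char N l chi /\
    forall s, G s -> s (x a) = z ^ chi s * x a.
  have [Aa|?] := pselect (A a); last by exists (fun _ => 0).
  have [|chi hchi chiE] := kummer_char compositum_roots zP (x0 _ Aa) (ax _ Aa).
    by move=> s hs; rewrite -(embX hs) xE (emb_id hs (Nya Aa)).
  by exists chi.
exists chi; split=> [a /chiE[]//|n a ai Aa c cv i].
have /choice[k ck] j := int_rep (c j) l0.
have {}cv s (hs : G s) := sum_rep ck (cv s hs).
pose w := \prod_j x (a j) ^+ k j.
have Nw : N w.
  apply: (fixedN hN compositum_perfect) => [|s hs].
    by apply: (subring_prod hAR) => j _; apply: (subringX hAR); apply: ax.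
  rewrite (emb_prod hs).
  transitivity (\prod_j (z ^ ((k j)%:Z * chi (a j) s) * x (a j) ^+ k j)).
    apply: eq_bigr => j _; rewrite (embX hs); have [_ ->] := chiE _ (Aa j); last by [].
    by rewrite exprMn [_ * chi _ _]mulrC -exprz_exp.
  rewrite big_split /= [X in X * _](_ : _ = 1) ?mul1r //.
  have z0 := prim_neq0 zP.
  have zD : {morph (fun m : int => z ^ m) : m m' / m + m' >-> m * m'}.
    by move=> m m'; rewrite expfzDr.
  rewrite -(big_morph _ zD (expr0z z)).
  by apply/eqP; rewrite (prim_exprz_eq1 zP); apply: cv.
have cop e : [pchar K].-nat e -> coprime l e.
  move=> pe; rewrite prime_coprime //; apply: contra lK => le.
  have e0 : (0 < e)%N by case/andP: pe.
  by move/(pnatP _ e0): pe; apply.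
have E : \prod_j (y - a j) ^+ k j = w ^+ l.
  by rewrite -prodrXl; apply: eq_bigr => j _; rewrite -xE exprAC.
have La j : L (a j) by case: (Aa j).
have nMa j : ~ M (a j) by case: (Aa j).
have := power_independent hL hM hdisj My nLy ai La nMa Nw l0 cop E i => lk.
by apply: (dvdz_transport (rpredD (ck i) (_ : (l%:Z %| (k i)%:Z)%Z))); [rewrite dvdzE|ring].
Qed.

(** As in the Kummer case, with [w] a sum of multiples of Artin-Schreier roots of the
    [1 / (y - a)]. *)
Lemma artin_schreier_family p : p \in [pchar K] ->
  exists chi : K -> (K -> K) -> int, (forall a, A a -> is_char N p (chi a)) /\
    char_indep N p A chi.
Proof.
move=> pcp; have p_pr := pcharf_prime pcp; have p0 := prime_gt0 p_pr.
have p_nat : [pchar K].-nat p by rewrite (eq_pnat _ (pcharf_eq pcp)) pnat_id.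
have powD (u v : K) : (u + v) ^+ p = u ^+ p + v ^+ p by rewrite exprDn_pchar.
have powB (u v : K) : (u - v) ^+ p = u ^+ p - v ^+ p by rewrite powD exprNn_pchar.
have /choice[x xE] a : exists x : K, x ^+ p - x = (y - a)^-1.
  have [|x] := @closed_root K ('X^p - 'X - ((y - a)^-1)%:P).
    by rewrite size_artin_schreier ?ltnS ?prime_gt1.
  by rewrite /root !hornerE subr_eq0 => /eqP; exists x.
have NV a : A a -> N (y - a)^-1 by move=> Aa; apply: (subfieldV hN); apply: Nya.
have ax a : A a -> algP N (x a).
  move=> Aa; apply: (@alg_root _ _ hN ('X^p - 'X - ((y - a)^-1)%:P)).
  - by rewrite -size_poly_gt0 size_artin_schreier ?prime_gt1.
  - apply: (poly_inB hAR); last by apply: (poly_inC hAR); apply: (alg_id hN); apply: NV.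
    by apply: (poly_inB hAR); [apply: (poly_inXn hAR)|]; apply: (poly_inX hAR).
  - by rewrite /root !hornerE xE subrr.
have /choice[chi chiE] a : exists chi, A a -> is_char N p chi /\
    forall s, G s -> s (x a) = x a + (chi s)%:~R.
  have [Aa|?] := pselect (A a); last by exists (fun _ => 0).
  have [|chi hchi chiE] := artin_schreier_char hN pcp (ax _ Aa).
    move=> s hs; have := emb_id hs (NV _ Aa); rewrite -xE (embB hs) (embX hs) => E.
    rewrite powB; apply/eqP; rewrite -subr_eq0.
    have -> : s (x a) ^+ p - x a ^+ p - (s (x a) - x a) =
      (s (x a) ^+ p - s (x a)) - (x a ^+ p - x a) by ring.
    by rewrite E subrr.
  by exists chi.
exists chi; split=> [a /chiE[]//|n a ai Aa c cv i].
have /choice[k ck] j := int_rep (c j) p0.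
have {}cv s (hs : G s) := sum_rep ck (cv s hs).
pose w := \sum_j (k j)%:R * x (a j).
have Nw : N w.
  apply: (fixedN hN compositum_perfect) => [|s hs].
    apply: (subring_sum hAR) => j _; apply: (subringM hAR); last exact: ax.
    by apply: (subringMn hAR); apply: (subring1 hAR).
  rewrite (emb_sum hs).
  transitivity (\sum_j ((k j)%:R * x (a j) + ((k j)%:Z * chi (a j) s)%:~R)).
    apply: eq_bigr => j _; rewrite (embM hs) (embMn hs) (emb1 hs).
    have [_ ->] := chiE _ (Aa j); last by [].
    by rewrite mulrDr intrM -pmulrn.
  rewrite big_split /= -rmorph_sum /=.
  have /eqP-> : (\sum_j (k j)%:Z * chi (a j) s)%:~R == 0%:~R :> K.
    by rewrite (intr_pchar_eq _ _ pcp) subr0; apply: cv.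
  by rewrite addr0.
have E : \sum_j (k j)%:R / (y - a j) = w ^+ p - w.
  have -> : w ^+ p = \sum_j (k j)%:R * x (a j) ^+ p.
    rewrite /w (big_morph (fun m => m ^+ p) powD (_ : 0 ^+ p = 0)); last first.
      by rewrite expr0n eqn0Ngt p0.
    apply: eq_bigr => j _; rewrite exprMn; congr (_ * _).
    by rewrite -(pFrobenius_autE pcp) pFrobenius_aut_nat.
  by rewrite -sumrB; apply: eq_bigr => j _; rewrite -mulrBr xE.
have La j : L (a j) by case: (Aa j).
have nMa j : ~ M (a j) by case: (Aa j).
have := artin_schreier_independent hL hM hdisj My nLy ai La nMa Nw pcp E i => lk.
by apply: (dvdz_transport (rpredD (ck i) (_ : (p%:Z %| (k i)%:Z)%Z))); [rewrite dvdzE|ring].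
Qed.

Lemma compositum_iso a0 : A a0 -> injects (M : set K) (L : set K) ->
  exists (I : Type) (Phi : (K -> K) -> I -> nat -> nat),
    same_card I N /\ galois_ab_iso_zhat_pow N Phi.
Proof.
move=> [La0 nMa0] ML; have NA : injects (N : set K) A by apply: compositum_injects La0 nMa0 ML.
have /choice[v vE] l : exists v : (N : set K) -> (K -> K) -> int, prime l ->
    [/\ forall i, is_char N l (v i), char_indep N l setT v & char_spans N l v].
  have [l_pr|_] := boolP (prime l); last by exists (fun _ _ => 0).
  have [chi [chi_char chi_indep]] : exists chi : K -> (K -> K) -> int,
      (forall a, A a -> is_char N l (chi a)) /\ char_indep N l A chi.
    have [lK|lK] := boolP (l \in [pchar K]); first exact: artin_schreier_family.
    exact: kummer_family.
  pose B0 : set ((K -> K) -> int) := fun f => exists2 a, A a & chi a = f.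
  have B0c f : B0 f -> is_char N l f by move=> [a Aa <-]; apply: chi_char.
  have AB0 : injects A B0.
    exists chi; split=> [a Aa|a b Aa Ab E]; first by exists a.
    by apply: (char_indep_inj l_pr chi_indep) => // s _; rewrite E subrr dvdz0.
  have B0i : char_indep N l B0 id.
    move=> n f fi fB; have /choice[a aE] j : exists a, A a /\ chi a = f j.
      by have [a ? ?] := fB j; exists a.
    have ai : injective a.
      by move=> j k ajk; apply: fi; case: (aE j) (aE k) => _ <- [_ <-]; rewrite ajk.
    have Aa j : A (a j) by case: (aE j).
    move=> c cf; apply: (chi_indep n a ai Aa) => s hs; have := cf s hs.
    by under eq_bigr do rewrite -(proj2 (aE _)).
  have NB0 : injects (N : set K) B0 by apply: injects_trans NA AB0.
  have [v vP] := char_basis_indexed hN compositum_perfect compositum_roots l_pr B0c B0i NB0.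
  by exists v.
have vc l i : prime l -> is_char N l (v l i) by move=> /vE[].
have /choice[Phi PhiE] i : exists Phi, zchar N Phi /\
    forall l s, prime l -> G s -> (l%:Z %| Phi l s - v l i s)%Z.
  have [|Phi ? ?] := zchar_exists hN compositum_roots (chi := fun l => v l i).
    by move=> l; apply: vc.
  by exists Phi.
have Phi_zchar i : zchar N (Phi i) by case: (PhiE i).
have Phiv i l s : prime l -> G s -> (l%:Z %| Phi i l s - v l i s)%Z by case: (PhiE i) => _; apply.
(* [Phi] agrees with the basis [v] modulo each prime, so independence and spanning carry over. *)
have Phi_sum l n (j : 'I_n -> (N : set K)) (c : 'I_n -> int) s : prime l -> G s ->
    (l%:Z %| \sum_i c i * Phi (j i) l s - \sum_i c i * v l (j i) s)%Z.
  move=> l_pr hs; rewrite -sumrB; apply: rpred_sum => i _.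
  by rewrite -mulrBr; apply/dvdz_mull/Phiv.
exists (N : set K), (fun s i n => residue (Phi i n.+1 s) n); split.
  exists val; split=> [i|]; first exact: set_mem (valP i).
  split; first exact: val_inj.
  by move=> x Nx; exists (SigSub (mem_set Nx : x \in (N : set K))).
apply: (zhat_pow_iso hN compositum_perfect compositum_roots Phi_zchar) => l l_pr.
- have [_ vi _] := vE l l_pr; move=> n j ji jT c cP; apply: (vi n j ji jT) => s hs.
  by apply: (dvdz_transport (rpredB (cP s hs) (Phi_sum l n j c s l_pr hs))); ring.
- have [_ _ vs] := vE l l_pr; move=> chi /vs[n [j [c cE]]]; exists n, j, c => s hs.
  by apply: (dvdz_transport (rpredB (cE s hs) (Phi_sum l n j c s l_pr hs))); ring.
Qed.

End CompositumCharacters.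

(** * Transport along an embedding *)

Lemma compositumC (F : fieldType) (L M : F -> Prop) : compositum M L = compositum L M.
Proof.
by apply/funext => x; apply/propext; split=> h S hS SL SM; apply: h.
Qed.

Lemma compositum_galois (K : closedFieldType) (L M : K -> Prop) :
    alg_closed_subfield L -> alg_closed_subfield M ->
    ~ (forall x, L x -> M x) -> ~ (forall x, M x -> L x) ->
    linearly_disjoint (fun x => L x /\ M x) L M ->
  exists (I : Type) (Phi : (K -> K) -> I -> nat -> nat),
    same_card I (compositum L M) /\ galois_ab_iso_zhat_pow (compositum L M) Phi.
Proof.
move=> hL hM /existsNP[a /not_implyP[La nMa]] /existsNP[y /not_implyP[My nLy]] hdisj.
(* The larger field must supply the points [a], and the other one [y]. *)
have [ML|LM] := injects_total 0 0 (M : set K) (L : set K).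
  exact: (compositum_iso hL hM hdisj My nLy (conj La nMa) ML).
have hdisj' : linearly_disjoint (fun x => M x /\ L x) M L.
  have CC : (fun x => M x /\ L x) = (fun x => L x /\ M x).
    by apply/funext => x; apply/propext; split=> -[].
  have [hLf _] := hL; rewrite CC.
  apply: (linearly_disjoint_sym (meet_subfield hL hM) hLf _ hdisj).
  by move=> x [].
rewrite -compositumC.
exact: (compositum_iso hM hL hdisj' La nMa (conj My nLy) LM).
Qed.

Section Transport.
Variables (F K : fieldType) (iota : {rmorphism F -> K}).
Implicit Types (S L M : F -> Prop).

Definition image_pred S (y : K) : Prop := exists x, S x /\ iota x = y.

Lemma image_predE S x : image_pred S (iota x) <-> S x.
Proof. by split=> [[x' [Sx' /fmorph_inj <-]]|Sx]; [|exists x]. Qed.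

Lemma image_subfield S : is_subfield S -> is_subfield (image_pred S).
Proof.
move=> [s0 s1 sB sM sV]; split.
- by exists 0; rewrite rmorph0.
- by exists 1; rewrite rmorph1.
- by move=> _ _ [x [Sx <-]] [y [Sy <-]]; exists (x - y); rewrite rmorphB; split=> //; apply: sB.
- by move=> _ _ [x [Sx <-]] [y [Sy <-]]; exists (x * y); rewrite rmorphM; split=> //; apply: sM.
- by move=> _ [x [Sx <-]]; exists x^-1; rewrite fmorphV; split=> //; apply: sV.
Qed.

Lemma image_alg_closed S : alg_closed_subfield S -> alg_closed_subfield (image_pred S).
Proof.
move=> [hS cS]; split; first exact: image_subfield.
move=> p sp Sp; have /choice[q qE] i := Sp i.
pose p0 := \poly_(i < size p) q i.
have p0E : map_poly iota p0 = p.
  apply/polyP => i; rewrite coef_map coef_poly; have [_ qi] := qE i.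
  by case: ltnP => hi; rewrite ?raddf0 ?(nth_default _ hi) //=.
have [||x [Sx xr]] := cS p0.
- by rewrite -(size_map_poly iota) p0E.
- move=> i; rewrite coef_poly; case: ifP => _; first by case: (qE i).
  by case: hS.
- by exists (iota x); split; [exists x|rewrite -p0E fmorph_root].
Qed.

Lemma image_compositum L M : compositum (image_pred L) (image_pred M) = image_pred (compositum L M).
Proof.
apply/funext => y; apply/propext; split.
  apply; first exact/image_subfield/compositum_subfield.
  - by move=> _ [x [Lx <-]]; exists x; split=> //; apply: compositum_l.
  - by move=> _ [x [Mx <-]]; exists x; split=> //; apply: compositum_r.
move=> [x [Nx <-]]; apply: (Nx (fun x => compositum (image_pred L) (image_pred M) (iota x))).
- have [c0 c1 cB cM cV] := compositum_subfield (image_pred L) (image_pred M).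
  split; rewrite ?rmorph0 ?rmorph1 // => u; rewrite ?fmorphV; try exact: cV.
    by move=> v cu cv; rewrite rmorphB; apply: cB.
  by move=> v cu cv; rewrite rmorphM; apply: cM.
- by move=> u Lu; apply: compositum_l; exists u.
- by move=> u Mu; apply: compositum_r; exists u.
Qed.

Lemma image_linearly_disjoint L M : linearly_disjoint (fun x => L x /\ M x) L M ->
  linearly_disjoint (fun x => image_pred L x /\ image_pred M x) (image_pred L) (image_pred M).
Proof.
move=> hdisj n v /choice[w wE] iv c /choice[d dE] E.
have vE i : v i = iota (w i) by case: (wE i).
have cE i : c i = iota (d i) by case: (dE i).
suff d0 : forall i, d i = 0 by move=> i; rewrite cE d0 rmorph0.
apply: (hdisj n w) => [i|b bC b0 i|i|]; [by case: (wE i)| |by case: (dE i)|].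
  apply: (fmorph_inj iota); rewrite rmorph0; apply: (iv (fun i => iota (b i))) => [k|].
    by have [bL bM] := bC k; split; apply/image_predE.
  under eq_bigr do rewrite vE -rmorphM; by rewrite -rmorph_sum b0 rmorph0.
apply: (fmorph_inj iota); rewrite rmorph_sum rmorph0 -[RHS]E; apply: eq_bigr => i _.
by rewrite rmorphM vE cE.
Qed.

End Transport.

Theorem theorem4p1 (F : fieldType) (L M : F -> Prop)
  (hL : alg_closed_subfield L) (hM : alg_closed_subfield M)
  (hLM : ~ (forall x, L x -> M x)) (hML : ~ (forall x, M x -> L x))
  (hdisj : linearly_disjoint (fun x => L x /\ M x) L M)
  (K : closedFieldType) (iota : {rmorphism F -> K}) :
  exists (I : Type) (Phi : (K -> K) -> I -> nat -> nat),
    same_card I (compositum L M) /\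
    galois_ab_iso_zhat_pow (fun y => exists x, compositum L M x /\ iota x = y) Phi.
Proof.
have hLK := image_alg_closed iota hL; have hMK := image_alg_closed iota hM.
have nLM : ~ (forall y, image_pred iota L y -> image_pred iota M y).
  by move=> h; apply: hLM => x /(image_predE iota)/h/image_predE.
have nML : ~ (forall y, image_pred iota M y -> image_pred iota L y).
  by move=> h; apply: hML => x /(image_predE iota)/h/image_predE.
have [I [Phi [[f [fN [f_inj f_surj]]] iso]]] :=
  compositum_galois hLK hMK nLM nML (image_linearly_disjoint hdisj).
rewrite image_compositum in fN f_surj iso; exists I, Phi; split=> //.
have [g gE] := choice fN; exists g; split=> [i|]; first by case: (gE i).
split=> [i j gij|x Nx].
  by apply: f_inj; case: (gE i) (gE j) => _ <- [_ <-]; rewrite gij.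
have [i fi] : exists i, f i = iota x by apply: f_surj; exists x.
by exists i; apply: (fmorph_inj iota); case: (gE i) => _ ->.
Qed.
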